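(* There is a constant $C>0$ such that for every $d\in L^2(\mathbb{R}^3)$ satisfying $d(\pm x_1,\pm x_2,\pm x_3)=d(x_1,x_2,x_3)$ for all choices of signs, one has $$ \int_0^{2\pi}\int_{\mathbb{R}^3}\frac{|e^{-it(-\triangle+|x|^2)}d|^2}{|x|^2}\,dx\,dt\leq C\|d\|_2^2 . $$
   Context: $e^{-it(-\triangle+|x|^2)}$ denotes the unitary propagator on $L^2(\mathbb{R}^3)$ of the equation $i\partial_t u=-\triangle u+|x|^2u$ in $\mathbb{R}^{3+1}$; i.e. $u(\cdot,t)=e^{-it(-\triangle+|x|^2)}d$ is the solution with $u(\cdot,0)=d$. Here $\triangle$ is the Laplacian on $\mathbb{R}^3$ and $\|\cdot\|_2$ is the norm of $L^2(\mathbb{R}^3)$. *)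

(* Defs.v *)
From HB Require Import structures.
From mathcomp Require Import all_boot all_order all_algebra.
From mathcomp Require Import all_classical all_reals all_analysis.
From mathcomp Require Import complex.

Set Implicit Arguments.
Unset Strict Implicit.
Unset Printing Implicit Defensive.

Import Order.TTheory GRing.Theory Num.Theory.
Import numFieldNormedType.Exports.

Local Open Scope classical_set_scope.
Local Open Scope ring_scope.
Local Open Scope complex_scope.

(* Points of the three-dimensional space are ((x1, x2), x3) : R * R * R.      *)

Definition leb3 {R : realType} :=
  ((@lebesgue_measure R \x @lebesgue_measure R) \x @lebesgue_measure R)%E.

HB.instance Definition _ (R : realType) := Measure.on (@leb3 R).

(* The squared Euclidean length: the library norm on a product of normed      *)
(* modules is the sup norm.                                                   *)
Definition sqlen {R : realType} (x : R * R * R) : R :=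
  x.1.1 ^+ 2 + x.1.2 ^+ 2 + x.2 ^+ 2.

Definition reflect3 {R : realType} (s1 s2 s3 : bool) (x : R * R * R) :
    R * R * R :=
  ((-1) ^+ s1 * x.1.1, (-1) ^+ s2 * x.1.2, (-1) ^+ s3 * x.2).

(* Complex L^2: the integration library only has real-valued Lfun and Lnorm,  *)
(* and an L^2 class is represented by any of its members.                     *)
Definition cmod {R : realType} (z : R[i]) : R := ComplexField.Normc.normc z.

Definition memL2 {R : realType} (f : R * R * R -> R[i]) : Prop :=
  (fun x => complex.Re (f x)) \in Lfun (@leb3 R) 2%:E /\
  (fun x => complex.Im (f x)) \in Lfun (@leb3 R) 2%:E.

Definition normL2 {R : realType} (f : R * R * R -> R[i]) : \bar R :=
  ('N[@leb3 R]_2%:E[EFin \o (@cmod R \o f)])%E.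

Definition axis {R : realType} (i : 'I_3) : R * R * R :=
  ((i == 0 :> nat)%:R, (i == 1 :> nat)%:R, (i == 2 :> nat)%:R).

Definition partial {R : realType} (i : 'I_3) (f : R * R * R -> R) :
    R * R * R -> R :=
  fun x => 'D_(axis i) f x.

Definition iter_partial {R : realType} (s : seq 'I_3) (f : R * R * R -> R) :
    R * R * R -> R :=
  foldr partial f s.

Definition laplacian {R : realType} (f : R * R * R -> R) (x : R * R * R) : R :=
  \sum_(i < 3) partial i (partial i f) x.

(* Real Schwartz functions. Existence of all the iterated partial derivatives *)
(* together with their boundedness entails that f is smooth.                  *)
Definition schwartz {R : realType} (f : R * R * R -> R) : Prop :=
  (forall (s : seq 'I_3) (i : 'I_3) (x : R * R * R),
     derivable (iter_partial s f) x (axis i)) /\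
  (forall (s : seq 'I_3) (k : nat), exists M : R, forall x : R * R * R,
     (1 + sqlen x) ^+ k * `|iter_partial s f x| <= M).

Definition oscillator {R : realType} (f : R * R * R -> R) (x : R * R * R) : R :=
  - laplacian f x + sqlen x * f x.

(* The action of f, seen as a tempered distribution, on a real test function. *)
Definition pairing {R : realType} (f : R * R * R -> R[i])
    (phi : R * R * R -> R) : R[i] :=
  (\int[@leb3 R]_x (complex.Re (f x) * phi x)) +i*
  (\int[@leb3 R]_x (complex.Im (f x) * phi x)).

Definition is_cderive {R : realType} (z : R -> R[i]) (t : R) (w : R[i]) : Prop :=
  is_derive t 1 (fun s => complex.Re (z s)) (complex.Re w) /\
  is_derive t 1 (fun s => complex.Im (z s)) (complex.Im w).

(* u(t) = e^{-it(-\triangle+|x|^2)} d: u is the solution in C(R; L^2(R^3)) of  *)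
(* i \partial_t u = -\triangle u + |x|^2 u with u(0) = d. As d is merely in   *)
(* L^2, the equation is meant in the sense of tempered distributions, the     *)
(* symmetric operator -\triangle+|x|^2 being moved to the test function; real *)
(* test functions suffice because the pairing is C-bilinear.                  *)
Record oscillator_flow {R : realType} (d : R * R * R -> R[i])
    (u : R -> R * R * R -> R[i]) : Prop := OscillatorFlow {
  flow_memL2 : forall t : R, memL2 (u t);
  flow_continuous : forall t : R,
    (fun s : R => normL2 (fun x => u s x - u t x)) @ t --> 0%E;
  flow_equation : forall phi : R * R * R -> R, schwartz phi -> forall t : R,
    exists w : R[i], is_cderive (fun s => pairing (u s) phi) t w /\
      'i * w = pairing (u t) (oscillator phi);
  flow_initial : {ae @leb3 R, forall x, u 0 x = d x}
}.

(* Main.v *)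
(* The solution is expanded in the tensor Hermite functions, which are
   eigenfunctions of the oscillator with eigenvalue 2 N + 3 on the level
   N = n_1 + n_2 + n_3. Pairing the equation with one of them makes its coefficient
   rotate, so that the square modulus of the solution, averaged over a period, is
   at every point the sum over N of the square moduli of the level components;
   it is therefore enough to bound the integral of f ^ 2 / |x| ^ 2 by 3 ||f|| ^ 2
   for f in a single level. Writing
     exp (- rho) / rho = int_0^1 2 l ^ -3 exp (- rho / l ^ 2) dl, rho = |x| ^ 2,
   and x = l y turns this integral into an average over l of the square norms of
   P (l y) exp (- |y| ^ 2 / 2), where P is the Hermite sum of the level. The
   re-expansion of P (l y) involves sums Y_k of the coefficients over k + 2 j whose
   weighted square sums V_m satisfy J ^ 2 V_m <= (m + 3) (m + 2) V_{m+2},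
   m + 2 J = N, by Cauchy-Schwarz; with the beta integrals in l this gives a series
   of weights whose sum is at most 3, uniformly in N.
   Completeness of the Hermite functions makes the L^2 norm constant in time
   and the tail of the expansion small uniformly in time, which transfers the bound
   for finite sums to the solution after cutting 1 / |x| ^ 2 off at height b and
   letting b tend to infinity (Fatou). *)

Require Import Defs.
From HB Require Import structures.
From mathcomp Require Import all_boot all_order all_algebra.
From mathcomp Require Import all_classical all_reals all_analysis.
From mathcomp Require Import complex.
From mathcomp Require Import measurable_realfun ring lra zify.

Set Implicit Arguments.
Unset Strict Implicit.
Unset Printing Implicit Defensive.

Import Order.TTheory GRing.Theory Num.Theory.
Import numFieldNormedType.Exports.

Local Open Scope classical_set_scope.
Local Open Scope ring_scope.

(** * Hermite polynomials *)

(** The weight [1 / |x| ^ 2] is unbounded, so no bound follows from the norm of [L^2] alone. Two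
    facts help. Over a period different levels do not interact, because the frequencies [2 N + 3]
    are distinct integers. Inside a level, the squared Hermite functions already carry the factor
    [exp (- rho)], and dilation by [l] turns the kernel back into this Gaussian, so only the
    polynomial factor feels the scaling; its re-expansion comes from the generating function
    [exp (2 y t - t ^ 2)]. Comparing the solution with such a sum costs the factor 2 of
    [(a + b) ^ 2 <= 2 a ^ 2 + 2 b ^ 2], hence the constant [12 pi = 2 * (2 pi * 3)]. Completeness is
    reached without Fourier analysis: Gaussians in one coordinate are multipliers of the closed
    span, polynomials in them converge to indicators of intervals, and a sigma-algebra argument
    gives all measurable sets. *)

Section hermite.
Context {R : realFieldType}.
Implicit Types (l x y : R) (n k : nat).

(** The physicists' Hermite polynomial divided by [n!], that is, the coefficient of [t ^ n] in
    [exp (2 x t - t ^ 2)]. With this normalisation differentiation lowers the index with the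
    constant factor 2, and dilation produces plain inverse factorials. *)
Fixpoint herm n : {poly R} :=
  if n is m.+1 then m.+1%:R^-1 *: (2 *: ('X * herm m) - (herm m)^`()) else 1.

Lemma hermS n : n.+1%:R *: herm n.+1 = 2 *: ('X * herm n) - (herm n)^`().
Proof. by rewrite /= scalerA divff ?scale1r// pnatr_eq0. Qed.

Lemma herm0 : herm 0 = 1. Proof. by []. Qed.

Lemma hermSE n : herm n.+1 = n.+1%:R^-1 *: (2 *: ('X * herm n) - (herm n)^`()).
Proof. by []. Qed.

Arguments herm : simpl never.
Opaque herm.

(** Differentiating the recurrence and inserting the induction hypothesis reproduces the recurrence
    one index lower. *)
Lemma deriv_herm n : (herm n)^`() = if n is m.+1 then 2 *: herm m else 0.
Proof.
elim: n => [|n IH]; first by rewrite herm0 -polyC1 derivC.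
apply: (@scalerI _ _ n.+1%:R); first by rewrite pnatr_eq0.
rewrite -derivZ hermS !poly.derivE mul1r.
case: n IH => [|n] IH; first by rewrite IH deriv0 mulr0 addr0 subr0 scale1r.
rewrite IH derivZ -scalerAr scalerDr -addrA -scalerBr -hermS.
rewrite -scalerDr -[X in X + _]scale1r -scalerDl !scalerA.
by congr (_ *: _); rewrite -[n.+2%:R]natr1; ring.
Qed.

Lemma size_herm n : (size (herm n) <= n.+1)%N.
Proof.
elim: n => [|n IH]; first by rewrite herm0 size_poly1.
rewrite hermSE; apply: (leq_trans (size_scale_leq _ _)).
apply: (leq_trans (size_polyD _ _)); rewrite geq_max size_polyN; apply/andP; split.
  apply: (leq_trans (size_scale_leq _ _)).
  by apply: (leq_trans (size_polyMleq _ _)); rewrite size_polyX.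
by apply: (leq_trans (size_poly _ _)); lia.
Qed.

(* the coefficient of ['X^n] in [herm n] is [2 ^ n / n!] *)
Lemma coef_herm n : (herm n)`_n != 0.
Proof.
elim: n => [|n IH]; first by rewrite herm0 coef1 oner_neq0.
rewrite hermSE coefZ coefB coefZ coefXM /= coef_deriv.
rewrite [_`_n.+2]nth_default ?mul0rn ?subr0; last by apply: leqW; exact: size_herm.
by rewrite !mulf_neq0 ?invr_neq0 ?pnatr_eq0.
Qed.

(** [herm K] has degree exactly [K], so a multiple of it removes the top coefficient of [p]. *)
Lemma herm_span K (p : {poly R}) : (size p <= K)%N ->
  exists c : 'I_K -> R, p = \sum_(i < K) c i *: herm i.
Proof.
elim: K p => [|K IH] p pK.
  by exists (fun=> 0); rewrite big_ord0; apply/eqP; rewrite -size_poly_leq0.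
pose a := p`_K / (herm K)`_K.
have [|c Ec] := IH (p - a *: herm K).
  apply/leq_sizeP => j; rewrite leq_eqVlt => /predU1P[<-|Kj].
    by rewrite coefB coefZ /a divfK ?subrr ?coef_herm.
  rewrite coefB coefZ nth_default ?(leq_trans pK)//.
  by rewrite nth_default ?mulr0 ?subr0// (leq_trans (size_herm _)).
exists (fun i => if unlift ord_max i is Some j then c j else a).
rewrite big_ord_recr /= unlift_none.
rewrite (eq_bigr (fun i : 'I_K => c i *: herm i)) -?Ec ?subrK// => i _.
by rewrite (_ : widen_ord _ i = lift ord_max i) ?liftK//; apply: val_inj; rewrite /= /bump leqNgt ltn_ord.
Qed.

(** The derivative conjugated by the Gaussian: [dmul p * exp (- x ^ 2 / 2)] is the derivative of
    [p * exp (- x ^ 2 / 2)]. *)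
Definition dmul (p : {poly R}) : {poly R} := p^`() - 'X * p.

(** [E] is Hermite's equation; the term in [x ^ 2] produced by the two conjugated derivatives
    cancels against the potential. *)
Lemma herm_oscillator n :
  - dmul (dmul (herm n)) + 'X * ('X * herm n) = (2 * n + 1)%:R *: herm n.
Proof.
have E : 2 *: ('X * (herm n)^`()) - (herm n)^`()^`() = (2 * n)%:R *: herm n.
  case: n => [|n]; first by rewrite deriv_herm deriv0 mulr0 scaler0 subrr scale0r.
  by rewrite deriv_herm derivZ -scalerAr -scalerBr -hermS scalerA -natrM.
rewrite /dmul natrD scalerDl -E scale1r !derivB !derivM derivX.
rewrite !scaler_nat mulr2n mulrBr.
by ring.
Qed.

(** The coefficient of [t ^ (n - k)] in [exp (t ^ 2)]: it is [1 / j!] when [n = k + 2 j], and 0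
    otherwise. *)
Definition shift_coef (n k : nat) : R :=
  if (k <= n)%N && ~~ odd (n - k) then ((n - k)./2`!)%:R^-1 else 0.

Definition scal_coef (l c : R) (n k : nat) : R :=
  l ^+ k * c ^+ (n - k)./2 * shift_coef n k.

Lemma shift_coefSS n k : (n - k)./2%:R * shift_coef n k = shift_coef n k.+2.
Proof.
rewrite /shift_coef; case: (leqP k.+2 n) => kn.
  have -> : (k <= n)%N by lia.
  have -> : (n - k = (n - k.+2).+2)%N by lia.
  rewrite /= negbK; case: ifP => _; last by rewrite mulr0.
  rewrite factS natrM invfM mulrA divff ?mul1r// pnatr_eq0; lia.
case: (leqP k n) => kn2 /=; rewrite ?mulr0//.
have -> : ((n - k)./2 = 0)%N by lia.
by rewrite mul0r.
Qed.

Lemma shift_coef_eq0 n k : (n < k)%N || odd (n - k) -> shift_coef n k = 0.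
Proof.
by move=> H; rewrite /shift_coef; case: ifP => // /andP[kn]; move: H; rewrite ltnNge kn /= => ->.
Qed.

Lemma shift_coefE n k j : n = (k + j.*2)%N -> shift_coef n k = (j`!)%:R^-1.
Proof. by move=> ->; rewrite /shift_coef leq_addr addKn odd_double doubleK. Qed.

Lemma shift_coefnn n : shift_coef n n = 1.
Proof. by rewrite /shift_coef leqnn subnn /= invr1. Qed.

(** This is the three-term recurrence of [herm] at [l y], read off on the coefficient of [herm k] at
    [y] after [2 y h_k] is replaced by [(k + 1) h_{k+1} + 2 h_{k-1}]. The value [l ^ 2 - 1] is what
    makes the last two terms combine. *)
Lemma scal_coef_rec l n k : let s := scal_coef l (l ^+ 2 - 1) in
  n.+2%:R * s n.+2 k =
  (if k is k1.+1 then k%:R * (l * s n.+1 k1) else 0) +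
  2 * (l * s n.+1 k.+1) - 2 * s n k.
Proof.
move=> s; rewrite /s /scal_coef; set c := l ^+ 2 - 1.
case: (leqP k n.+2) => kn; last first.
  rewrite !shift_coef_eq0//; try lia; rewrite !mulr0 addr0 subr0.
  case: k kn => [//|k1] kn; rewrite shift_coef_eq0 ?mulr0//; lia.
case: (boolP (odd (n.+2 - k))) => po.
  have E : shift_coef n.+2 k = 0 by rewrite shift_coef_eq0// po orbT.
  have -> : shift_coef n.+1 k.+1 = 0 by rewrite shift_coef_eq0//; lia.
  have -> : shift_coef n k = 0 by rewrite shift_coef_eq0//; lia.
  rewrite E !mulr0 addr0 subr0.
  case: k kn po E => [//|k1] kn po E; rewrite (_ : shift_coef n.+1 k1 = 0) ?mulr0//.
have [j Ej] : exists j, n.+2 = (k + j.*2)%N by exists (n.+2 - k)./2; lia.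
have jf i : i.+1%:R * (i.+1`!)%:R^-1 = (i`!)%:R^-1 :> R.
  by rewrite factS natrM invfM mulrA divff ?mul1r// pnatr_eq0.
have -> : shift_coef n.+2 k = (j`!)%:R^-1.
  by apply: shift_coefE; lia.
have -> : (n.+2 - k)./2 = j by lia.
have Ek : (if k is k1.+1 then k%:R * (l * (l ^+ k1 * c ^+ (n.+1 - k1)./2 * shift_coef n.+1 k1)) else 0)
    = k%:R * (l ^+ k * c ^+ j * (j`!)%:R^-1).
  case: k kn po Ej => [|k1] kn po Ej; first by rewrite mul0r.
  have -> : (n.+1 - k1)./2 = j by lia.
  have -> : shift_coef n.+1 k1 = (j`!)%:R^-1.
    by apply: shift_coefE; lia.
  by rewrite exprS !mulrA.
rewrite Ek; case: j Ej Ek => [|j] Ej Ek.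
  rewrite Ej !shift_coef_eq0; try lia; rewrite !mulr0 addr0 subr0.
  by rewrite addn0; ring.
have -> : (n.+1 - k.+1)./2 = j by lia.
have -> : shift_coef n.+1 k.+1 = (j`!)%:R^-1.
  by apply: shift_coefE; lia.
have -> : shift_coef n k = (j`!)%:R^-1.
  by apply: shift_coefE; lia.
rewrite -(jf j) Ej -mul2n natrD natrM !exprS; move: (c ^+ j) => P.
by rewrite /c; ring.
Qed.

(** In generating functions: [exp (2 l y t - t ^ 2) = exp (2 y (l t) - (l t) ^ 2) * exp ((l ^ 2 - 1)
    t ^ 2)]. The proof compares recurrences instead; [K] may be any bound above [n] since the higher
    coefficients vanish. *)
Lemma herm_scale l n K y : (n < K)%N ->
  (herm n).[l * y] = \sum_(k < K) scal_coef l (l ^+ 2 - 1) n k * (herm k).[y].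
Proof.
set s := scal_coef l (l ^+ 2 - 1).
pose h k := (herm k).[y].
have hS k z : k.+2%:R * (herm k.+2).[z] = 2 * (z * (herm k.+1).[z]) - 2 * (herm k).[z].
  by rewrite -hornerZ hermS deriv_herm !hornerE.
have h1 z : (herm 1).[z] = 2 * z.
  by rewrite hermSE herm0 mulr1 -polyC1 derivC subr0 invr1 scale1r hornerZ hornerX.
have s0 m k : (m < k)%N -> s m k = 0 by move=> mk; rewrite /s /scal_coef shift_coef_eq0 ?mk// mulr0.
(* The recurrence reaches back two indices, so the induction runs over all [n <= m]. *)
elim: n {-2}n (leqnn n) K => [|m IH] n nm K nK.
  move: nm; rewrite leqn0 => /eqP En; rewrite En in nK *.
  case: K nK => // K _; rewrite big_ord_recl big1 => [|i _]; last first.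
    by rewrite s0 ?mul0r.
  by rewrite /s /scal_coef shift_coefnn herm0 !hornerC /=; ring.
case: n nm nK => [|n] nm nK; first by apply: IH.
case: n nm nK => [|n] nm nK.
  do 2 (case: K nK => [//|K] nK); rewrite !big_ord_recl big1 /=; last first.
    by move=> i _; rewrite [s _ _]s0 ?mul0r.
  by rewrite /s /scal_coef /shift_coef /= /bump /= herm0 hornerC !h1 invr1; ring.
apply: (@mulfI _ n.+2%:R); first by rewrite pnatr_eq0.
rewrite hS (IH n.+1 _ K) ?(IH n _ K) ?mulr_sumr; try lia.
rewrite [RHS](eq_bigr (fun k : 'I_K =>
   (if (k : nat) is k1.+1 then k%:R * (l * s n.+1 k1) else 0) * h k +
  2 * (l * s n.+1 k.+1) * h k - 2 * (s n k * h k))); last first.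
  by move=> k _; rewrite [LHS]mulrA /s scal_coef_rec mulrBl mulrDl -!mulrA.
rewrite sumrB big_split; congr (_ - _).
have hX k : 2 * (y * h k) = k.+1%:R * h k.+1 + (if k is k1.+1 then 2 * h k1 else 0).
  case: k => [|k]; first by rewrite /h h1 herm0 hornerC; ring.
  by rewrite /h hS; ring.
rewrite (eq_bigr (fun k : 'I_K => l * s n.+1 k * (k.+1%:R * h k.+1) +
   (if (k : nat) is k1.+1 then l * s n.+1 k * (2 * h k1) else 0))); last first.
  move=> k _; rewrite -/(h k) [LHS](_ : _ = l * s n.+1 k * (2 * (y * h k))); last by ring.
  by rewrite hX mulrDr; case: (k : nat) => [|k1]; rewrite ?mulr0.
rewrite big_split; case: K nK => [//|K] nK; congr (_ + _).
  rewrite big_ord_recr /= s0 ?mulr0 ?mul0r ?addr0; last by lia.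
  rewrite big_ord_recl /= mul0r add0r; apply: eq_bigr => i _.
  by rewrite /bump /=; ring.
rewrite big_ord_recl /= add0r big_ord_recr /= [s _ K.+1]s0; last by lia.
rewrite !mulr0 mul0r addr0; apply: eq_bigr => i _.
by rewrite /bump /=; ring.
Qed.

End hermite.

Arguments herm : simpl never.

(** * The recursion between levels *)

Notation idx K := ('I_K * 'I_K * 'I_K)%type.

Definition deg {K} (n : idx K) : nat := (n.1.1 + n.1.2 + n.2)%N.

Section level.
Context {R : realFieldType}.

Lemma sum3E K (F : nat -> nat -> nat -> R) :
  \sum_(k : idx K) F k.1.1 k.1.2 k.2 = \sum_(a < K) \sum_(b < K) \sum_(c < K) F a b c.
Proof.
rewrite (pair_bigA _ (fun a b : 'I_K => \sum_(c < K) F a b c)) /=.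
by rewrite (pair_bigA _ (fun (p : 'I_K * 'I_K) (c : 'I_K) => F p.1 p.2 c)).
Qed.

(** Since [g] vanishes from [K] on, the shift only loses the terms of index 0 and 1. *)
Lemma ler_sum_shift2 K (g : nat -> R) : (forall j, 0 <= g j) ->
  (forall j, (K <= j)%N -> g j = 0) ->
  \sum_(k < K) g k.+2 <= \sum_(k < K) g k.
Proof.
move=> g0 gK.
have : \sum_(k < K.+2) g k = \sum_(k < K) g k.
  by rewrite !big_ord_recr /= !gK ?addr0.
rewrite !big_ord_recl /= => <-; rewrite addrA -[leLHS]add0r lerD ?addr_ge0//.
Qed.

Lemma ler_sum3_shift2 K (F : nat -> nat -> nat -> R) :
  (forall a b c, 0 <= F a b c) ->
  (forall a b c, (K <= maxn a (maxn b c))%N -> F a b c = 0) ->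
  [/\ \sum_(k : idx K) F k.1.1.+2 k.1.2 k.2 <= \sum_(k : idx K) F k.1.1 k.1.2 k.2,
      \sum_(k : idx K) F k.1.1 k.1.2.+2 k.2 <= \sum_(k : idx K) F k.1.1 k.1.2 k.2 &
      \sum_(k : idx K) F k.1.1 k.1.2 k.2.+2 <= \sum_(k : idx K) F k.1.1 k.1.2 k.2].
Proof.
move=> F0 FK; rewrite (sum3E _ F) (sum3E _ (fun a b c => F a.+2 b c)).
rewrite (sum3E _ (fun a b c => F a b.+2 c)) (sum3E _ (fun a b c => F a b c.+2)).
split.
- apply: (ler_sum_shift2 (g := fun a => \sum_(b < K) \sum_(c < K) F a b c)) => j.
    by do 2 (apply: sumr_ge0 => ? _).
  by move=> jK; do 2 (rewrite big1// => ? _); apply: FK; lia.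
- apply: ler_sum => a _.
  apply: (ler_sum_shift2 (g := fun b => \sum_(c < K) F a b c)) => j.
    by apply: sumr_ge0.
  by move=> jK; rewrite big1// => ? _; apply: FK; lia.
- apply: ler_sum => a _; apply: ler_sum => b _.
  by apply: ler_sum_shift2 => // j jK; apply: FK; lia.
Qed.

(** Lagrange's identity: the difference is a sum of three squares with positive weights. *)
Lemma cauchy_schwarz3 (x y z a b c : R) : 0 < x -> 0 < y -> 0 < z ->
  (a + b + c) ^+ 2 <= (x + y + z) * (a ^+ 2 / x + b ^+ 2 / y + c ^+ 2 / z).
Proof.
move=> x0 y0 z0; rewrite -subr_ge0.
rewrite (_ : _ - _ = (y * a - x * b) ^+ 2 / (x * y) +
  (z * b - y * c) ^+ 2 / (y * z) + (x * c - z * a) ^+ 2 / (z * x)).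
  by rewrite !addr_ge0// divr_ge0 ?sqr_ge0// mulr_ge0// ltW.
by field; rewrite !gt_eqF.
Qed.

Variables (K N : nat) (gam : idx K -> R).
Hypothesis gamN : forall n, deg n != N -> gam n = 0.

(* the coefficient of the Hermite function of index [(a, b, c)] that remains when
   every [herm n (l y)] of a sum of coefficients [gam] is expanded by
   [herm_scale] and the common power of [l] and [l ^ 2 - 1] is left out *)
Definition lap_coef (a b c : nat) : R :=
  \sum_(n : idx K) gam n *
    (shift_coef n.1.1 a * shift_coef n.1.2 b * shift_coef n.2 c).

(** For each [n] on the level, [J = j1 + j2 + j3] with [2 j_i] the drop of the i-th index, and
    multiplication by [j_i] shortens one factorial, as in [shift_coefSS]. The right side plays the
    part of the Laplacian. *)
Lemma lap_coef_rec a b c J : (a + b + c + J.*2 = N)%N ->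
  J%:R * lap_coef a b c =
  lap_coef a.+2 b c + lap_coef a b.+2 c + lap_coef a b c.+2.
Proof.
move=> EN; rewrite /lap_coef mulr_sumr -!big_split; apply: eq_bigr => n _.
have [En|/gamN ->] := eqVneq (deg n) N; last by rewrite /= !mul0r mulr0 !addr0.
rewrite /deg in En; rewrite /= -!shift_coefSS.
set e1 := shift_coef n.1.1 a; set e2 := shift_coef n.1.2 b; set e3 := shift_coef n.2 c.
have [e10|e10] := eqVneq e1 0; first by rewrite e10; ring.
have [e20|e20] := eqVneq e2 0; first by rewrite e20; ring.
have [e30|e30] := eqVneq e3 0; first by rewrite e30; ring.
have P m k : @shift_coef R m k != 0 -> m = (k + (m - k)./2.*2)%N.
  by rewrite /shift_coef; case: ifP => [/andP[km om] _|]; [lia|rewrite eqxx].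
have H1 := P _ _ e10; have H2 := P _ _ e20; have H3 := P _ _ e30.
rewrite (_ : J = ((n.1.1 - a)./2 + (n.1.2 - b)./2 + (n.2 - c)./2)%N); last first.
  by move: En; rewrite [in X in X -> _]H1 [in X in X -> _]H2 [in X in X -> _]H3 -EN; lia.
by rewrite !natrD; ring.
Qed.

Lemma lap_coef_top (k : idx K) : deg k = N -> lap_coef k.1.1 k.1.2 k.2 = gam k.
Proof.
move=> Ek; rewrite /lap_coef (bigD1 k)//= !shift_coefnn !mulr1 big1 ?addr0// => n nk.
have [En|/gamN ->] := eqVneq (deg n) N; last by rewrite mul0r.
have [H|H] := boolP ((n.1.1 < k.1.1)%N || (n.1.2 < k.1.2)%N || (n.2 < k.2)%N).
  by move: H => /orP[/orP[]|] H; [rewrite (@shift_coef_eq0 _ n.1.1) ?H//|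
    rewrite (@shift_coef_eq0 _ n.1.2) ?H//|rewrite (@shift_coef_eq0 _ n.2) ?H//]; ring.
case/negP: nk; apply/eqP; move: En Ek H; rewrite /deg.
case: n => -[n1 n2] n3; case: k => -[k1 k2] k3 /= En Ek H.
by congr (_, _, _); apply: val_inj => /=; lia.
Qed.

Lemma lap_coef_eq0 a b c : (N < a + b + c)%N || odd (N - (a + b + c)) ->
  lap_coef a b c = 0.
Proof.
move=> H; rewrite /lap_coef big1// => n _.
have [En|/gamN ->] := eqVneq (deg n) N; last by rewrite mul0r.
have [H1|H1] := boolP ((n.1.1 < a)%N || odd (n.1.1 - a)).
  by rewrite (@shift_coef_eq0 _ _ _ H1); ring.
have [H2|H2] := boolP ((n.1.2 < b)%N || odd (n.1.2 - b)).
  by rewrite (@shift_coef_eq0 _ _ _ H2); ring.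
have [H3|H3] := boolP ((n.2 < c)%N || odd (n.2 - c)).
  by rewrite (@shift_coef_eq0 _ _ _ H3); ring.
have E m k : ~~ ((m < k)%N || odd (m - k)) -> exists j, m = (k + j.*2)%N.
  by move=> Hm; exists (m - k)./2; lia.
have [i Ei] := E _ _ H1; have [j Ej] := E _ _ H2; have [l El] := E _ _ H3.
by exfalso; move: En H; rewrite /deg Ei Ej El => <-; lia.
Qed.

Lemma lap_coef_geK a b c : (K <= maxn a (maxn b c))%N -> lap_coef a b c = 0.
Proof.
move=> H; rewrite /lap_coef big1// => n _.
have := ltn_ord n.1.1; have := ltn_ord n.1.2; have := ltn_ord n.2 => ? ? ?.
have : (n.1.1 < a)%N || (n.1.2 < b)%N || (n.2 < c)%N by lia.
by move=> /orP[/orP[]|] H1; [rewrite (@shift_coef_eq0 _ n.1.1) ?H1//|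
  rewrite (@shift_coef_eq0 _ n.1.2) ?H1//|rewrite (@shift_coef_eq0 _ n.2) ?H1//]; ring.
Qed.

Definition wfact (a b c : nat) : R := (a`! * b`! * c`!)%:R.

Definition level_sum m : R :=
  \sum_(k : idx K | deg k == m)
    lap_coef k.1.1 k.1.2 k.2 ^+ 2 / wfact k.1.1 k.1.2 k.2.

Lemma wfact_gt0 a b c : 0 < wfact a b c.
Proof. by rewrite /wfact ltr0n !muln_gt0 !fact_gt0. Qed.

Lemma level_sum_ge0 m : 0 <= level_sum m.
Proof. by apply: sumr_ge0 => k _; rewrite divr_ge0 ?sqr_ge0// ltW// wfact_gt0. Qed.

Lemma level_sum_top : level_sum N = \sum_k gam k ^+ 2 / wfact k.1.1 k.1.2 k.2.
Proof.
rewrite /level_sum [RHS](bigID (fun k => deg k == N)) /= [X in _ + X]big1 ?addr0.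
  by apply: eq_bigr => k /eqP /lap_coef_top ->.
by move=> k /gamN ->; rewrite expr0n mul0r.
Qed.

(* Cauchy-Schwarz with weights [k_i + 1]; it plays the role of the bound
   [|| Delta p || <= 2 sqrt (N (N + 1)) || p ||] on the level [N] *)
Lemma level_sum_rec m J : (m + J.*2 = N)%N ->
  J%:R ^+ 2 * level_sum m <= (m.+3 * m.+2)%:R * level_sum m.+2.
Proof.
move=> EN; pose F a b c : R :=
  if (a + b + c == m.+2)%N then lap_coef a b c ^+ 2 / wfact a b c else 0.
have F0 a b c : 0 <= F a b c.
  by rewrite /F; case: ifP => // _; rewrite divr_ge0 ?sqr_ge0// ltW// wfact_gt0.
have FK a b c : (K <= maxn a (maxn b c))%N -> F a b c = 0.
  by move=> H; rewrite /F lap_coef_geK// expr0n mul0r if_same.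
have FKM (h : nat -> nat -> nat -> R) a b c : (K <= maxn a (maxn b c))%N ->
    h a b c * F a b c = 0 by move=> H; rewrite FK ?mulr0.
have [S1 _ _] := @ler_sum3_shift2 K (fun a b c => a%:R * F a b c)
  (fun _ _ _ => mulr_ge0 (ler0n _ _) (F0 _ _ _)) (FKM (fun a b c => a%:R)).
have [_ S2 _] := @ler_sum3_shift2 K (fun a b c => b%:R * F a b c)
  (fun _ _ _ => mulr_ge0 (ler0n _ _) (F0 _ _ _)) (FKM (fun a b c => b%:R)).
have [_ _ S3] := @ler_sum3_shift2 K (fun a b c => c%:R * F a b c)
  (fun _ _ _ => mulr_ge0 (ler0n _ _) (F0 _ _ _)) (FKM (fun a b c => c%:R)).
pose G a b c := a.+2%:R * F a.+2 b c + b.+2%:R * F a b.+2 c + c.+2%:R * F a b c.+2.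
have G0 a b c : 0 <= G a b c by rewrite /G !addr_ge0 ?mulr_ge0.
(* After reindexing by 2 the factor [a + 2] becomes the index itself, and in degree [m + 2] the
   three indices add up to [m + 2]. *)
have V2 : \sum_(k : idx K) G k.1.1 k.1.2 k.2 <= m.+2%:R * level_sum m.+2.
  rewrite !big_split /=; apply: (le_trans (lerD (lerD S1 S2) S3)).
  rewrite -!big_split /level_sum /= mulr_sumr [leRHS]big_mkcond /=.
  apply: ler_sum => k _; rewrite /F -/(deg k); case: eqP => [Ek|_]; last by rewrite !mulr0 !addr0.
  by rewrite -!mulrDl -!natrD -/(deg k) Ek.
rewrite natrM -mulrA; apply: le_trans (ler_wpM2l (ler0n _ _) V2).
rewrite /level_sum mulr_sumr mulr_sumr big_mkcond; apply: ler_sum => k _.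
case: ifP => [/eqP Ek|_]; last by rewrite mulr_ge0.
rewrite mulrA -exprMn (@lap_coef_rec _ _ _ J); last by rewrite -/(deg k) Ek.
rewrite /G /F; move: Ek; rewrite /deg; move: (k.1.1 : nat) (k.1.2 : nat) (k.2 : nat) => a b c Ek.
rewrite !addSn !addnS !addSn Ek eqxx.
move: (lap_coef _ _ _) (lap_coef _ _ _) (lap_coef _ _ _) => C B A.
have fn0 i : (i`!)%:R != 0 :> R by rewrite pnatr_eq0 -lt0n fact_gt0.
(* Of the two new factors in [(a + 2)!], one cancels [a + 2] and the other leaves the Cauchy-Schwarz
   weight [a + 1]; the three weights add up to [m + 3]. *)
have w1 : a.+2%:R * (A ^+ 2 / wfact a.+2 b c) = A ^+ 2 / a.+1%:R / wfact a b c.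
  by rewrite /wfact !factS !natrM; field; rewrite !fn0 /= -natrD nat1r !pnatr_eq0.
have w2 : b.+2%:R * (B ^+ 2 / wfact a b.+2 c) = B ^+ 2 / b.+1%:R / wfact a b c.
  by rewrite /wfact !factS !natrM; field; rewrite !fn0 /= -natrD nat1r !pnatr_eq0.
have w3 : c.+2%:R * (C ^+ 2 / wfact a b c.+2) = C ^+ 2 / c.+1%:R / wfact a b c.
  by rewrite /wfact !factS !natrM; field; rewrite !fn0 /= -natrD nat1r !pnatr_eq0.
rewrite w1 w2 w3 -!mulrDl [leRHS]mulrA ler_wpM2r ?invr_ge0 ?(ltW (wfact_gt0 _ _ _))//.
rewrite (_ : m.+3%:R = a.+1%:R + b.+1%:R + c.+1%:R); last by rewrite -!natrD; congr (_%:R); lia.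
by rewrite cauchy_schwarz3.
Qed.

End level.

(** * Explicit weights for the degrees below a level, and their sum *)

Section weights.
Context {R : realFieldType}.

(* [ratio (N - 2 J) J] bounds the quotient of the terms of degrees [N - 2 J - 2]
   and [N - 2 J] in [level_bound], by [level_sum_rec] and the beta recursion *)
Definition ratio (n J : R) : R :=
  4 * (n + 1) * n * (2 * J + 1) / ((2 * J + 2) * (2 * n - 1) * (2 * n - 3)).

Fixpoint weight (N J : nat) : R :=
  if J is J1.+1 then ratio (N - J1.*2)%:R J1%:R * weight N J1
  else 2 / (2 * N%:R + 1).

Lemma ratio_ge0 (n J : R) : 2 <= n -> 0 <= J -> 0 <= ratio n J.
Proof. by move=> n2 J0; rewrite /ratio divr_ge0// !mulr_ge0//; lra. Qed.

Lemma weight_ge0 N J : (J.*2 <= N)%N -> 0 <= weight N J.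
Proof.
elim: J => [_|J IH JN] /=; first by rewrite divr_ge0// addr_ge0// mulr_ge0.
by rewrite mulr_ge0 ?IH ?ratio_ge0 ?ler_nat//; lia.
Qed.

(** Each partial sum is controlled by an explicit multiple of the next weight, so only the last
    weight remains to be estimated. With [n = N - 2 J], the induction step reduces to
    [(2 n + 3) (2 n - 1) <= 4 n (n + 1)], where just 3 is lost. *)
Lemma sum_weight_le N J : (J.*2 <= N)%N ->
  \sum_(i < J) weight N i <=
  2 * J%:R * (2 * (N - J.*2)%:R + 1) / (2 * N%:R + 3) * weight N J.
Proof.
elim: J => [_|J IH JN]; first by rewrite big_ord0 mulr0 !mul0r.
rewrite big_ord_recr /=; set n := (N - J.*2)%N.
have n2 : 2 <= n%:R :> R by rewrite ler_nat; lia.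
have t0 : 0 <= weight N J by apply: weight_ge0; lia.
rewrite (_ : (N - J.+1.*2)%:R = n%:R - 2); last by rewrite -natrB; [congr _%:R; lia|lia].
have -> : N%:R = n%:R + 2 * J%:R :> R by rewrite -natrM -natrD; congr _%:R; lia.
have IHJ : (J.*2 <= N)%N by lia.
apply: (le_trans (lerD (IH IHJ) (lexx _))); rewrite -/n -[X in _ + X]mul1r -mulrDl mulrA.
apply: ler_wpM2r => //.
have -> : N%:R = n%:R + 2 * J%:R :> R by rewrite -natrM -natrD; congr _%:R; lia.
rewrite -[J.+1%:R]natr1; have J0 : 0 <= J%:R :> R by [].
move: n2 J0; move: (n%:R : R) (J%:R : R) => x y x2 y0.
rewrite /ratio [leLHS](_ : _ = (2 * y + 1) * (2 * x + 3) / (2 * (x + 2 * y) + 3)); last first.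
  by field; lra.
rewrite [leRHS](_ : _ =
   (2 * y + 1) * (4 * x * (x + 1) / (2 * x - 1)) / (2 * (x + 2 * y) + 3)); last first.
  by field; rewrite ?mulf_neq0//; repeat (apply/andP; split); lra.
rewrite ler_wpM2r ?invr_ge0//; first lra.
rewrite ler_wpM2l//; first lra.
by rewrite ler_pdivlMr; nra.
Qed.

(* a Wallis-type bound, exact at [J = 0]; the induction step loses [8 n ^ 2 + 1] *)
Lemma sqr_weight_le N J : (J.*2 <= N)%N ->
  weight N J ^+ 2 <= 4 * (N%:R + 1) /
    ((2 * J%:R + 1) * ((N - J.*2)%:R + 1) * (2 * (N - J.*2)%:R + 1) ^+ 2).
Proof.
elim: J => [_|J IH JN].
  rewrite /= subn0; have : 0 <= N%:R :> R by [].
  move: (N%:R : R) => x x0; rewrite [leRHS](_ : _ = (2 / (2 * x + 1)) ^+ 2)//.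
  by field; lra.
rewrite [weight _ _]/=; set n := (N - J.*2)%N.
have n2 : 2 <= n%:R :> R by rewrite ler_nat; lia.
rewrite (_ : (N - J.+1.*2)%:R = n%:R - 2); last by rewrite -natrB; [congr _%:R; lia|lia].
have IHJ : (J.*2 <= N)%N by lia.
rewrite exprMn; apply: (le_trans (ler_wpM2l (sqr_ge0 _) (IH IHJ))); rewrite -/n.
rewrite -[J.+1%:R]natr1; have J0 : 0 <= J%:R :> R by [].
have c0 : 0 <= 4 * (N%:R + 1) :> R by rewrite mulr_ge0// addr_ge0.
move: n2 J0 c0; move: (n%:R : R) (J%:R : R) (4 * _ : R) => x y c x2 y0 c0.
rewrite mulrCA ler_wpM2l// /ratio.
rewrite [leLHS](_ : _ = (16 * x ^+ 2 * (x + 1) * (2 * y + 1)) /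
    ((2 * y + 2) ^+ 2 * (2 * x - 1) ^+ 2 * (2 * x - 3) ^+ 2 * (2 * x + 1) ^+ 2)); last first.
  by field; repeat (apply/andP; split); lra.
rewrite [leRHS](_ : _ = ((2 * y + 2) ^+ 2 * (2 * x - 1) ^+ 2 * (2 * x + 1) ^+ 2) /
    ((2 * y + 3) * (x - 1)) /
    ((2 * y + 2) ^+ 2 * (2 * x - 1) ^+ 2 * (2 * x - 3) ^+ 2 * (2 * x + 1) ^+ 2)); last first.
  by field; repeat (apply/andP; split); lra.
rewrite ler_wpM2r//.
  by rewrite invr_ge0 -!exprMn sqr_ge0.
rewrite ler_pdivlMr; last by rewrite mulr_gt0; lra.
rewrite [leLHS](_ : _ = ((2 * y + 1) * (2 * y + 3)) * (16 * x ^+ 2 * (x ^+ 2 - 1))); last by ring.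
rewrite [leRHS](_ : _ = (2 * y + 2) ^+ 2 * (4 * x ^+ 2 - 1) ^+ 2); last by ring.
apply: ler_pM; [by rewrite mulr_ge0//; lra|by rewrite mulr_ge0 ?(mulr_ge0 _ (sqr_ge0 _))//; nra|nra|].
by rewrite -subr_ge0 (_ : _ - _ = 8 * x ^+ 2 + 1); [rewrite addr_ge0// mulr_ge0// sqr_ge0|ring].
Qed.

(** At the last index [N - 2 L] is 0 or 1. In the even case the last weight is at most 2 and the
    earlier ones add at most half of it, which gives 3. In the odd case the last weight is at most 1
    and the earlier ones add at most twice it. *)
Lemma sum_weight_le3 N : \sum_(i < (N./2).+1) weight N i <= 3.
Proof.
set L := N./2; have LN : (L.*2 <= N)%N by rewrite /L; lia.
have t0 := weight_ge0 LN; have S := sum_weight_le LN; have Q := sqr_weight_le LN.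
rewrite big_ord_recr /=; apply: (le_trans (lerD S (lexx _))).
rewrite -[X in _ + X]mul1r -mulrDl; move: t0 Q; move: (weight N L) => t t0 Q.
have L0 : 0 <= L%:R :> R by [].
have [E|E] : N = L.*2 \/ N = L.*2.+1 by rewrite /L; lia.
  have n0 : (N - L.*2)%:R = 0 :> R by rewrite E subnn.
  have NE : N%:R = 2 * L%:R :> R by rewrite -natrM mul2n -E.
  rewrite n0 NE in Q *; move: (L%:R : R) L0 Q => y y0 Q.
  have t2 : t <= 2.
    rewrite -(ler_pXn2r (n := 2)) ?nnegrE//; apply: (le_trans Q).
    by rewrite mulr0 !add0r !expr1n !mulr1 ler_pdivrMr; lra.
  have k1 : 2 * y * (2 * 0 + 1) / (2 * (2 * y) + 3) <= 1 / 2.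
    by rewrite ler_pdivrMr; lra.
  by apply: (@le_trans _ _ ((1 / 2 + 1) * 2)); [apply: ler_pM => //; [rewrite addr_ge0// divr_ge0//; lra|lra]|lra].
have n1 : (N - L.*2)%:R = 1 :> R by rewrite [in LHS]E subSn// subnn.
have NE : N%:R = 2 * L%:R + 1 :> R by rewrite -natrM natr1 mul2n -E.
rewrite n1 NE in Q *; move: (L%:R : R) L0 Q => y y0 Q.
have t2 : t <= 1.
  rewrite -(ler_pXn2r (n := 2)) ?nnegrE//; apply: (le_trans Q).
  by rewrite expr1n ler_pdivrMr; nra.
have k1 : 2 * y * (2 * 1 + 1) / (2 * (2 * y + 1) + 3) <= 2.
  by rewrite ler_pdivrMr; lra.
by apply: (@le_trans _ _ ((2 + 1) * 1)); [apply: ler_pM => //; [rewrite addr_ge0// divr_ge0//; lra|lra]|lra].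
Qed.

(** Stands for the integral of [l ^ (2 n) (1 - l ^ 2) ^ m] over [[0, 1]], known here only through
    its initial values and its recursion. *)
Variable beta : nat -> nat -> R.
Hypothesis beta0 : forall n, beta n 0 = (2 * n%:R + 1)^-1.
Hypothesis betaS : forall n m,
  (2 * n%:R + 1) * beta n m.+1 = 2 * m.+1%:R * beta n.+1 m.

Lemma beta_ge0 n m : 0 <= beta n m.
Proof.
elim: m n => [|m IH] n; first by rewrite beta0 invr_ge0 addr_ge0// mulr_ge0.
have c : 0 < 2 * n%:R + 1 :> R by rewrite ltr_wpDl// mulr_ge0.
by rewrite -(pmulr_rge0 _ c) betaS !mulr_ge0.
Qed.

Variables (K N : nat) (gam : idx K -> R).
Hypothesis gamN : forall n, deg n != N -> gam n = 0.

(** The contribution of degree [N - 2 J] to the integral over [l], up to the Gaussian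
    normalisation. *)
Let X J := 2 ^+ (N - J.*2)%N * level_sum gam (N - J.*2)%N * (2 * beta (N - J.*2)%N J.*2).

(** A step from [J] to [J + 1] uses [level_sum_rec] once and the beta recursion twice, from
    [beta n (2 J + 2)] through [beta (n + 1) (2 J + 1)] to [beta (n + 2) (2 J)]. Together with the
    quotient of the powers of 2, the factors multiply exactly to [ratio]. *)
Let X_le J : (J.*2 <= N)%N -> X J <= weight N J * (2 ^+ N * level_sum gam N).
Proof.
elim: J => [_|J IH JN].
  rewrite /X subn0 beta0 [leRHS]mulrC lexx //.
have JN' : (J.*2 <= N)%N by lia.
have n2 : 2 <= (N - J.*2)%:R :> R by rewrite ler_nat; lia.
rewrite [weight _ _]/= -mulrA.
apply: le_trans (ler_wpM2l (ratio_ge0 n2 (ler0n _ _)) (IH JN')).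
have [n En] : exists n, (N - J.*2 = n.+2)%N by exists (N - J.+1.*2)%N; lia.
have En' : (N - J.+1.*2 = n)%N by lia.
have VR : J.+1%:R ^+ 2 * level_sum gam n <= (n.+3 * n.+2)%:R * level_sum gam n.+2.
  by apply: (level_sum_rec gamN); lia.
rewrite /X En En'; rewrite En in n2.
have b1 := betaS n J.*2.+1; have b2 := betaS n.+1 J.*2.
have V0 := @level_sum_ge0 R K gam n.
have B0 := beta_ge0 n.+2 J.*2.
move: VR b1 b2 B0 V0; rewrite !natrM -muln2 -[n.+3%:R]natr1 -[n.+2%:R]natr1 -[n.+1%:R]natr1.
rewrite -[(J * 2).+2%:R]natr1 -[(J * 2).+1%:R]natr1 natrM -[J.+1%:R]natr1 !exprS -muln2.
have -> : (J.+1 * 2 = (J * 2).+2)%N by lia.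
move: (beta n.+2 _) (beta n.+1 _) (beta n _) => B2 B1 Bn.
move: (level_sum _ n) (level_sum _ n.+2) (n%:R : R) (J%:R : R) (ler0n R n) (ler0n R J) (exprn_ge0 n (ler0n R 2)).
move=> V V2 x y x0 y0; move: (2 ^+ n) => e e0 VR b1 b2 B0 V0.
have {b1 b2} -> : Bn = 4 * (2 * y + 1) * (2 * y + 2) / ((2 * x + 1) * (2 * x + 3)) * B2.
  have -> : Bn = 2 * (y * 2 + 1 + 1) * B1 / (2 * x + 1) by rewrite -b1; field; lra.
  have -> : B1 = 2 * (y * 2 + 1) * B2 / (2 * (x + 1) + 1) by rewrite -b2; field; lra.
  by field; repeat (apply/andP; split); lra.
have VR' : V <= (x + 1 + 1 + 1) * (x + 1 + 1) * V2 / (y + 1) ^+ 2.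
  by rewrite ler_pdivlMr ?exprn_gt0 ?ltr_wpDl//; move: VR; rewrite expr0 mulr1 -expr2 [V * _]mulrC.
rewrite (_ : e * V * _ = e * (2 * (4 * (2 * y + 1) * (2 * y + 2) / ((2 * x + 1) * (2 * x + 3)) * B2)) * V); last by ring.
apply: le_trans (ler_wpM2l _ VR') _.
  rewrite mulr_ge0// mulr_ge0// mulr_ge0// divr_ge0// mulr_ge0//; lra.
rewrite le_eqVlt; apply/orP; left; apply/eqP; rewrite /ratio.
by field; repeat (apply/andP; split); lra.
Qed.

(** By parity only the degrees [N - 2 J] contribute; grouping the sum by degree leaves the terms
    [X J], whose weights sum to at most 3. *)
Lemma level_bound :
  \sum_(k : idx K) 2 ^+ deg k *
     (lap_coef gam k.1.1 k.1.2 k.2 ^+ 2 / wfact k.1.1 k.1.2 k.2) *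
     (2 * beta (deg k) (N - deg k)) <=
  3 * \sum_(k : idx K) 2 ^+ deg k * (gam k ^+ 2 / wfact k.1.1 k.1.2 k.2).
Proof.
set f := fun k : idx K => lap_coef gam k.1.1 k.1.2 k.2 ^+ 2 / wfact k.1.1 k.1.2 k.2 : R.
have f0 k : ~~ [exists J : 'I_(N./2).+1, deg k == (N - J.*2)%N] -> f k = 0.
  rewrite negb_exists => /forallP H; rewrite /f (lap_coef_eq0 gamN) ?expr0n ?mul0r//.
  apply/negP => /negP; rewrite negb_or -leqNgt -/(deg k) => /andP[kN oN].
  have jb : ((N - deg k)./2 < (N./2).+1)%N by lia.
  by have /eqP := H (Ordinal jb); rewrite /=; lia.
have -> : \sum_(k : idx K) 2 ^+ deg k * (gam k ^+ 2 / wfact k.1.1 k.1.2 k.2) = 2 ^+ N * level_sum gam N.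
  rewrite (level_sum_top gamN) mulr_sumr; apply: eq_bigr => k _.
  by have [->//|/gamN ->] := eqVneq (deg k) N; rewrite expr0n mul0r !mulr0.
have -> : \sum_(k : idx K) 2 ^+ deg k * f k * (2 * beta (deg k) (N - deg k)) =
    \sum_(J < (N./2).+1) X J.
  rewrite (bigID (fun k => [exists J : 'I_(N./2).+1, deg k == (N - J.*2)%N])) /=.
  rewrite [X in _ + X]big1 ?addr0; last by move=> k /f0 ->; rewrite mulr0 mul0r.
  rewrite (partition_big (fun k => inord (N - deg k)./2 : 'I_(N./2).+1) xpredT)//=.
  apply: eq_bigr => J _; rewrite /X /level_sum mulr_sumr mulr_suml.
  have JL := ltn_ord J.
  apply: eq_big => [k|k /andP[/existsP[J' /eqP kJ'] /eqP E]].
    apply/idP/idP => [/andP[/existsP[J' /eqP kJ'] /eqP <-]|/eqP kJ].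
      by have := ltn_ord J'; rewrite inordK kJ'; lia.
    apply/andP; split; first by apply/existsP; exists J; rewrite kJ.
    by apply/eqP/val_inj; rewrite /= inordK kJ; lia.
  have kJ : deg k = (N - J.*2)%N.
    by have := ltn_ord J'; rewrite -E inordK kJ'; lia.
  by rewrite kJ (_ : (N - (N - J.*2))%N = J.*2)//; lia.
have V0 : 0 <= 2 ^+ N * level_sum gam N by rewrite mulr_ge0 ?exprn_ge0 ?level_sum_ge0.
apply: le_trans (ler_wpM2r V0 (sum_weight_le3 N)); rewrite mulr_suml.
by apply: ler_sum => J _; apply: X_le; have := ltn_ord J; lia.
Qed.

End weights.

(** * Gaussian integrals *)

Section scaling.
Context {R : realType}.
Local Notation mu := (@lebesgue_measure R).

(** [l] times the image of Lebesgue measure under the dilation agrees with Lebesgue measure on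
    half-open intervals, hence on all measurable sets. *)
Lemma ge0_integral_scale (l : R) (f : R -> \bar R) : 0 < l ->
  measurable_fun setT f -> (forall x, (0 <= f x)%E) ->
  (\int[mu]_x f x = l%:E * \int[mu]_x f (l * x)%R)%E.
Proof.
move=> l0 mf f0.
pose phi : measurableTypeR R -> measurableTypeR R := fun x => l * x.
have mphi : measurable_fun setT phi by exact: measurable_funM.
pose P := measure_function_pushforward__canonical__measure_function_Measure mu mphi.
pose nu := mscale (NngNum (ltW l0)) P.
have nuE A : measurable A -> mu A = nu A.
  apply: lebesgue_measure_unique => //= _ [[a b]] _ <-.
  rewrite /nu /mscale /= /pushforward.
  rewrite (_ : phi @^-1` _ = `](a / l), (b / l)]%classic); last first.
    apply/seteqP; split => x /=; rewrite /phi !in_itv/= ltr_pdivrMr// ler_pdivlMr//;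
      by rewrite mulrC.
  rewrite !lebesgue_measure_itv/= !lte_fin ltr_pM2r ?invr_gt0//.
  by case: ifP => _; rewrite ?mule0// -EFinB -EFinM; congr EFin; field; rewrite gt_eqF.
rewrite (@eq_measure_integral _ _ _ _ nu); last by move=> A mA _; exact: nuE.
rewrite ge0_integral_mscale//; congr (_ * _)%E.
by rewrite (@ge0_integral_pushforward _ _ _ _ R phi mphi mu)//.
Qed.

End scaling.

Section product_integral.
Context d1 d2 (T1 : measurableType d1) (T2 : measurableType d2) (R : realType).
Variables (m1 : {sigma_finite_measure set T1 -> \bar R})
          (m2 : {sigma_finite_measure set T2 -> \bar R}).
Variables (f : T1 -> R) (g : T2 -> R).
Hypothesis intf : m1.-integrable setT (EFin \o f).
Hypothesis intg : m2.-integrable setT (EFin \o g).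

Lemma measurable_fun_tensor : measurable_fun setT f -> measurable_fun setT g ->
  measurable_fun setT (fun z : T1 * T2 => f z.1 * g z.2).
Proof. by move=> mf mg; apply: measurable_funM; apply: measurableT_comp. Qed.

Let mf : measurable_fun setT f.
Proof. by apply/measurable_EFinP; exact: measurable_int intf. Qed.

Let mg : measurable_fun setT g.
Proof. by apply/measurable_EFinP; exact: measurable_int intg. Qed.

Lemma integrable_tensor :
  (m1 \x m2)%E.-integrable setT (EFin \o (fun z => f z.1 * g z.2)).
Proof.
apply/integrable12ltyP; first by apply/measurable_EFinP; exact: measurable_fun_tensor.
have /integrableP[_ If] := intf; have /integrableP[_ Ig] := intg.
under eq_integral.
  move=> x _; under eq_integral do rewrite /= normrM EFinM.
  rewrite ge0_integralZl_EFin//; last by do 2 apply: measurableT_comp => //.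
  over.
rewrite ge0_integralZr//; last 2 first.
- by do 2 apply: measurableT_comp => //.
- exact: integral_ge0.
rewrite lte_mul_pinfty//; first exact: integral_ge0.
by rewrite ge0_fin_numE//; exact: integral_ge0.
Qed.

Lemma Rintegral_tensor :
  \int[(m1 \x m2)%E]_z (f z.1 * g z.2) = (\int[m1]_x f x) * (\int[m2]_y g y).
Proof.
rewrite /Rintegral -fineM ?integrable_fin_num//; congr fine.
rewrite -(integral12_prod_meas1 integrable_tensor) /fubini_F /=.
under eq_integral.
  move=> x _; under eq_integral do rewrite EFinM.
  rewrite integralZl//.
  over.
rewrite /= -[in RHS](fineK (integrable_fin_num measurableT intg)) -integralZr//.
by under [RHS]eq_integral do rewrite fineK ?integrable_fin_num//.
Qed.

End product_integral.

Section gauss1.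
Context {R : realType}.
Local Notation mu := (@lebesgue_measure R).
Implicit Types (a x : R) (p q : {poly R}).

Lemma poly_bound p : exists2 C : R, 0 <= C & exists m, forall x,
  `|p.[x]| <= C * (1 + x ^+ 2) ^+ m.
Proof.
elim/poly_ind: p => [|p c [C C0 [m H]]].
  by exists 0 => //; exists 0%N => x; rewrite horner0 normr0 mul0r.
exists (C + `|c|); first by rewrite addr_ge0.
exists m.+1 => x; rewrite hornerMXaddC (le_trans (ler_normD _ _))// mulrDl.
have x1 : 1 <= 1 + x ^+ 2 by rewrite lerDl sqr_ge0.
apply: lerD; last by rewrite ler_peMr// exprn_ege1.
rewrite normrM exprSr mulrA; apply: ler_pM => //.
rewrite ler_norml; apply/andP; split; nra.
Qed.

Lemma pow_gauss_bound a m : 0 < a -> exists2 M : R, 0 <= M &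
  forall x, (1 + x ^+ 2) ^+ m * expR (- (a * x ^+ 2)) <= M.
Proof.
move=> a0; case: m => [|m].
  by exists 1 => // x; rewrite mul1r -expR0 ler_expR lerNl oppr0 mulr_ge0 ?sqr_ge0 ?(ltW a0).
pose b := m.+1%:R / a; have b0 : 0 < b by rewrite divr_gt0.
exists (b ^+ m.+1 * expR a) => [|x]; first by rewrite mulr_ge0 ?expR_ge0 ?exprn_ge0 ?ltW.
rewrite -ler_pdivlMr ?expR_gt0// -expRN opprK -mulrA -expRD.
rewrite (_ : a + _ = m.+1%:R * (a * (1 + x ^+ 2) / m.+1%:R)); last first.
  by field; rewrite nat1r pnatr_eq0.
rewrite expRM_natl -exprMn lerXn2r ?nnegrE//.
- by rewrite addr_ge0 ?sqr_ge0.
- by rewrite mulr_ge0 ?expR_ge0 ?ltW.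
rewrite mulrC -ler_pdivrMr// (le_trans _ (expR_ge1Dx _))// ler_wpDl// /b.
by rewrite invf_div mulrC mulrAC.
Qed.

Lemma poly_gauss_bound a p : 0 < a -> exists2 M : R, 0 <= M &
  forall x, `|p.[x] * expR (- (a * x ^+ 2))| <= M.
Proof.
move=> a0; have [C C0 [m H]] := poly_bound p; have [M M0 HM] := pow_gauss_bound m a0.
exists (C * M) => [|x]; first exact: mulr_ge0.
rewrite normrM (ger0_norm (expR_ge0 _)).
by apply: (le_trans (ler_wpM2r (expR_ge0 _) (H x))); rewrite -mulrA ler_wpM2l.
Qed.

Lemma integrable_gauss a : 0 < a ->
  mu.-integrable setT (EFin \o (fun x => expR (- (a * x ^+ 2)))).
Proof.
move=> a0; have s0 : 0 < Num.sqrt a by rewrite sqrtr_gt0.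
have mg b : measurable_fun setT (fun x : R => expR (- (b * x ^+ 2))).
  apply: measurableT_comp => //; apply: measurableT_comp => //.
  by apply: measurable_funM => //; apply: exprn_measurable.
apply/integrableP; split; first by apply/measurable_EFinP; exact: mg.
under eq_integral do rewrite /= ger0_norm ?expR_ge0//.
rewrite (@ge0_integral_scale R (Num.sqrt a)^-1) ?invr_gt0//; last by apply/measurable_EFinP; exact: mg.
under eq_integral.
  move=> x _; rewrite exprMn exprVn sqr_sqrtr ?ltW// mulrA divff ?gt_eqF// mul1r -/(gauss_fun x).
  over.
by rewrite integralT_gauss -EFinM ltry.
Qed.

Lemma measurable_horner p : measurable_fun setT (fun x : R => p.[x]).
Proof.
elim/poly_ind: p => [|p c IH].
  by rewrite (_ : (fun _ => _) = cst 0)//; apply/funext => x; rewrite horner0.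
under eq_fun do rewrite hornerMXaddC.
by apply: measurable_funD => //; apply: measurable_funM.
Qed.

Lemma measurable_poly_gauss a p :
  measurable_fun setT (fun x : R => p.[x] * expR (- (a * x ^+ 2))).
Proof.
apply: measurable_funM; first exact: measurable_horner.
apply: measurableT_comp => //; apply: measurableT_comp => //.
by apply: measurable_funM => //; apply: exprn_measurable.
Qed.

(** Half of the exponent bounds the polynomial, the other half is integrable. *)
Lemma integrable_poly_gauss a p : 0 < a ->
  mu.-integrable setT (EFin \o (fun x => p.[x] * expR (- (a * x ^+ 2)))).
Proof.
move=> a0; have h0 : 0 < a / 2 by rewrite divr_gt0.
have [M M0 HM] := poly_gauss_bound p h0.
apply: (@le_integrable _ _ _ mu setT measurableT _
  (fun x => M%:E * (expR (- (a / 2 * x ^+ 2)))%:E)%E).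
- by apply/measurable_EFinP; exact: measurable_poly_gauss.
- move=> x _; rewrite /= lee_fin !normrM (ger0_norm M0).
  rewrite (_ : - (a * _) = - (a / 2 * x ^+ 2) + - (a / 2 * x ^+ 2)); last by field.
  by rewrite expRD normrM mulrA ler_wpM2r// -normrM.
- exact: integrableZl (integrable_gauss h0).
Qed.

End gauss1.

Section gint.
Context {R : realType}.
Local Notation mu := (@lebesgue_measure R).
Implicit Types (p q : {poly R}).

Definition dgauss a p : {poly R} := p^`() - (2 * a) *: ('X * p).

Lemma is_derive_poly_gauss a p (x : R) :
  is_derive x 1 (fun y => p.[y] * expR (- (a * y ^+ 2)))
    ((dgauss a p).[x] * expR (- (a * x ^+ 2))).
Proof.
have dq : is_derive x 1 (horner (- (a *: 'X^2) : {poly R})) (- (2 * a * x)).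
  by apply: is_derive_eq; rewrite derivN derivZ derivXn /= !hornerE; ring.
have dE := is_derive1_comp (is_derive_expR (- (a *: 'X^2)).[x]) dq.
have dp := is_derive_poly p x.
have := is_deriveM dp dE.
rewrite (_ : _ * _ = (fun y => p.[y] * expR (- (a * y ^+ 2)))); last first.
  by apply/funext => y; rewrite !fctE /= !hornerE.
move=> H; apply: (is_derive_eq H).
rewrite /dgauss /GRing.scale /= hornerN hornerZ hornerXn hornerD hornerN hornerZ hornerM hornerX.
by ring.
Qed.

Definition gint p : R := \int[mu]_x (p.[x] * expR (- (1 * x ^+ 2))).

Lemma integrable_gint p :
  mu.-integrable setT (EFin \o (fun x => p.[x] * expR (- (1 * x ^+ 2)))).
Proof. exact: integrable_poly_gauss. Qed.

Lemma gintD p q : gint (p + q) = gint p + gint q.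
Proof.
rewrite /gint -RintegralD ?integrable_gint//.
by apply: eq_Rintegral => x _; rewrite hornerD mulrDl.
Qed.

Lemma gintZ c p : gint (c *: p) = c * gint p.
Proof.
rewrite /gint -RintegralZl ?integrable_gint//.
by apply: eq_Rintegral => x _; rewrite hornerZ -[LHS]mulrA.
Qed.

(** The fundamental theorem on growing symmetric intervals: the boundary values are [O (1 / n)]
    because [x p(x) exp (- x ^ 2)] is bounded, and dominated convergence passes to the whole
    line. *)
Lemma gint_dgauss p : gint (dgauss 1 p) = 0.
Proof.
pose F (x : R) := p.[x] * expR (- (1 * x ^+ 2)).
pose f (x : R) := (dgauss 1 p).[x] * expR (- (1 * x ^+ 2)).
have dF (x : R) : is_derive x 1 F (f x) by exact: is_derive_poly_gauss.
have cf : continuous f.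
  move=> x; apply: differentiable_continuous; apply/derivable1_diffP.
  by case: (is_derive_poly_gauss 1 (dgauss 1 p) x).
have cF : continuous F.
  by move=> x; apply: differentiable_continuous; apply/derivable1_diffP; case: (dF x).
have intf : mu.-integrable setT (EFin \o f) by exact: integrable_gint.
have mf : measurable_fun setT (EFin \o f) by exact: measurable_int intf.
pose D n : set R := `[(- n.+1%:R)%R, (n.+1%:R)%R]%classic.
have FTC n : (\int[mu]_x ((EFin \o f) \_ (D n)) x = (F n.+1%:R - F (- n.+1%:R))%:E)%E.
  rewrite -integral_mkcond EFinB; apply: continuous_FTC2.
  - by apply: (@lt_trans _ _ 0); rewrite ?oppr_lt0 ?ltr0n.
  - exact: continuous_subspaceT.
  - split; [by move=> x _; case: (dF x)|apply: cvg_at_right_filter|apply: cvg_at_left_filter]; exact: cF.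
  - by move=> x _; rewrite derive1E; case: (dF x) => _ ->.
have Fb : exists M : R, forall n, `|F n.+1%:R - F (- n.+1%:R)| <= M / n.+1%:R.
  have [M M0 HM] := @poly_gauss_bound R 1 ('X * p) ltr01.
  exists (M + M) => n; rewrite mulrDl (le_trans (ler_normB _ _))//.
  have G (y : R) : `|y| = n.+1%:R -> `|F y| <= M / n.+1%:R.
    move=> yn; rewrite ler_pdivlMr// -yn mulrC -normrM /F mulrA.
    by have := HM y; rewrite hornerM hornerX.
  by apply: lerD; apply: G; rewrite ?normrN ger0_norm.
have cv0 : (F n.+1%:R - F (- n.+1%:R)) @[n --> \oo] --> (0 : R).
  have [M HM] := Fb; apply/norm_cvg0P.
  apply: (@squeeze_cvgr _ _ _ _ (fun=> 0) (fun n => M / n.+1%:R)).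
  - by apply: nearW => n; rewrite normr_ge0 HM.
  - exact: cvg_cst.
  - rewrite -[X in _ --> X](mulr0 M); apply: cvgMr; exact: cvg_harmonic.
have dom : (\int[mu]_x ((EFin \o f) \_ (D n)) x @[n --> \oo] --> \int[mu]_x (EFin \o f) x)%E.
  have mfn n : measurable_fun setT ((EFin \o f) \_ (D n)).
    by apply/(measurable_restrictT _ _).1; [exact: measurable_itv|exact: measurable_funTS].
  have [] := @dominated_convergence _ _ _ mu setT measurableT
    (fun n => (EFin \o f) \_ (D n)) (EFin \o f) (abse \o (EFin \o f)) mfn mf.
  - apply: aeW => x _; apply: cvg_near_cst.
    exists (Num.truncn `|x|) => // n /= xn; rewrite patchE ifT// inE /D /= in_itv/=.
    rewrite -ler_norml (le_trans (ltW (truncnS_gt _)))// ler_nat ltnS //.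
  - exact: integrable_abse.
  - by apply: aeW => x n _; rewrite patchE; case: ifP => _; [exact: lexx|rewrite abse0; exact: abse_ge0].
  by move=> _ _.
have E : (\int[mu]_x (EFin \o f) x = 0)%E.
  have E0 : (\int[mu]_x ((EFin \o f) \_ (D n)) x @[n --> \oo] --> 0)%E.
    by under eq_fun do rewrite FTC; apply: cvg_EFin; [exact: nearW|exact: cv0].
  exact: (cvg_unique (@ereal_hausdorff R) dom E0).
by rewrite /gint /Rintegral E.
Qed.

(** Integration by parts turns the raising recurrence on one factor into a derivative on the other
    ([rec]), so both indices drop together until one of them is 0. *)
Lemma gint_herm m n :
  gint (herm m * herm n) = if m == n then 2 ^+ n / n`!%:R * gint 1 else 0.
Proof.
have rec i j : j.+1%:R * gint (herm i * herm j.+1) = gint ((herm i)^`() * herm j).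
  rewrite -gintZ scalerAr hermS -[LHS]addr0 -(gint_dgauss (herm i * herm j)) -gintD.
  congr gint; rewrite /dgauss mulr1 derivM mulrBr -scalerAr.
  by rewrite ['X * (_ * _)]mulrCA; ring.
elim: n m => [|n IH] m.
  case: m => [|m]; first by rewrite eqxx herm0 mulr1 expr0 divr1 mul1r.
  apply: (@mulfI _ m.+1%:R); first by rewrite pnatr_eq0.
  rewrite /= mulr0 [herm m.+1 * _]mulrC rec.
  by rewrite herm0 -polyC1 derivC mul0r -(scale0r 1) gintZ mul0r.
apply: (@mulfI _ n.+1%:R); first by rewrite pnatr_eq0.
rewrite rec deriv_herm; case: m => [|m].
  by rewrite mul0r mulr0 -(scale0r 1) gintZ mul0r.
rewrite -scalerAl gintZ IH eqSS; case: eqP => _; last by rewrite !mulr0.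
rewrite factS natrM exprS; field.
by rewrite nat1r !pnatr_eq0 -lt0n fact_gt0.
Qed.

End gint.

(** * Hermite functions in three variables *)

Lemma sigma_finite_product d1 d2 (T1 : measurableType d1)
    (T2 : measurableType d2) (R : realType)
    (m1 : {sigma_finite_measure set T1 -> \bar R})
    (m2 : {sigma_finite_measure set T2 -> \bar R}) :
  sigma_finite setT (m1 \x m2)%E.
Proof.
have /sigma_finiteP[F [FT F_nd F_fin]] := sigma_finiteT m1.
have /sigma_finiteP[G [GT G_nd G_fin]] := sigma_finiteT m2.
exists (fun n => F n `*` G n) => [|n]; last first.
  have [mF Fn] := F_fin n; have [mG Gn] := G_fin n; split; first exact: measurableX.
  by rewrite product_measure1E// lte_mul_pinfty// ge0_fin_numE.
apply/seteqP; split => // -[x y] _.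
have [i _ Fx] : (\bigcup_n F n) x by rewrite -FT.
have [j _ Gy] : (\bigcup_n G n) y by rewrite -GT.
exists (maxn i j) => //; split => /=.
  by have /subsetPset := F_nd _ _ (leq_maxl i j); apply.
by have /subsetPset := G_nd _ _ (leq_maxr i j); apply.
Qed.

Section product_map.
Local Open Scope ereal_scope.
Context d1 d2 (T1 : measurableType d1) (T2 : measurableType d2) (R : realType).
Variables (m1 : {sigma_finite_measure set T1 -> \bar R})
          (m2 : {sigma_finite_measure set T2 -> \bar R}).
Variables (phi1 : T1 -> T1) (phi2 : T2 -> T2) (c1 c2 : R).
Hypotheses (mphi1 : measurable_fun setT phi1) (mphi2 : measurable_fun setT phi2).
Hypotheses (c1_ge0 : (0 <= c1)%R) (c2_ge0 : (0 <= c2)%R).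
Hypothesis int1 : forall f, measurable_fun setT f -> (forall x, 0 <= f x) ->
  \int[m1]_x f x = c1%:E * \int[m1]_x f (phi1 x).
Hypothesis int2 : forall f, measurable_fun setT f -> (forall x, 0 <= f x) ->
  \int[m2]_x f x = c2%:E * \int[m2]_x f (phi2 x).

(** Tonelli in both orders: the variable is changed in the second coordinate as inner integral, then
    in the first. *)
Lemma ge0_integral_prod_map (f : T1 * T2 -> \bar R) :
  measurable_fun setT f -> (forall x, 0 <= f x) ->
  \int[m1 \x m2]_z f z =
  (c1 * c2)%:E * \int[m1 \x m2]_z f (phi1 z.1, phi2 z.2).
Proof.
move=> mf f0; pose g z := f (z.1, phi2 z.2).
have mg : measurable_fun setT g.
  apply: measurableT_comp => //; apply: measurable_fun_pair => //.
  exact: measurableT_comp.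
have g0 z : 0 <= g z by exact: f0.
have mh : measurable_fun setT (fun z => f (phi1 z.1, phi2 z.2)).
  by apply: measurableT_comp => //; apply: measurable_fun_pair; exact: measurableT_comp.
have -> : \int[m1 \x m2]_z f z = c2%:E * \int[m1 \x m2]_z g z.
  rewrite !fubini_tonelli1// -ge0_integralZl_EFin//; last 2 first.
  - by move=> x _; exact: integral_ge0.
  - exact: (measurable_fun_fubini_tonelli_F g).
  apply: eq_integral => x _; rewrite /fubini_F (int2 (f := fun y => f (x, y)))//.
  by apply: measurableT_comp => //; exact: measurable_pair2.
rewrite mulrC EFinM -muleA; congr (_ * _); rewrite !fubini_tonelli2//.
rewrite -ge0_integralZl_EFin//; last 2 first.
- by move=> x _; exact: integral_ge0.
- exact: (measurable_fun_fubini_tonelli_G (fun z => f (phi1 z.1, phi2 z.2))).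
apply: eq_integral => y _; rewrite /fubini_G (int1 (f := fun x => g (x, y)))//.
by apply: measurableT_comp => //; exact: measurable_pair1.
Qed.

End product_map.

(* the library infers for [product_measure1] only its sub-probability
   instance, hence these explicit sigma-finite copies *)
Definition leb2 {R : realType} := (@lebesgue_measure R \x @lebesgue_measure R)%E.

HB.instance Definition _ (R : realType) := Measure.on (@leb2 R).
HB.instance Definition _ (R : realType) :=
  Measure_isSigmaFinite.Build _ _ _ (@leb2 R) (sigma_finite_product _ _).
HB.instance Definition _ (R : realType) :=
  Measure_isSigmaFinite.Build _ _ _ (@leb3 R) (@sigma_finite_product _ _ _ _ R leb2 lebesgue_measure).

Section leb3_integral.
Context {R : realType}.
Local Notation mu := (@lebesgue_measure R).
Local Notation leb3 := (@leb3 R).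

(** Reduced to real powers of the nonnegative [x ^ 2]; the identity persists at 0, where the inverse
    is 0. *)
Lemma measurable_inv : measurable_fun setT (@GRing.inv R).
Proof.
rewrite (_ : GRing.inv = fun x => x * (x ^+ 2) `^ (-1)); last first.
  apply/funext => x; rewrite powR_inv1 ?sqr_ge0//.
  by have [->|x0] := eqVneq x 0; [rewrite invr0 mul0r|field].
apply: measurable_funM => //; apply: (measurableT_comp (measurable_powR _)).
exact: exprn_measurable.
Qed.

Lemma measurable_tensor3 (f g h : R -> R) :
  measurable_fun setT f -> measurable_fun setT g -> measurable_fun setT h ->
  measurable_fun setT (fun x : R * R * R => f x.1.1 * g x.1.2 * h x.2).
Proof.
by move=> mf mg mh; exact: (measurable_fun_tensor (measurable_fun_tensor mf mg) mh).
Qed.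

Lemma measurable_sqlen : measurable_fun setT (@sqlen R).
Proof.
by do !apply: measurable_funD; apply: measurable_funX => //; apply: measurableT_comp.
Qed.

Lemma integrable_tensor3 (f g h : R -> R) :
  mu.-integrable setT (EFin \o f) -> mu.-integrable setT (EFin \o g) ->
  mu.-integrable setT (EFin \o h) ->
  leb3.-integrable setT (EFin \o (fun x => f x.1.1 * g x.1.2 * h x.2)).
Proof.
move=> If Ig Ih; have Ifg := integrable_tensor If Ig.
exact: (@integrable_tensor _ _ _ _ R leb2 mu _ _ Ifg Ih).
Qed.

Lemma Rintegral_tensor3 (f g h : R -> R) :
  mu.-integrable setT (EFin \o f) -> mu.-integrable setT (EFin \o g) ->
  mu.-integrable setT (EFin \o h) ->
  \int[leb3]_x (f x.1.1 * g x.1.2 * h x.2) =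
  (\int[mu]_x f x) * (\int[mu]_x g x) * (\int[mu]_x h x).
Proof.
move=> If Ig Ih; have Ifg := integrable_tensor If Ig.
by rewrite -(Rintegral_tensor If Ig) -(@Rintegral_tensor _ _ _ _ R leb2 mu _ _ Ifg Ih).
Qed.

Lemma ge0_integral_scale3 (l : R) (f : R * R * R -> \bar R) : 0 < l ->
  measurable_fun setT f -> (forall x, (0 <= f x)%E) ->
  (\int[leb3]_x f x =
   (l ^+ 3)%:E * \int[leb3]_x f (l * x.1.1, l * x.1.2, l * x.2)%R)%E.
Proof.
move=> l0 mf f0; have ml : measurable_fun setT ( *%R l) by exact: mulrl_measurable.
have S1 := ge0_integral_scale l0.
have S2 := ge0_integral_prod_map (m1 := mu) (m2 := mu) ml ml (ltW l0) (ltW l0) S1 S1.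
have l2 : 0 <= l * l by rewrite mulr_ge0// ltW.
have ml2 : measurable_fun setT (fun z : R * R => (l * z.1, l * z.2)).
  by apply: measurable_fun_pair; apply: measurableT_comp.
have := ge0_integral_prod_map (m1 := leb2) (m2 := mu) ml2 ml l2 (ltW l0) S2 S1 mf f0.
by rewrite (_ : l * l * l = l ^+ 3)//; ring.
Qed.

End leb3_integral.

Section hermite3.
Context {R : realType}.
Local Notation mu := (@lebesgue_measure R).
Local Notation leb3 := (@leb3 R).
Implicit Types (p q r : {poly R}) (a : R).

Definition pgauss a p (y : R) : R := p.[y] * expR (- (a * y ^+ 2)).

Definition pgauss3 a p q r (x : R * R * R) : R :=
  pgauss a p x.1.1 * pgauss a q x.1.2 * pgauss a r x.2.

Lemma measurable_pgauss3 a p q r : measurable_fun setT (pgauss3 a p q r).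
Proof. by apply: measurable_tensor3; apply: measurable_poly_gauss. Qed.

Lemma integrable_pgauss3 a p q r : 0 < a ->
  leb3.-integrable setT (EFin \o pgauss3 a p q r).
Proof. by move=> a0; apply: integrable_tensor3; exact: integrable_poly_gauss. Qed.

Lemma Rintegral_pgauss3 p q r :
  \int[leb3]_x pgauss3 1 p q r x = gint p * gint q * gint r.
Proof. by apply: Rintegral_tensor3; apply: integrable_poly_gauss. Qed.

Definition hb {K} (n : idx K) : R * R * R -> R :=
  pgauss3 (1 / 2) (herm n.1.1) (herm n.1.2) (herm n.2).

(** The squared norm of [hb n] in [L^2]. *)
Definition eta {K} (n : idx K) : R :=
  gint 1 ^+ 3 * (2 ^+ deg n / wfact n.1.1 n.1.2 n.2).

Lemma pgauss3M p q r p' q' r' x :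
  pgauss3 (1 / 2) p q r x * pgauss3 (1 / 2) p' q' r' x =
  pgauss3 1 (p * p') (q * q') (r * r') x.
Proof.
have E (y : R) : expR (- (1 / 2 * y ^+ 2)) ^+ 2 = expR (- (1 * y ^+ 2)).
  by rewrite expr2 -expRD; congr expR; field.
by rewrite /pgauss3 /pgauss !hornerM -!E; ring.
Qed.

Lemma gint1_gt0 : 0 < gint (1 : {poly R}).
Proof.
rewrite /gint /Rintegral; under eq_integral.
  move=> x _; rewrite hornerC mul1r mul1r -/(gauss_fun x); over.
by rewrite integralT_gauss /= sqrtr_gt0 pi_gt0.
Qed.

Lemma eta_gt0 K (n : idx K) : 0 < eta n.
Proof.
by rewrite mulr_gt0 ?exprn_gt0 ?gint1_gt0// divr_gt0 ?exprn_gt0 ?wfact_gt0.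
Qed.

Lemma integrable_hbM K (m n : idx K) :
  leb3.-integrable setT (EFin \o (fun x => hb m x * hb n x)).
Proof.
rewrite (_ : (fun x => _) = pgauss3 1 (herm m.1.1 * herm n.1.1)
  (herm m.1.2 * herm n.1.2) (herm m.2 * herm n.2)); first exact: integrable_pgauss3.
by apply/funext => x; exact: pgauss3M.
Qed.

Lemma Rintegral_hbM K (m n : idx K) :
  \int[leb3]_x (hb m x * hb n x) = if m == n then eta n else 0.
Proof.
under eq_Rintegral do rewrite pgauss3M.
rewrite Rintegral_pgauss3 !gint_herm.
case: m n => -[m1 m2] m3 [[n1 n2] n3]; rewrite /eta /wfact /deg !xpair_eqE -!val_eqE /=.
case: eqP => [<-|_] /=; last by rewrite !mul0r.
case: eqP => [<-|_] /=; last by rewrite mulr0 mul0r.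
case: eqP => [<-|_] /=; last by rewrite mulr0.
rewrite !exprD !natrM; field.
by rewrite !pnatr_eq0 -!lt0n !fact_gt0.
Qed.

End hermite3.

Section orthogonal_family.
Context d (T : measurableType d) (R : realType) (m : {measure set T -> \bar R}).
Context (I : finType) (e : I -> T -> R) (nu : I -> R).
Hypothesis ie : forall i j, m.-integrable setT (EFin \o (fun x => e i x * e j x)).
Hypothesis oe : forall i j,
  \int[m]_x (e i x * e j x) = if i == j then nu j else 0.

Lemma integral_sqr_sum (c : I -> R) :
  (\int[m]_x ((\sum_i c i * e i x) ^+ 2)%:E = (\sum_i c i ^+ 2 * nu i)%:E)%E.
Proof.
pose h (p : I * I) x : \bar R := ((c p.1 * c p.2)%:E * (e p.1 x * e p.2 x)%:E)%E.
under eq_integral.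
  move=> x _; rewrite (_ : (_)%:E = (\sum_p h p x)%E); last first.
    rewrite expr2 big_distrlr /= pair_bigA /= -sumEFin; apply: eq_bigr => p _.
    by rewrite /h -EFinM; congr EFin; ring.
  over.
rewrite integral_sum//; last by move=> p; apply: integrableZl => //; exact: ie.
rewrite -sumEFin (eq_bigr (fun p : I * I =>
    ((c p.1 * c p.2) * (if p.1 == p.2 then nu p.2 else 0))%:E)); last first.
  move=> p _; rewrite integralZl//; last exact: ie.
  rewrite -[X in (_ * X)%E]fineK; last by apply: integrable_fin_num => //; exact: ie.
  by rewrite -EFinM -(oe p.1 p.2).
rewrite -(pair_bigA _ (fun i j => (c i * c j * (if i == j then nu j else 0))%:E)) /=.
apply: eq_bigr => i _; rewrite (bigD1 i)//= eqxx big1 ?adde0 ?expr2// => j ji.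
by rewrite eq_sym (negbTE ji) mulr0.
Qed.

End orthogonal_family.

(** * Beta integrals on the unit interval *)

Section beta_integral.
Context {R : realType}.
Local Notation mu := (@lebesgue_measure R).

Definition pint (p : {poly R}) : R := \int[mu]_(x in `[0, 1]) p.[x].

Lemma continuous_horner (p : {poly R}) : continuous (horner p).
Proof. by move=> x; apply: differentiable_continuous; apply/derivable1_diffP. Qed.

Lemma integrable_pint (p : {poly R}) : mu.-integrable `[0, 1] (EFin \o horner p).
Proof.
apply: continuous_compact_integrable; first exact: segment_compact.
exact/continuous_subspaceT/continuous_horner.
Qed.

Lemma pintD p q : pint (p + q) = pint p + pint q.
Proof.
rewrite /pint -RintegralD ?integrable_pint//.
by apply: eq_Rintegral => x _; rewrite hornerD.
Qed.

Lemma pintZ c p : pint (c *: p) = c * pint p.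
Proof.
rewrite /pint -RintegralZl ?integrable_pint//.
by apply: eq_Rintegral => x _; rewrite hornerZ.
Qed.

Lemma pint_deriv p : pint p^`() = p.[1] - p.[0].
Proof.
rewrite /pint /Rintegral (continuous_FTC2 (F := horner p))//.
- exact/continuous_subspaceT/continuous_horner.
- split; [by move=> x _|apply: cvg_at_right_filter|apply: cvg_at_left_filter];
    exact: continuous_horner.
- by move=> x _; rewrite derive1E; case: (is_derive_poly p x) => _ ->.
Qed.

Definition beta (n m : nat) : R := pint ('X^(n.*2) * (1 - 'X^2) ^+ m).

Lemma beta_0 n : beta n 0 = (2 * n%:R + 1)^-1.
Proof.
have H : (n.*2.+1)%:R != 0 :> R by rewrite pnatr_eq0.
have E : ((n.*2.+1)%:R^-1 *: 'X^(n.*2.+1) : {poly R})^`() = 'X^(n.*2).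
  by rewrite derivZ derivXn -(scaler_nat _ 'X^_) scalerA mulVf// scale1r.
rewrite /beta mulr1 -E pint_deriv.
by rewrite !hornerZ !hornerXn expr1n expr0n /= mulr0 subr0 mulr1 -natrM natr1 mul2n.
Qed.

(** Integrate the derivative of [l ^ (2 n + 1) (1 - l ^ 2) ^ (m + 1)], a polynomial that vanishes at
    both endpoints. *)
Lemma beta_S n m : (2 * n%:R + 1) * beta n m.+1 = 2 * m.+1%:R * beta n.+1 m.
Proof.
have := pint_deriv ('X^(n.*2.+1) * (1 - 'X^2) ^+ m.+1).
have h1 (x : R) : (1 : {poly R}).[x] = 1 by rewrite -polyC1 hornerC.
rewrite !hornerM !horner_exp !hornerD !hornerN !hornerXn !h1.
rewrite !hornerX !expr1n subrr !expr0n /= mulr0 mul0r subr0.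
have dE : ((1 - 'X^2 : {poly R}) ^+ m.+1)^`() = (- (2 * m.+1%:R)) *: ('X * (1 - 'X^2) ^+ m).
  rewrite deriv_exp /= derivB derivXn -polyC1 derivC sub0r /= expr1 polyC1.
  rewrite -mulr_natl -(mulr_natl 'X) -!polyC_natr -mul_polyC polyCN polyCM; ring.
rewrite derivM derivXn dE -(mulr_natl 'X^_) -polyC_natr mul_polyC.
rewrite -scalerAr -scalerAl mulrA -exprSr -doubleS pintD !pintZ => /eqP.
rewrite mulNr subr_eq0 => /eqP <-; rewrite /beta; congr (_ * _).
by rewrite -[in RHS]natr1 -mul2n natrM.
Qed.

End beta_integral.

(** * The level estimate *)

Section level_estimate.
Context {R : realType}.
Local Notation mu := (@lebesgue_measure R).
Local Notation leb3 := (@leb3 R).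

Lemma continuous_pgauss a (p : {poly R}) : continuous (pgauss a p).
Proof.
move=> x; apply: differentiable_continuous; apply/derivable1_diffP.
by case: (is_derive_poly_gauss a p x).
Qed.

(* [exp (- rho) / rho] is the integral over [0 < l < 1] of this kernel *)
Definition ker (rho l : R) : R := 2 * l^-1 ^+ 3 * expR (- (rho * l^-1 ^+ 2)).

Lemma is_derive_ker (rho l : R) : l != 0 -> rho != 0 ->
  is_derive l 1 (fun y => expR (- (rho * y^-1 ^+ 2)) / rho) (ker rho l).
Proof.
move=> l0 rho0.
have dV : is_derive l 1 (fun y : R => y^-1) (- l ^- 2).
  by apply: (is_derive_eq (is_deriveV l0 (is_derive_id l 1))); rewrite /GRing.scale /= mulr1.
have dp := is_derive_poly (- (rho *: 'X^2)) l^-1.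
have dc := is_derive1_comp dp dV.
have dE := @is_derive1_comp R expR (horner (- (rho *: 'X^2)) \o GRing.inv) l _ _ (is_derive_expR _) dc.
have := is_deriveZ rho^-1 dE.
rewrite (_ : _ \*: _ = (fun y => expR (- (rho * y^-1 ^+ 2)) / rho)); last first.
  apply/funext => y /=; rewrite hornerN hornerZ hornerXn; exact: mulrC.
move=> H; apply: (is_derive_eq H).
rewrite /ker /GRing.scale /= hornerN hornerZ hornerXn derivN derivZ derivXn /=.
rewrite hornerN hornerZ hornerMn hornerXn expr1 mulr2n.
by field; rewrite l0.
Qed.

Lemma ker_ge0 (rho l : R) : 0 <= l -> 0 <= ker rho l.
Proof. by move=> l0; rewrite !mulr_ge0 ?exprn_ge0 ?invr_ge0 ?expR_ge0. Qed.

Lemma measurable_ker2 d (T : measurableType d) (f g : T -> R) :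
  measurable_fun setT f -> measurable_fun setT g ->
  measurable_fun setT (fun x => ker (f x) (g x)).
Proof.
move=> mf mg; have mV : measurable_fun setT (fun x => (g x)^-1).
  by apply: (measurableT_comp measurable_inv).
apply: measurable_funM.
  by apply: measurable_funM => //; apply: measurable_funX.
apply: measurableT_comp => //; apply: measurableT_comp => //.
by apply: measurable_funM => //; apply: measurable_funX.
Qed.

(** As the inverse of 0 is 0, the primitive jumps at 0, so the fundamental theorem is applied on
    [[d, 1]]. The boundary term at [d] is at most [d ^ 2 / rho ^ 2], and [d] is chosen to make this
    at most [e]. *)
Lemma kernel_le (rho : R) : 0 < rho ->
  ((expR (- rho) / rho)%:E <= \int[mu]_(l in `[0%R, 1%R]) (ker rho l)%:E)%E.
Proof.
move=> rho0; apply/lee_addgt0Pr => e e0.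
pose d := Num.min (2^-1) (e * rho ^+ 2).
have d0 : 0 < d by rewrite lt_min invr_gt0 ltr0n /= mulr_gt0 ?exprn_gt0.
have d1 : d < 1 by rewrite gt_min; apply/orP; left; rewrite invf_lt1 ?ltr1n.
have de : d <= e * rho ^+ 2 by rewrite ge_min lexx orbT.
have mk : measurable_fun setT (fun l => (ker rho l)%:E).
  by apply/measurable_EFinP; exact: measurable_ker2.
pose F (y : R) : R := expR (- (rho * y^-1 ^+ 2)) / rho.
have FTC : (\int[mu]_(l in `[d, 1%R]) (ker rho l)%:E =
    (expR (- (rho * 1^-1 ^+ 2)) / rho)%:E - (expR (- (rho * d^-1 ^+ 2)) / rho)%:E)%E.
  have nz x : d <= x -> x != 0 by move=> dx; rewrite gt_eqF// (lt_le_trans d0).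
  have dk x : d <= x -> is_derive x 1 F (ker rho x).
    by move=> /nz x0; apply: is_derive_ker => //; rewrite gt_eqF.
  have cF x : d <= x -> {for x, continuous F}.
    by move=> dx; apply: differentiable_continuous; apply/derivable1_diffP; case: (dk x dx).
  apply: (continuous_FTC2 (F := F)) => //.
  - apply: continuous_in_subspaceT => x; rewrite inE /= in_itv /= => /andP[dx _].
    have -> : ker rho = pgauss rho (2 *: 'X^3) \o GRing.inv.
      by apply/funext => y; rewrite /pgauss /= hornerZ hornerXn.
    apply: continuous_comp; first by apply: inv_continuous; exact: nz.
    exact: continuous_pgauss.
  - split; [move=> x|apply: cvg_at_right_filter; exact: cF|apply: cvg_at_left_filter; apply: cF; exact: ltW].
    by rewrite in_itv /= => /andP[dx _]; case: (dk x (ltW dx)).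
  - by move=> x; rewrite in_itv /= => /andP[dx _]; rewrite derive1E; case: (dk x (ltW dx)) => _ ->.
have sub : `[d, 1] `<=` (`[0, 1] : set R).
  by move=> x /=; rewrite !in_itv /= => /andP[dx ->]; rewrite (le_trans (ltW d0)).
have le1 : (\int[mu]_(l in `[d, 1%R]) (ker rho l)%:E <= \int[mu]_(l in `[0%R, 1%R]) (ker rho l)%:E)%E.
  apply: ge0_subset_integral => //; first exact: measurable_funTS.
  by move=> x /=; rewrite in_itv /= lee_fin => /andP[x0 _]; exact: ker_ge0.
apply: (le_trans _ (leeD2r e%:E le1)); rewrite FTC -EFinB -EFinD lee_fin.
rewrite invr1 expr1n mulr1 -addrA lerDl addrC subr_ge0.
have z0 : 0 < rho * d^-1 ^+ 2 by rewrite mulr_gt0 ?exprn_gt0 ?invr_gt0.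
have E : expR (- (rho * d^-1 ^+ 2)) <= (rho * d^-1 ^+ 2)^-1.
  by rewrite expRN lef_pV2 ?posrE ?expR_gt0// (le_trans _ (expR_ge1Dx _))// lerDr.
rewrite ler_pdivrMr// (le_trans E)// invfM exprVn invrK mulrC ler_pdivrMr//.
rewrite -mulrA -expr2 (le_trans _ de)// expr2 ler_piMl// ltW//.
Qed.


Definition herm3 {K} (n : idx K) (x : R * R * R) : R :=
  (herm n.1.1).[x.1.1] * (herm n.1.2).[x.1.2] * (herm n.2).[x.2].

Lemma hbE K (n : idx K) x : hb n x = herm3 n x * expR (- (1 / 2 * sqlen x)).
Proof.
rewrite /hb /pgauss3 /pgauss /herm3 /sqlen !mulrDr !opprD !expRD; ring.
Qed.

Lemma sqr_sum_hb K (c : idx K -> R) x :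
  (\sum_n c n * hb n x) ^+ 2 = (\sum_n c n * herm3 n x) ^+ 2 * expR (- sqlen x).
Proof.
under eq_bigr do rewrite hbE mulrA.
rewrite -mulr_suml exprMn; congr (_ * _).
by rewrite expr2 -expRD; congr expR; field.
Qed.

Lemma integral_sqr_sum_hb K (c : idx K -> R) :
  (\int[leb3]_x ((\sum_n c n * hb n x) ^+ 2)%:E = (\sum_n c n ^+ 2 * eta n)%:E)%E.
Proof.
exact: (@integral_sqr_sum _ _ _ leb3 _ _ (@eta R K) (@integrable_hbM R K) (@Rintegral_hbM R K)).
Qed.

Lemma measurable_herm3 K (n : idx K) : measurable_fun setT (herm3 n).
Proof. by apply: measurable_tensor3; apply: measurable_horner. Qed.

Lemma measurable_sum_herm3 K (c : idx K -> R) :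
  measurable_fun setT (fun x => \sum_n c n * herm3 n x).
Proof.
by apply: measurable_sum => n; apply: measurable_funM => //; exact: measurable_herm3.
Qed.

(** On a level the halved drops of the three indices always add up to [(N - deg k) / 2], so the
    power of [l ^ 2 - 1] is common to all [n] and [lap_coef] is what remains. *)
Lemma sum_herm3_scale K N (gam : idx K -> R) (l : R) (y : R * R * R) :
  (forall n, deg n != N -> gam n = 0) ->
  \sum_n gam n * herm3 n (l * y.1.1, l * y.1.2, l * y.2) =
  \sum_(k : idx K) (l ^+ deg k * (l ^+ 2 - 1) ^+ (N - deg k)./2 *
     lap_coef gam k.1.1 k.1.2 k.2) * herm3 k y.
Proof.
move=> gamN; set c := l ^+ 2 - 1.
have mul_sum3 (F G H : nat -> R) : (\sum_(a < K) F a) * (\sum_(b < K) G b) *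
    (\sum_(d < K) H d) = \sum_(k : idx K) F k.1.1 * G k.1.2 * H k.2.
  rewrite (sum3E K (fun a b d => F a * G b * H d)) mulr_suml mulr_suml.
  apply: eq_bigr => a _; rewrite [F a * _]mulr_sumr mulr_suml; apply: eq_bigr => b _.
  by rewrite mulr_sumr.
transitivity (\sum_n \sum_(k : idx K) gam n *
    (scal_coef l c n.1.1 k.1.1 * scal_coef l c n.1.2 k.1.2 * scal_coef l c n.2 k.2 * herm3 k y)).
  apply: eq_bigr => n _; rewrite /herm3 /= !(@herm_scale _ _ _ K)// -/c.
  rewrite (mul_sum3 (fun a => scal_coef l c n.1.1 a * (herm a).[y.1.1])
    (fun b => scal_coef l c n.1.2 b * (herm b).[y.1.2])
    (fun d => scal_coef l c n.2 d * (herm d).[y.2])) mulr_sumr.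
  by apply: eq_bigr => k _; ring.
rewrite exchange_big /=; apply: eq_bigr => k _.
rewrite /lap_coef mulr_sumr mulr_suml; apply: eq_bigr => n _.
have [En|/gamN ->] := eqVneq (deg n) N; last by rewrite !(mul0r, mulr0).
rewrite !mulrA; congr (_ * _); rewrite /scal_coef.
set e1 := shift_coef n.1.1 k.1.1; set e2 := shift_coef n.1.2 k.1.2; set e3 := shift_coef n.2 k.2.
have [e10|e10] := eqVneq e1 0; first by rewrite e10; ring.
have [e20|e20] := eqVneq e2 0; first by rewrite e20; ring.
have [e30|e30] := eqVneq e3 0; first by rewrite e30; ring.
have P i j : @shift_coef R i j != 0 -> i = (j + (i - j)./2.*2)%N.
  by rewrite /shift_coef; case: ifP => [/andP[? ?] _|]; [lia|rewrite eqxx].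
have H1 := P _ _ e10; have H2 := P _ _ e20; have H3 := P _ _ e30.
have -> : ((N - deg k)./2 = (n.1.1 - k.1.1)./2 + (n.1.2 - k.1.2)./2 + (n.2 - k.2)./2)%N.
  move: En; rewrite /deg.
  by rewrite [in X in X -> _]H1 [in X in X -> _]H2 [in X in X -> _]H3; lia.
by rewrite /deg !exprD; ring.
Qed.

Lemma level_estimate K N (gam : idx K -> R) :
  (forall n, deg n != N -> gam n = 0) ->
  (\int[leb3]_x ((\sum_n gam n * hb n x) ^+ 2 / sqlen x)%:E <=
   (3 * \sum_n gam n ^+ 2 * eta n)%:E)%E.
Proof.
move=> gamN.
pose P x := \sum_n gam n * herm3 n x.
pose D : set R := `[0%R, 1%R]%classic.
pose H (x : R * R * R) (l : R) : R := P x ^+ 2 * (\1_D l * ker (sqlen x) l).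
have H0 x l : 0 <= H x l.
  rewrite /H mulr_ge0 ?sqr_ge0// indicE; case: (boolP (l \in D)); last by rewrite mul0r.
  by rewrite inE /D /= in_itv /= => /andP[l0 _]; rewrite mul1r ker_ge0.
have mP : measurable_fun setT P by exact: measurable_sum_herm3.
have mH : measurable_fun setT (fun z : (R * R * R) * R => (H z.1 z.2)%:E).
  apply/measurable_EFinP; apply: measurable_funM.
    by apply: measurable_funX; apply: measurableT_comp.
  apply: measurable_funM.
    by apply: (measurableT_comp (measurable_indic _)) => //; exact: measurable_itv.
  by apply: measurable_ker2 => //; apply: (measurableT_comp measurable_sqlen).
have sum0 x : (0 <= \int[mu]_l (H x l)%:E)%E by apply: integral_ge0 => l _; rewrite lee_fin.
have int_D (f : R -> R) : (\int[mu]_l (\1_D l * f l)%:E = \int[mu]_(l in D) (f l)%:E)%E.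
  rewrite [RHS]integral_mkcond; apply: eq_integral => l _; rewrite patchE indicE.
  by case: (l \in D); rewrite ?mul1r ?mul0r.
(* Pointwise this is [kernel_le]; at the origin the left integrand is 0 because the inverse of 0 is
   0. *)
have step1 : (\int[leb3]_x ((\sum_n gam n * hb n x) ^+ 2 / sqlen x)%:E <=
    \int[leb3]_x \int[mu]_l (H x l)%:E)%E.
  have mI : measurable_fun setT (fun x => ((\sum_n gam n * hb n x) ^+ 2 / sqlen x)%:E).
    apply/measurable_EFinP; apply: measurable_funM.
      apply: measurable_funX; apply: measurable_sum => n; apply: measurable_funM => //.
      exact: measurable_pgauss3.
    exact: (measurableT_comp measurable_inv measurable_sqlen).
  have s0 x : 0 <= sqlen x :> R by rewrite /sqlen !addr_ge0 ?sqr_ge0.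
  apply: ge0_le_integral => //.
  - by move=> x _; rewrite lee_fin divr_ge0 ?sqr_ge0.
  - by apply: (@measurable_fun_fubini_tonelli_F _ _ _ _ R mu (fun z => (H z.1 z.2)%:E) mH) => z; rewrite lee_fin.
  move=> x _; have [s00|sp] := eqVneq (sqlen x) 0.
    by rewrite s00 invr0 mulr0.
  rewrite sqr_sum_hb -/(P x) -mulrA EFinM.
  under eq_integral do rewrite /H EFinM.
  rewrite ge0_integralZl_EFin ?sqr_ge0//; last 2 first.
  - move=> l _; have := H0 x l; rewrite /H lee_fin indicE.
    case: (boolP (l \in D)); last by rewrite mul0r.
    by rewrite inE /D /= in_itv /= => /andP[l0 _] _; rewrite mul1r ker_ge0.
  - apply/measurable_EFinP; apply: measurable_funM; last exact: measurable_ker2.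
    by apply: measurable_indic; exact: measurable_itv.
  rewrite int_D lee_wpmul2l ?lee_fin ?sqr_ge0// kernel_le//.
  by rewrite lt_neqAle eq_sym sp s0.
apply: (le_trans step1).
have -> : (\int[leb3]_x \int[mu]_l (H x l)%:E = \int[mu]_l \int[leb3]_x (H x l)%:E)%E.
  by apply: (@fubini_tonelli _ _ _ _ R leb3 mu (fun z => (H z.1 z.2)%:E) mH) => z; rewrite lee_fin.
pose Y (k : idx K) := lap_coef gam k.1.1 k.1.2 k.2.
(* The density in [l] given by orthogonality: [(l ^ 2 - 1) ^ j] squared is [(1 - l ^ 2) ^ (2 j)],
   with [2 j = N - deg k] wherever [Y k] is nonzero. It is polynomial, so its integral is a
   combination of beta values. *)
pose q : {poly R} := \sum_(k : idx K) (2 * (Y k ^+ 2 * eta k)) *: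
  ('X^((deg k).*2) * (1 - 'X^2) ^+ (N - deg k)).
have step2 l : (\int[leb3]_x (H x l)%:E <= (\1_D l * q.[l])%:E)%E.
  rewrite indicE; case: (boolP (l \in D)) => lD; last first.
    rewrite mul0r integral0_eq// => x _.
    by rewrite /H indicE (negbTE lD) mul0r mulr0.
  rewrite mul1r; move: (lD); rewrite inE /D /= in_itv /= => /andP[l0 l1].
  have qE : q.[l] = \sum_(k : idx K) 2 * (Y k ^+ 2 * eta k) *
      (l ^+ (deg k).*2 * (1 - l ^+ 2) ^+ (N - deg k)).
    rewrite /q horner_sum; apply: eq_bigr => k _.
    by rewrite hornerZ hornerM hornerXn horner_exp hornerD hornerN hornerXn -polyC1 hornerC.
  have q0 : 0 <= q.[l].
    have w0 : 0 <= 1 - l ^+ 2 by rewrite subr_ge0 expr_le1.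
    rewrite qE; apply: sumr_ge0 => k _; apply: mulr_ge0.
      by apply: mulr_ge0 => //; apply: mulr_ge0; [exact: sqr_ge0|exact/ltW/eta_gt0].
    by apply: mulr_ge0; exact: exprn_ge0.
  have [l00|lp] := eqVneq l 0.
    rewrite integral0_eq ?lee_fin// => x _.
    by rewrite /H /ker l00 invr0 expr0n /= mulr0 mul0r !mulr0.
  have {}lp : 0 < l by rewrite lt_neqAle eq_sym lp.
  have mHl : measurable_fun setT (fun x => (H x l)%:E).
    apply/measurable_EFinP; apply: measurable_funM; first exact: measurable_funX.
    by apply: measurable_funM => //; apply: measurable_ker2 => //; exact: measurable_sqlen.
  rewrite (ge0_integral_scale3 lp mHl); last by move=> x; rewrite lee_fin.
  rewrite -ge0_integralZl_EFin ?exprn_ge0//; last 2 first.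
  - by move=> x _; rewrite lee_fin.
  - apply: (measurableT_comp mHl).
    by apply: measurable_fun_pair; [apply: measurable_fun_pair|]; apply: measurable_funM => //;
      do ?apply: measurableT_comp.
  pose dl (k : idx K) := l ^+ deg k * (l ^+ 2 - 1) ^+ (N - deg k)./2 * Y k.
  (* The Jacobian [l ^ 3] cancels the factor [l ^ -3] of the kernel and leaves its 2. *)
  have E (y : R * R * R) : ((l ^+ 3)%:E * (H (l * y.1.1, l * y.1.2, l * y.2)%R l)%:E =
      2%:E * ((\sum_k dl k * hb k y) ^+ 2)%:E)%E.
    rewrite -!EFinM; congr EFin.
    rewrite /H indicE lD mul1r /P (sum_herm3_scale _ _ gamN) sqr_sum_hb -/dl /ker.
    rewrite (_ : sqlen _ = l ^+ 2 * sqlen y); last by rewrite /sqlen /=; ring.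
    rewrite (_ : l ^+ 2 * sqlen y * l^-1 ^+ 2 = sqlen y); last by field; rewrite gt_eqF.
    by field; rewrite gt_eqF.
  under eq_integral do rewrite E.
  rewrite ge0_integralZl_EFin//; last 2 first.
  - by move=> x _; rewrite lee_fin sqr_ge0.
  - apply/measurable_EFinP/measurable_funX; apply: measurable_sum => n.
    by apply: measurable_funM => //; exact: measurable_pgauss3.
  rewrite integral_sqr_sum_hb -EFinM lee_fin qE mulr_sumr; apply: ler_sum => k _.
  have [Y0|Yn0] := eqVneq (Y k) 0.
    by rewrite /dl Y0 mulr0 expr0n /= !(mul0r, mulr0).
  have [j Ej] : exists j, (N - deg k = j.*2)%N.
    exists (N - deg k)./2; have : ~~ odd (N - deg k); last by lia.
    by apply/negP => H1; case/negP: Yn0; apply/eqP; apply: (lap_coef_eq0 gamN); rewrite -/(deg k) H1 orbT.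
  rewrite /dl Ej doubleK -!muln2 !exprM [(1 - _) ^+ j ^+ 2](_ : _ = (l ^+ 2 - 1) ^+ j ^+ 2).
    by rewrite le_eqVlt; apply/orP; left; apply/eqP; ring.
  by rewrite -!exprM ![(j * 2)%N]mulnC !exprM -sqrrN opprB.
have pq : pint q = \sum_(k : idx K) 2 * (Y k ^+ 2 * eta k) * beta (deg k) (N - deg k).
  have pint0 : pint (0 : {poly R}) = 0 by rewrite -(scale0r 0) pintZ mul0r.
  by rewrite /q (big_morph pint pintD pint0); apply: eq_bigr => k _; rewrite pintZ.
apply: (@le_trans _ _ (pint q)%:E).
  rewrite /pint /Rintegral fineK ?(integrable_fin_num _ (integrable_pint q))//.
  rewrite -int_D; apply: ge0_le_integral => //.
  - by move=> l _; apply: integral_ge0 => x _; rewrite lee_fin.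
  - by apply: (@measurable_fun_fubini_tonelli_G _ _ _ _ R leb3 (fun z => (H z.1 z.2)%:E) mH) => z; rewrite lee_fin.
  - apply/measurable_EFinP; apply: measurable_funM; last exact: measurable_horner.
    by apply: measurable_indic; exact: measurable_itv.
rewrite lee_fin pq.
have G0 : 0 <= gint (1 : {poly R}) ^+ 3 by rewrite exprn_ge0// ltW// gint1_gt0.
have := ler_wpM2l G0 (level_bound beta_0 beta_S gamN).
rewrite mulrCA !mulr_sumr => LB; apply: le_trans (le_trans LB _).
  by rewrite le_eqVlt; apply/orP; left; apply/eqP; apply: eq_bigr => k _; rewrite /eta /Y; ring.
by rewrite le_eqVlt; apply/orP; left; apply/eqP; apply: eq_bigr => k _; rewrite /eta; ring.
Qed.

End level_estimate.

(** * Density of the Hermite functions *)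

Section density.
Context {R : realType}.
Local Notation leb3 := (@leb3 R).
Local Notation R3 := (R * R * R)%type.
Implicit Types (f g h phi chi : R3 -> R) (p q r : {poly R}).

Definition hspan g := exists s : seq ({poly R} * {poly R} * {poly R}),
  g = fun x => \sum_(t <- s) pgauss3 (1 / 2) t.1.1 t.1.2 t.2 x.

Lemma measurable_hspan g : hspan g -> measurable_fun setT g.
Proof. by move=> [s ->]; apply: measurable_sum => t; exact: measurable_pgauss3. Qed.

Lemma hspanD f g : hspan f -> hspan g -> hspan (fun x => f x + g x).
Proof.
by move=> [s ->] [s' ->]; exists (s ++ s'); apply/funext => x; rewrite big_cat.
Qed.

Lemma hspanZ (c : R) g : hspan g -> hspan (fun x => c * g x).
Proof.
move=> [s ->]; exists [seq (c *: t.1.1, t.1.2, t.2) | t <- s].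
apply/funext => x; rewrite big_map mulr_sumr; apply: eq_bigr => t _ /=.
by rewrite /pgauss3 /pgauss hornerZ !mulrA.
Qed.

Definition sqdist f g : \bar R := (\int[leb3]_x ((f x - g x) ^+ 2)%:E)%E.

Definition app f := measurable_fun setT f /\
  forall e : R, 0 < e -> exists2 g, hspan g & (sqdist f g < e%:E)%E.

Lemma sqdist_triangle f g h : measurable_fun setT f -> measurable_fun setT g ->
  measurable_fun setT h -> (sqdist f h <= 2%:E * sqdist f g + 2%:E * sqdist g h)%E.
Proof.
move=> mf mg mh; have msq (a b : R3 -> R) : measurable_fun setT a -> measurable_fun setT b ->
    measurable_fun setT (fun x : R3 => ((a x - b x) ^+ 2)%:E).
  by move=> ma mb; apply/measurable_EFinP/measurable_funX/measurable_funB.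
rewrite /sqdist -!ge0_integralZl_EFin//; try exact: msq; try by move=> x _; rewrite lee_fin sqr_ge0.
rewrite -ge0_integralD//; try exact: measurable_funeM (msq _ _ _ _);
  try by move=> x _; rewrite -EFinM lee_fin mulr_ge0// sqr_ge0.
- apply: ge0_le_integral => //.
  + by move=> x _; rewrite lee_fin sqr_ge0.
  + exact: msq.
  + by apply: emeasurable_funD; apply: measurable_funeM; exact: msq.
  + move=> x _; rewrite -!EFinM -EFinD lee_fin -subr_ge0.
    by rewrite (_ : _ - _ = (f x - 2 * g x + h x) ^+ 2); [exact: sqr_ge0|ring].
Qed.

Lemma app_hspan g : hspan g -> app g.
Proof.
move=> hg; split=> [|e e0]; first exact: measurable_hspan.
exists g => //; rewrite /sqdist; under eq_integral do rewrite subrr expr0n.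
by rewrite integral0 lte_fin.
Qed.

Lemma app_close f : measurable_fun setT f ->
  (forall e : R, 0 < e -> exists2 g, app g & (sqdist f g < e%:E)%E) -> app f.
Proof.
move=> mf H; split=> // e e0; have e4 : 0 < e / 4 by rewrite divr_gt0.
have [g [mg Hg] fg] := H _ e4; have [h hh gh] := Hg _ e4.
exists h => //; apply: (le_lt_trans (sqdist_triangle mf mg (measurable_hspan hh))).
have -> : e%:E = (2%:E * (e / 4)%:E + 2%:E * (e / 4)%:E)%E.
  by rewrite -!EFinM -EFinD; congr EFin; field.
by apply: lteD; rewrite lte_pmul2l ?lte_fin.
Qed.

Lemma sqdistDD f g f' g' : measurable_fun setT f -> measurable_fun setT f' ->
  measurable_fun setT g -> measurable_fun setT g' ->
  (sqdist (fun x => f x + f' x)%R (fun x => g x + g' x)%R <=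
   2%:E * sqdist f g + 2%:E * sqdist f' g')%E.
Proof.
move=> mf mf' mg mg'.
have H := @sqdist_triangle (fun x => f x + f' x) (fun x => g x + f' x) (fun x => g x + g' x)
  (measurable_funD mf mf') (measurable_funD mg mf') (measurable_funD mg mg').
apply: (le_trans H); rewrite le_eqVlt; apply/orP; left; apply/eqP.
by congr (_ * _ + _ * _)%E; apply: eq_integral => x _; congr (EFin (_ ^+ 2)); ring.
Qed.

Lemma appD f g : app f -> app g -> app (fun x => f x + g x).
Proof.
move=> [mf Hf] [mg Hg]; apply: app_close; first exact: measurable_funD.
move=> e e0; have e4 : 0 < e / 4 by rewrite divr_gt0.
have [f' hf' ff'] := Hf _ e4; have [g' hg' gg'] := Hg _ e4.
exists (fun x => f' x + g' x); first exact/app_hspan/hspanD.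
have := sqdistDD mf mg (measurable_hspan hf') (measurable_hspan hg').
move/le_lt_trans; apply.
have -> : e%:E = (2%:E * (e / 4)%:E + 2%:E * (e / 4)%:E)%E.
  by rewrite -!EFinM -EFinD; congr EFin; field.
by apply: lteD; rewrite lte_pmul2l ?lte_fin.
Qed.

(** The limit inherits the bound [G], so dominated convergence applies to
    [(f - F n) ^ 2 <= 4 G ^ 2]. *)
Lemma app_dominated (F : nat -> R3 -> R) f (G : R3 -> R) : (forall n, app (F n)) ->
  measurable_fun setT G -> (\int[leb3]_x (G x ^+ 2)%:E < +oo)%E ->
  (forall n x, `|F n x| <= G x) -> (forall x, F n x @[n --> \oo] --> f x) -> app f.
Proof.
move=> aF mG iG FG Ff.
have mF n : measurable_fun setT (F n) by case: (aF n).
have mf : measurable_fun setT f by apply: (measurable_fun_cvg mF) => x _; exact: Ff.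
apply: app_close => // e e0.
pose h n (x : R3) := ((f x - F n x) ^+ 2)%:E.
have mh n : measurable_fun setT (h n).
  exact/measurable_EFinP/measurable_funX/measurable_funB.
have G0 x : 0 <= G x by apply: le_trans (FG 0%N x).
have fG x : `|f x| <= G x.
  have cn : `|F n x| @[n --> \oo] --> `|f x| by apply: cvg_norm; exact: Ff.
  rewrite -(cvg_lim (@Rhausdorff R) cn).
  apply: limr_le; first by apply/cvg_ex; exists `|f x|.
  by apply: nearW => n; exact: FG.
have iG4 : leb3.-integrable setT (fun x => (4 * G x ^+ 2)%:E).
  rewrite (_ : (fun x => _) = (fun x => 4%:E * (G x ^+ 2)%:E)%E); last first.
    by apply/funext => x; rewrite EFinM.
  apply: integrableZl => //; apply/integrableP; split.
    exact/measurable_EFinP/measurable_funX.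
  by under eq_integral do rewrite gee0_abs ?lee_fin ?sqr_ge0//.
have h0 x : h n x @[n --> \oo] --> 0%E.
  have : (f x - F n x) ^+ 2 @[n --> \oo] --> (f x - f x) ^+ 2.
    by apply: (cvg_comp _ (fun y : R => y ^+ 2)); [exact: cvgB (cvg_cst _) (Ff x)|exact: exprn_continuous].
  rewrite subrr expr0n /= => c0.
  by apply: cvg_EFin; [exact: nearW|exact: c0].
have hG x n : (`|h n x| <= (4 * G x ^+ 2)%:E)%E.
  rewrite /h gee0_abs ?lee_fin ?sqr_ge0//.
  have := FG n x; have := fG x; rewrite !ler_norml => /andP[? ?] /andP[? ?]; nra.
have cv : (\int[leb3]_x h n x @[n --> \oo] --> 0)%E.
  have [] := @dominated_convergence _ _ _ leb3 setT measurableT h (cst 0%E)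
    (fun x => (4 * G x ^+ 2)%:E) mh (measurable_cst _).
  - by apply: aeW => x _; exact: h0.
  - exact: iG4.
  - by apply: aeW => x n _; exact: hG.
  by rewrite integral0.
have [n Hn] : exists n, (\int[leb3]_x h n x < e%:E)%E.
  have e0' : (0%:E < e%:E)%E by rewrite lte_fin.
  by have [N _ HN] := cv _ (open_ereal_lt' e0'); exists N; apply: HN => /=.
by exists (F n).
Qed.

End density.

(** * Multipliers of the closed Hermite span *)

Section multipliers.
Context {R : realType}.
Local Notation leb3 := (@leb3 R).
Local Notation R3 := (R * R * R)%type.
Implicit Types (f g h phi chi : R3 -> R) (p q r : {poly R}).

(* bounded functions all of whose products with the functions
   [polynomial * exp (- |x|^2 / 2)] lie in the L^2 closure of the Hermite span *)
Definition appw phi := [/\ measurable_fun setT phi,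
  exists M : R, forall x, `|phi x| <= M &
  forall p q r, app (fun x => phi x * pgauss3 (1 / 2) p q r x)].

(** Asking for stability of the whole class [appw], and not of a single function, makes multipliers
    closed under products. *)
Definition mult chi := forall phi, appw phi -> appw (fun x => phi x * chi x).

Lemma appw1 : appw (fun=> 1).
Proof.
split => //; first by exists 1 => x; rewrite normr1.
move=> p q r; apply: app_hspan; exists [:: (p, q, r)].
by apply/funext => x; rewrite big_seq1 mul1r.
Qed.

Lemma appwD phi chi : appw phi -> appw chi -> appw (fun x => phi x + chi x).
Proof.
move=> [mf [M HM] af] [mg [M' HM'] ag]; split; first exact: measurable_funD.
  by exists (M + M') => x; rewrite (le_trans (ler_normD _ _))// lerD.
move=> p q r; rewrite (_ : (fun x => _) = (fun x =>
  phi x * pgauss3 (1 / 2) p q r x + chi x * pgauss3 (1 / 2) p q r x)); first exact: appD.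
by apply/funext => x; rewrite mulrDl.
Qed.

Lemma integral_sqr_pgauss3 a p q r : 0 < a ->
  (\int[leb3]_x (pgauss3 a p q r x ^+ 2)%:E < +oo)%E.
Proof.
move=> a0.
have E x : pgauss3 a p q r x ^+ 2 = pgauss3 (2 * a) (p ^+ 2) (q ^+ 2) (r ^+ 2) x.
  rewrite /pgauss3 /pgauss !horner_exp.
  have e2 (y : R) : expR (- (2 * a * y ^+ 2)) = expR (- (a * y ^+ 2)) ^+ 2.
    by rewrite -expRM_natl; congr expR; ring.
  by rewrite !e2; ring.
have a2 : 0 < 2 * a by rewrite mulr_gt0.
under eq_integral do rewrite E.
have /integrableP[_] := integrable_pgauss3 (p ^+ 2) (q ^+ 2) (r ^+ 2) a2.
apply: le_lt_trans; rewrite le_eqVlt; apply/orP; left; apply/eqP.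
by apply: eq_integral => x _; rewrite /= -E ger0_norm// sqr_ge0.
Qed.

Lemma appw_lim (F : nat -> R3 -> R) phi (M : R) : (forall n, appw (F n)) ->
  (forall n x, `|F n x| <= M) -> (forall x, F n x @[n --> \oo] --> phi x) ->
  appw phi.
Proof.
move=> aF FM Fphi; have mF n : measurable_fun setT (F n) by case: (aF n).
have mphi : measurable_fun setT phi by apply: (measurable_fun_cvg mF) => x _; exact: Fphi.
split=> //.
  exists M => x; have cn : `|F n x| @[n --> \oo] --> `|phi x| by apply: cvg_norm; exact: Fphi.
  rewrite -(cvg_lim (@Rhausdorff R) cn); apply: limr_le; first by apply/cvg_ex; exists `|phi x|.
  by apply: nearW => n; exact: FM.
move=> p q r.
apply: (@app_dominated _ (fun n x => F n x * pgauss3 (1 / 2) p q r x) _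
  (fun x => M * `|pgauss3 (1 / 2) p q r x|)).
- by move=> n; have [_ _] := aF n; exact.
- apply: measurable_funM => //; apply: measurableT_comp => //; exact: measurable_pgauss3.
- under eq_integral do rewrite exprMn real_normK ?num_real// EFinM.
  have h0 : 0 < 1 / 2 :> R by [].
  rewrite ge0_integralZl_EFin ?sqr_ge0//; last 2 first.
  + by move=> x _; rewrite lee_fin sqr_ge0.
  + by apply/measurable_EFinP/measurable_funX; exact: measurable_pgauss3.
  rewrite lte_mul_pinfty ?lee_fin ?sqr_ge0//; exact: integral_sqr_pgauss3.
- by move=> n x; rewrite normrM ler_wpM2r.
- by move=> x; apply: cvgM; [exact: Fphi|exact: cvg_cst].
Qed.

Lemma mult_cst (c : R) : mult (fun=> c).
Proof.
move=> phi [mphi [M HM] aphi]; split.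
- exact: measurable_funM.
- by exists (M * `|c|) => x; rewrite normrM ler_wpM2r.
move=> p q r; rewrite (_ : (fun x => _) = (fun x => phi x * pgauss3 (1 / 2) (c *: p) q r x)); first exact: aphi.
by apply/funext => x; rewrite /pgauss3 /pgauss hornerZ; ring.
Qed.

Lemma multM f g : mult f -> mult g -> mult (fun x => f x * g x).
Proof.
move=> mf mg phi aphi; rewrite (_ : (fun x => _) = (fun x => (phi x * f x) * g x)).
  exact/mg/mf.
by apply/funext => x; rewrite mulrA.
Qed.

Lemma multD f g : mult f -> mult g -> mult (fun x => f x + g x).
Proof.
move=> mf mg phi aphi; rewrite (_ : (fun x => _) = (fun x => phi x * f x + phi x * g x)).
  by apply: appwD; [exact: mf|exact: mg].
by apply/funext => x; rewrite mulrDr.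
Qed.

Lemma multX f n : mult f -> mult (fun x => f x ^+ n).
Proof.
move=> mf; elim: n => [|n IH]; first exact: (mult_cst 1).
by under eq_fun do rewrite exprS; exact: multM.
Qed.

Lemma mult_onem f : mult f -> mult (fun x => 1 - f x).
Proof.
move=> mf; rewrite (_ : (fun x => _) = (fun x => 1 + (-1) * f x)).
  by apply: multD; [exact: mult_cst|apply: multM => //; exact: mult_cst].
by apply/funext => x; rewrite mulN1r.
Qed.

Lemma mult_lim (F : nat -> R3 -> R) chi (M : R) : (forall n, mult (F n)) ->
  (forall n x, `|F n x| <= M) -> (forall x, F n x @[n --> \oo] --> chi x) ->
  mult chi.
Proof.
move=> aF FM Fchi phi aphi; have [_ [M' HM'] _] := aphi.
apply: (@appw_lim (fun n x => phi x * F n x) _ (M' * M)).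
- by move=> n; exact: aF.
- by move=> n x; rewrite normrM ler_pM.
- by move=> x; apply: cvgM; [exact: cvg_cst|exact: Fchi].
Qed.

(** Isolates what is used of the three coordinate functions: they are dominated by [|x|], and a
    polynomial in them is absorbed by the polynomial factors of [pgauss3], whatever the width [a] of
    the Gaussian. *)
Definition coordinate (xi : R3 -> R) := [/\ measurable_fun setT xi,
  forall x, xi x ^+ 2 <= sqlen x &
  forall (s : {poly R}) p q r, exists p' q' r', forall a x,
    s.[xi x] * pgauss3 a p q r x = pgauss3 a p' q' r' x].

Lemma coordinate1 : coordinate (fun x => x.1.1).
Proof.
split; first exact: (measurableT_comp measurable_fst measurable_fst).
  by move=> x; rewrite /sqlen -addrA lerDl addr_ge0// sqr_ge0.
move=> s p q r; exists (s * p), q, r => a x.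
by rewrite /pgauss3 /pgauss hornerM; ring.
Qed.

Lemma coordinate2 : coordinate (fun x => x.1.2).
Proof.
split; first exact: (measurableT_comp measurable_snd measurable_fst).
  by move=> x; rewrite /sqlen addrAC lerDr addr_ge0// sqr_ge0.
move=> s p q r; exists p, (s * q), r => a x.
by rewrite /pgauss3 /pgauss hornerM; ring.
Qed.

Lemma coordinate3 : coordinate (fun x => x.2).
Proof.
split; first exact: measurable_snd.
  by move=> x; rewrite /sqlen lerDr addr_ge0// sqr_ge0.
move=> s p q r; exists p, q, (s * r) => a x.
by rewrite /pgauss3 /pgauss hornerM; ring.
Qed.

End multipliers.

(** * Exponential partial sums and polynomials approximating a threshold *)

Section real_sequences.
Context {R : realType}.

Lemma series_exp_coeff_le (y : R) n : `|series (exp_coeff y) n| <= expR `|y|.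
Proof.
apply: (@le_trans _ _ (series (exp_coeff `|y|) n)).
  rewrite !seriesEnat /= (le_trans (ler_norm_sum _ _ _))//.
  by apply: ler_sum => k _; rewrite /exp_coeff /= normrM normrX normfV normr_nat.
rewrite /expR; apply: nondecreasing_cvgn_le; last exact: is_cvg_series_exp_coeff.
apply/nondecreasing_seqP => k; rewrite seriesSr lerDl.
exact: exp_coeff_ge0.
Qed.

Lemma cvg_series_exp_coeff (y : R) : series (exp_coeff y) n @[n --> \oo] --> expR y.
Proof. exact: is_cvg_series_exp_coeff. Qed.

(** With [z = exp (- c)], apply [exp y >= y ^ 2 / 2] at [y = (n + 1) c]. *)
Lemma natr_mul_geometric_le (z : R) : 0 <= z < 1 ->
  exists C : R, forall n, n.+1%:R * z ^+ n.+1 <= C * n.+1%:R^-1.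
Proof.
case/andP; rewrite le_eqVlt => /predU1P[<- _|z0 z1].
  by exists 1 => n; rewrite expr0n mulr0 mul1r invr_ge0.
pose c := - ln z; have c0 : 0 < c by rewrite oppr_gt0 ln_lt0// z0.
exists (2 / c ^+ 2) => n.
have zE : z ^+ n.+1 = expR (- (n.+1%:R * c)).
  by rewrite /c mulrN opprK expRM_natl lnK.
have := @expR_ge1Dxn R (n.+1%:R * c) 1 (mulr_ge0 (ler0n _ _) (ltW c0)).
move=> H; have {}H : (n.+1%:R * c) ^+ 2 / 2 <= expR (n.+1%:R * c).
  by rewrite (le_trans _ H)// lerDr.
have p0 : 0 < (n.+1%:R * c) ^+ 2 / 2 by rewrite divr_gt0// exprn_gt0// mulr_gt0.
have : z ^+ n.+1 <= ((n.+1%:R * c) ^+ 2 / 2)^-1.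
  by rewrite zE expRN lef_pV2 ?posrE ?expR_gt0.
move/(ler_wpM2l (ler0n R n.+1)) => /le_trans; apply.
rewrite le_eqVlt; apply/orP; left; apply/eqP.
have k0 : n.+1%:R != 0 :> R by rewrite pnatr_eq0.
have c0' : c != 0 by rewrite gt_eqF.
by clearbody c; move: (n.+1%:R) k0 => k k0; field; rewrite k0.
Qed.

(** Polynomials of Stone-Weierstrass type, tending on [[0, 1]] to the indicator of [[1/2, 1]]. Being
    polynomials in [y], they send multipliers to multipliers. *)
Definition step (n : nat) (y : R) : R := 1 - (1 - y ^+ n.+1) ^+ (n.+1 * 2 ^ n.+1).

Lemma bernoulli_ge (u : R) k : 0 <= u <= 1 -> 1 - k%:R * u <= (1 - u) ^+ k.
Proof.
case/andP=> u0 u1; elim: k => [|k IH]; first by rewrite mul0r subr0.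
rewrite exprS (le_trans _ (ler_wpM2l _ IH)) ?subr_ge0//.
rewrite -natr1; have : 0 <= k%:R :> R by []; nra.
Qed.

Lemma bernoulli_le (u : R) k : 0 <= u <= 1 -> (1 - u) ^+ k * (1 + k%:R * u) <= 1.
Proof.
case/andP=> u0 u1; elim: k => [|k IH]; first by rewrite mul0r addr0 mulr1.
apply: le_trans IH; rewrite exprSr -mulrA ler_wpM2l ?exprn_ge0 ?subr_ge0//.
rewrite -natr1; have : 0 <= k%:R :> R by []; nra.
Qed.

Lemma step_itv n y : 0 <= y <= 1 -> 0 <= step n y <= 1.
Proof.
case/andP=> y0 y1; have yn : 0 <= 1 - y ^+ n.+1 <= 1.
  by rewrite subr_ge0 exprn_ile1//= gerBl exprn_ge0.
case/andP: yn => h0 h1.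
by rewrite /step subr_ge0 exprn_ile1//= gerBl exprn_ge0.
Qed.

(* below [1/2] the factor [(n+1) (2 y)^(n+1)] vanishes in the limit, above
   [1/2] (and at [1/2], because of the factor [n+1]) it tends to infinity *)
Lemma cvg_step (y : R) : 0 <= y <= 1 -> step n y @[n --> \oo] --> ((1 / 2 <= y)%R%:R : R).
Proof.
move=> y01; have /andP[y0 y1] := y01.
have u01 n : 0 <= y ^+ n.+1 <= 1 by rewrite exprn_ge0//= exprn_ile1.
have cv0 (C : R) : C * n.+1%:R^-1 @[n --> \oo] --> 0.
  by rewrite -[X in _ --> X](mulr0 C); apply: cvgMr; exact: cvg_harmonic.
case: leP => y2 /=.
  have H : 1 - 1 * n.+1%:R^-1 @[n --> \oo] --> (1 : R).
    by rewrite -[X in _ --> X]subr0; apply: cvgB; [exact: cvg_cst|exact: cv0].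
  apply: (@squeeze_cvgr _ _ _ _ (fun n => 1 - 1 * n.+1%:R^-1) (fun=> 1)) => //; last exact: cvg_cst.
  apply: nearW => n; have /andP[_ ->] := step_itv n y01; rewrite andbT.
  rewrite /step lerD2l lerN2 mul1r.
  have h : n.+1%:R <= 1 + (n.+1 * 2 ^ n.+1)%:R * y ^+ n.+1.
    rewrite natrM natrX -mulrA -exprMn.
    have : 1 <= (2 * y) ^+ n.+1 by apply: exprn_ege1; lra.
    have : 0 <= n.+1%:R :> R by [].
    nra.
  have h0 : 0 < n.+1%:R :> R by [].
  rewrite -[leRHS]mul1r ler_pdivlMr//.
  apply: le_trans (bernoulli_le (n.+1 * 2 ^ n.+1) (u01 n)).
  by rewrite ler_wpM2l// exprn_ge0// subr_ge0; case/andP: (u01 n).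
have [|C HC] := @natr_mul_geometric_le (2 * y).
  by apply/andP; split; lra.
apply: (@squeeze_cvgr _ _ _ _ (fun=> 0) (fun n => C * n.+1%:R^-1)); [|exact: cvg_cst|exact: cv0].
apply: nearW => n; have /andP[-> _] := step_itv n y01; rewrite andTb.
apply: le_trans (HC n).
have := bernoulli_ge (n.+1 * 2 ^ n.+1) (u01 n).
by rewrite /step natrM natrX -mulrA -exprMn lerBlDr -lerBlDl.
Qed.

End real_sequences.

(** * From Gaussian multipliers to indicators of intervals *)

Section gaussian_multipliers.
Context {R : realType}.
Local Notation leb3 := (@leb3 R).
Local Notation R3 := (R * R * R)%type.
Implicit Types (f g h phi chi xi : R3 -> R) (p q r : {poly R}).

Lemma measurable_gauss_coordinate xi (s a : R) : measurable_fun setT xi ->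
  measurable_fun setT (fun x : R3 => expR (- (s * (xi x - a) ^+ 2))).
Proof.
move=> mxi; apply: measurableT_comp => //; apply: measurableT_comp => //.
by apply: measurable_funM => //; apply: measurable_funX; exact: measurable_funB.
Qed.

Lemma pgauss3_gauss (a b : R) p q r (x : R3) :
  pgauss3 (a + b) p q r x = pgauss3 a p q r x * expR (- (b * sqlen x)).
Proof.
have -> : expR (- (b * sqlen x)) =
    expR (- (b * x.1.1 ^+ 2)) * expR (- (b * x.1.2 ^+ 2)) * expR (- (b * x.2 ^+ 2)).
  by rewrite -!expRD; congr expR; rewrite /sqlen; ring.
have E (y : R) : expR (- ((a + b) * y ^+ 2)) = expR (- (a * y ^+ 2)) * expR (- (b * y ^+ 2)).
  by rewrite -expRD; congr expR; ring.
by rewrite /pgauss3 /pgauss !E; ring.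
Qed.

(** The partial sums of the exponential series are polynomials in [xi], hence absorbed. They are
    dominated by [exp (s (xi - a) ^ 2)], which for [s <= 1/8] is at most
    [exp (a ^ 2 / 4 + |x| ^ 2 / 4)]: half of the Gaussian pays for this, and the other half is still
    square integrable. *)
Lemma mult_gauss_small xi (s a : R) : coordinate xi -> 0 <= s <= 1 / 8 ->
  mult (fun x => expR (- (s * (xi x - a) ^+ 2))).
Proof.
move=> [mxi xile xiP] /andP[s0 s8] phi [mphi [M HM] aphi]; split.
- exact: measurable_funM (measurable_gauss_coordinate _ _ _).
- exists M => x; rewrite normrM -[leRHS]mulr1 ler_pM// ger0_norm ?expR_ge0//.
  by rewrite -expR0 ler_expR oppr_le0 mulr_ge0// sqr_ge0.
move=> p q r; pose Q : {poly R} := - (s *: ('X - a%:P) ^+ 2).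
have QE y : Q.[y] = - (s * (y - a) ^+ 2).
  by rewrite /Q hornerN hornerZ horner_exp hornerXsubC.
pose F n x := phi x * series (exp_coeff Q.[xi x]) n * pgauss3 (1 / 2) p q r x.
apply: (@app_dominated _ F _ (fun x => M * (expR (a ^+ 2 / 4) * `|pgauss3 (1 / 4) p q r x|))).
- move=> n; pose S : {poly R} := \sum_(0 <= k < n) k`!%:R^-1 *: Q ^+ k.
  have [p' [q' [r' E]]] := xiP S p q r.
  rewrite /F (_ : (fun x => _) = (fun x => phi x * pgauss3 (1 / 2) p' q' r' x)); first exact: aphi.
  apply/funext => x; rewrite -E [RHS]mulrA; congr (_ * _ * _).
  rewrite /S horner_sum seriesEnat /=; apply: eq_bigr => k _.
  by rewrite hornerZ horner_exp /exp_coeff /= mulrC.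
- apply: measurable_funM => //; apply: measurable_funM => //.
  apply: measurableT_comp => //; exact: measurable_pgauss3.
- under eq_integral do rewrite mulrA exprMn real_normK ?num_real// EFinM.
  have h0 : 0 < 1 / 4 :> R by [].
  rewrite ge0_integralZl_EFin ?sqr_ge0//; last 2 first.
  + by move=> x _; rewrite lee_fin sqr_ge0.
  + by apply/measurable_EFinP/measurable_funX; exact: measurable_pgauss3.
  rewrite lte_mul_pinfty ?lee_fin ?sqr_ge0//; exact: integral_sqr_pgauss3.
- move=> n x; rewrite /F (normrM (phi x * _)) (normrM (phi x)) -mulrA ler_pM ?mulr_ge0//.
  have -> : 1 / 2 = 1 / 4 + 1 / 4 :> R by field.
  rewrite pgauss3_gauss (normrM (pgauss3 _ _ _ _ _)) (ger0_norm (expR_ge0 _)) mulrA mulrAC ler_wpM2r//.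
  apply: (le_trans (ler_wpM2r (expR_ge0 _) (series_exp_coeff_le _ _))).
  rewrite -expRD ler_expR QE normrN ger0_norm; last by apply: mulr_ge0 => //; exact: sqr_ge0.
  have := xile x; have : 0 <= (xi x + a) ^+ 2 by exact: sqr_ge0.
  have : s * (xi x - a) ^+ 2 <= 1 / 8 * (xi x - a) ^+ 2 by rewrite ler_wpM2r// sqr_ge0.
  lra.
- move=> x; apply: cvgM; last exact: cvg_cst.
  apply: cvgM; first exact: cvg_cst.
  by rewrite -QE; exact: cvg_series_exp_coeff.
Qed.

(** A power of a Gaussian whose parameter [s / m] is small enough. *)
Lemma mult_gauss xi (s a : R) : coordinate xi -> 0 <= s ->
  mult (fun x => expR (- (s * (xi x - a) ^+ 2))).
Proof.
move=> cxi s0; pose m := (Num.truncn (8 * s)).+1.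
have ms : s / m%:R <= 1 / 8.
  have := Num.Theory.truncnS_gt (8 * s); rewrite -/m => h; have m0 : 0 < m%:R :> R by rewrite ltr0n.
  by rewrite ler_pdivrMr//; lra.
rewrite (_ : (fun x => _) = (fun x => expR (- (s / m%:R * (xi x - a) ^+ 2)) ^+ m)).
  by apply: multX; apply: mult_gauss_small => //; rewrite ms divr_ge0.
apply/funext => x; rewrite -expRM_natl; congr expR.
have m0 : m%:R != 0 :> R by rewrite pnatr_eq0.
by field.
Qed.

Lemma mult_superlevel psi : mult psi -> (forall x, 0 <= psi x <= 1) ->
  mult (fun x => (1 / 2 <= psi x)%R%:R : R).
Proof.
move=> mpsi psi01; apply: (@mult_lim _ (fun n x => step n (psi x)) _ 1).
- move=> n; rewrite /step; apply: mult_onem; apply: multX; apply: mult_onem; exact: multX.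
- move=> n x; have /andP[h0 h1] := step_itv n (psi01 x).
  by rewrite ger0_norm.
- by move=> x; exact: cvg_step.
Qed.

Lemma mult_interval xi (a r : R) : coordinate xi -> 0 < r ->
  mult (fun x => (`|xi x - a| <= r)%R%:R : R).
Proof.
(* With this [s] the Gaussian takes the value [1/2] exactly at distance [r] from [a]. *)
move=> cxi r0; pose s : R := ln 2 / r ^+ 2.
have s0 : 0 < s by rewrite divr_gt0 ?exprn_gt0// ln_gt0// ltr1n.
rewrite (_ : (fun x => _) = (fun x => (1 / 2 <= expR (- (s * (xi x - a) ^+ 2)))%R%:R : R)).
  apply: mult_superlevel; first exact: mult_gauss (ltW _).
  move=> x; rewrite expR_ge0/= -expR0 ler_expR oppr_le0.
  by apply: mulr_ge0; [exact: ltW|exact: sqr_ge0].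
apply/funext => x; congr (nat_of_bool _)%:R.
have -> : 1 / 2 = expR (- ln 2) :> R by rewrite expRN lnK ?posrE// mul1r.
rewrite ler_expR lerN2 (_ : s * _ = ln 2 * ((xi x - a) ^+ 2 / r ^+ 2)); last first.
  by rewrite /s mulrAC mulrA.
rewrite -[X in _ = (_ <= X)]mulr1 ler_pM2l ?ln_gt0 ?ltr1n//.
rewrite ler_pdivrMr ?exprn_gt0// mul1r -[(xi x - a) ^+ 2]real_normK ?num_real//.
by rewrite ler_sqr ?nnegrE// ltW.
Qed.

Definition mset (E : set R3) := measurable E /\ mult (fun x => \1_E x : R).

Lemma msetC E : mset E -> mset (~` E).
Proof.
move=> [mE multE]; split; first exact: measurableC.
rewrite (_ : (fun x => _) = (fun x => 1 - \1_E x : R)); first exact: mult_onem.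
by apply/funext => x; rewrite !indicE in_setC; case: (x \in E); rewrite ?subrr ?subr0.
Qed.

Lemma msetU A B : mset A -> mset B -> mset (A `|` B).
Proof.
move=> [mA nA] [mB nB]; split; first exact: measurableU.
rewrite (_ : (fun x => _) = (fun x => 1 - (1 - \1_A x) * (1 - \1_B x) : R)).
  by apply: mult_onem; apply: multM; exact: mult_onem.
apply/funext => x; rewrite !indicE in_setU.
by case: (x \in A); case: (x \in B) => /=; ring.
Qed.

Lemma mset0 : mset set0.
Proof.
split=> //; rewrite (_ : (fun x => _) = (fun=> 0)); first exact: mult_cst.
by apply/funext => x; rewrite indic0.
Qed.

(** At each point the indicators of the finite unions are eventually constant, so [mult_lim] applies
    with the bound 1. *)
Lemma mset_bigcup (A : (set R3)^nat) : (forall n, mset (A n)) -> mset (\bigcup_n A n).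
Proof.
move=> mA; have mB n : mset (\big[setU/set0]_(i < n) A i).
  by elim: n => [|n IH]; [rewrite big_ord0; exact: mset0|rewrite big_ord_recr; exact: msetU].
split; first by apply: bigcupT_measurable => n; case: (mA n).
apply: (@mult_lim _ (fun n x => \1_(\big[setU/set0]_(i < n) A i) x) _ 1).
- by move=> n; case: (mB n).
- by move=> n x; rewrite indicE; case: (x \in _); rewrite ?normr0 ?normr1.
move=> x; have [[n _ Anx]|nA] := pselect ((\bigcup_n A n) x); last first.
  rewrite [X in _ --> X](_ : _ = 0); last first.
    by rewrite indicE memNset.
  apply: cvg_near_cst; apply: nearW => n; rewrite indicE memNset//.
  by move=> H; apply: nA; move: H; rewrite -bigcup_mkord => -[k _ Akx]; exists k.
rewrite [X in _ --> X](_ : _ = 1); last by rewrite indicE mem_set//; exists n.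
apply: cvg_near_cst; exists n.+1 => // k /= nk.
rewrite indicE mem_set//.
by rewrite -bigcup_mkord; exists n.
Qed.

End gaussian_multipliers.

Import HBNNSimple.

(** * From intervals to measurable sets and square integrable functions *)

Section measurable_multipliers.
Context {R : realType}.
Local Notation leb3 := (@leb3 R).
Local Notation R3 := (R * R * R)%type.
Implicit Types (f g h phi chi xi : R3 -> R) (p q r : {poly R}).

Lemma msetI (A B : set R3) : mset A -> mset B -> mset (A `&` B).
Proof.
by move=> mA mB; rewrite -[A `&` B]setCK setCI; apply/msetC/msetU; exact: msetC.
Qed.

Lemma mset_sigma_preimage (T : Type) (G : set (set T)) (f : R3 -> T) :
  (forall B, G B -> mset (f @^-1` B)) -> forall B, <<s G >> B -> mset (f @^-1` B).
Proof.
move=> fG; apply: (@smallest_sub _ _ _ [set B | mset (f @^-1` B)]) => //.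
split => /=.
- by rewrite preimage_set0; exact: mset0.
- by move=> A mA; rewrite setTD preimage_setC; exact: msetC.
- by move=> A mA; rewrite preimage_bigcup; exact: mset_bigcup.
Qed.

Lemma mset_ray xi (c : R) : coordinate xi -> mset (xi @^-1` `[c, +oo[).
Proof.
move=> cxi; have [mxi _ _] := cxi.
(* Closed intervals with left end [c] and growing length exhaust the ray. *)
rewrite (_ : xi @^-1` _ = \bigcup_n [set x | `|xi x - (c + n.+1%:R)| <= n.+1%:R]).
  apply: mset_bigcup => n; split; last first.
    have := @mult_interval _ xi (c + n.+1%:R) n.+1%:R cxi (ltr0Sn _ _).
    by congr mult; apply/funext => x; rewrite indicE; congr (nat_of_bool _)%:R; apply/idP/idP; rewrite inE.
  have mabs : measurable_fun setT (fun x : R3 => `|xi x - (c + n.+1%:R)|).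
    by apply: measurableT_comp => //; exact: measurable_funB.
  rewrite -[X in measurable X]setTI.
  have -> : [set x | `|xi x - (c + n.+1%:R)| <= n.+1%:R] =
      (fun x : R3 => `|xi x - (c + n.+1%:R)|) @^-1` `]-oo, n.+1%:R].
    by apply/seteqP; split => x /=; rewrite in_itv.
  by apply: mabs => //; exact: measurable_itv.
apply/seteqP; split => x /=.
  rewrite in_itv /= andbT => cx; exists (Num.truncn (xi x - c)) => //=.
  have := truncnS_gt (xi x - c); have : 0 <= (Num.truncn (xi x - c)).+1%:R :> R by [].
  by rewrite ler_norml; lra.
by case=> n _ /=; rewrite in_itv /= andbT ler_norml; lra.
Qed.

Lemma mset_coordinate xi (B : set R) : coordinate xi -> measurable B ->
  mset (xi @^-1` B).
Proof.
move=> cxi mB; have {}mB : (@ocitv R).-sigma.-measurable B by [].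
rewrite RGenCInfty.measurableE in mB.
by apply: (mset_sigma_preimage _ mB) => _ [c ->]; exact: mset_ray.
Qed.

(** The product sigma-algebra is generated by rectangles; used twice, this reduces the claim to
    preimages of Borel sets under the coordinates. *)
Lemma mset_measurable (E : set R3) : measurable E -> mset E.
Proof.
rewrite measurable_prod_measurableType => mE.
apply: (@mset_sigma_preimage _ _ id _ _ mE) => _ [A mA] [B mB] <-.
rewrite (_ : _ @^-1` _ = (fst @^-1` A) `&` (snd @^-1` B)); last first.
  by apply/seteqP; split => x.
apply: msetI; last by apply: mset_coordinate => //; exact: coordinate3.
rewrite measurable_prod_measurableType in mA.
apply: (@mset_sigma_preimage _ _ fst _ _ mA) => _ [C mC] [D mD] <-.
rewrite (_ : _ @^-1` _ = ((fun x : R3 => x.1.1) @^-1` C) `&` ((fun x : R3 => x.1.2) @^-1` D)); last first.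
  by apply/seteqP; split => x.
apply: msetI; apply: mset_coordinate => //; [exact: coordinate1|exact: coordinate2].
Qed.

Lemma mult_sum (I : Type) (s : seq I) (f : I -> R3 -> R) :
  (forall i, mult (f i)) -> mult (fun x => \sum_(i <- s) f i x).
Proof.
move=> mf; elim: s => [|i s IH].
  by under eq_fun do rewrite big_nil; exact: mult_cst.
by under eq_fun do rewrite big_cons; exact: multD.
Qed.

Lemma mult_sfun (h : {nnsfun R3 >-> R}) : mult (fun x : R3 => h x).
Proof.
have [s E] : exists s : seq R, forall x : R3, h x = \sum_(y <- s) y * \1_(h @^-1` [set y]) x.
  by exists (finmap.enum_fset (fset_set (range h))) => x; rewrite fimfunE fsbig_finite.
under eq_fun do rewrite E.
apply: mult_sum => i; apply: multM; first exact: mult_cst.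
by apply: (mset_measurable _).2; exact: measurable_sfunP.
Qed.

(* [u] is [w] times the limit of the simple approximations of [u / w], where
   [w] is the Gaussian *)
Lemma app_ge0_of_sqr_integrable (u : R3 -> R) : measurable_fun setT u ->
  (forall x, 0 <= u x) -> (\int[leb3]_x (u x ^+ 2)%:E < +oo)%E -> app u.
Proof.
move=> mu u0 iu; pose w (x : R3) := pgauss3 (1 / 2) 1 1 1 x.
have w0 x : 0 < w x.
  by rewrite /w /pgauss3 /pgauss -polyC1 !hornerC !mul1r !mulr_gt0// expR_gt0.
have mw : measurable_fun setT w by exact: measurable_pgauss3.
pose v (x : R3) := u x / w x.
have mv : measurable_fun setT (EFin \o v).
  apply/measurable_EFinP; apply: measurable_funM => //.
  by apply: (measurableT_comp measurable_inv).
have v0 x : 0 <= v x by rewrite divr_ge0// ltW.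
pose h := nnsfun_approx measurableT mv.
have hv (x : R3) : h n x @[n --> \oo] --> v x.
  have := @cvg_nnsfun_approx _ _ _ _ measurableT _ mv (fun x _ => v0 x) x I.
  by move/fine_cvgP => [_]; exact.
have hle n (x : R3) : h n x <= v x.
  rewrite -(cvg_lim (@Rhausdorff R) (hv x)).
  apply: nondecreasing_cvgn_le; last by apply/cvg_ex; exists (v x).
  by move=> m k mk; exact/lefP/nd_nnsfun_approx.
apply: (@app_dominated _ (fun n (x : R3) => h n x * w x) _ u) => //.
- move=> n; have [_ _ H] := mult_sfun (h n) (@appw1 R).
  by have := H 1 1 1; congr app; apply/funext => x; rewrite mul1r.
- move=> n x; rewrite ger0_norm; last by apply: mulr_ge0 => //; exact: ltW.
  by rewrite -ler_pdivlMr.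
- move=> x; have -> : u x = v x * w x by rewrite /v divfK// gt_eqF.
  by apply: cvgM; [exact: hv|exact: cvg_cst].
Qed.

(** Split [u] into its positive and negative parts, both dominated by [|u|]. *)
Lemma app_of_sqr_integrable (u : R3 -> R) : measurable_fun setT u ->
  (\int[leb3]_x (u x ^+ 2)%:E < +oo)%E -> app u.
Proof.
move=> mu iu; have le (v : R3 -> R) : measurable_fun setT v -> (forall x, `|v x| <= `|u x|) ->
    (\int[leb3]_x (v x ^+ 2)%:E < +oo)%E.
  move=> mv vu; apply: le_lt_trans iu; apply: ge0_le_integral => //.
  - by move=> x _; rewrite lee_fin sqr_ge0.
  - exact/measurable_EFinP/measurable_funX.
  - exact/measurable_EFinP/measurable_funX.
  - move=> x _; rewrite lee_fin -[v x ^+ 2]real_normK ?num_real// -[u x ^+ 2]real_normK ?num_real//.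
    by rewrite ler_sqr ?nnegrE//; exact: vu.
have mp : measurable_fun setT (fun x : R3 => (`|u x| + u x) / 2).
  by apply: measurable_funM => //; apply: measurable_funD => //; exact: measurableT_comp.
have mn : measurable_fun setT (fun x : R3 => (`|u x| - u x) / 2).
  by apply: measurable_funM => //; apply: measurable_funB => //; exact: measurableT_comp.
have bp (x : R3) : 0 <= (`|u x| + u x) / 2 <= `|u x|.
  by have := ler_norm (u x); have := ler_norm (- u x); rewrite normrN; lra.
have bn (x : R3) : 0 <= (`|u x| - u x) / 2 <= `|u x|.
  by have := ler_norm (u x); have := ler_norm (- u x); rewrite normrN; lra.
have ap : app (fun x : R3 => (`|u x| + u x) / 2).
  apply: app_ge0_of_sqr_integrable => //; first by move=> x; case/andP: (bp x).
  by apply: le => // x; have /andP[h0 h1] := bp x; rewrite ger0_norm.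
have an : app (fun x : R3 => (`|u x| - u x) / 2).
  apply: app_ge0_of_sqr_integrable => //; first by move=> x; case/andP: (bn x).
  by apply: le => // x; have /andP[h0 h1] := bn x; rewrite ger0_norm.
rewrite (_ : u = fun x => (`|u x| + u x) / 2 + (-1) * ((`|u x| - u x) / 2)).
  apply: appD => //; split=> [|e e0]; first exact: measurable_funM.
  have [g hg ug] := an.2 e e0; exists (fun x => -1 * g x); first exact: hspanZ.
  rewrite /sqdist; under eq_integral do rewrite !mulN1r -opprD sqrrN.
  exact: ug.
by apply/funext => x; field.
Qed.

End measurable_multipliers.

(** * Bessel identity and completeness *)

Section square_integrable.
Context d (T : measurableType d) (R : realType) (m : {measure set T -> \bar R}).
Implicit Types (f g h : T -> R).

Definition sqint f := measurable_fun setT f /\ (\int[m]_x (f x ^+ 2)%:E < +oo)%E.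

Definition ip f g : R := \int[m]_x (f x * g x).

Lemma sqint_integrableM f g : sqint f -> sqint g ->
  m.-integrable setT (EFin \o (fun x => f x * g x)).
Proof.
move=> [mf If] [mg Ig].
have isq h : measurable_fun setT h -> (\int[m]_x (h x ^+ 2)%:E < +oo)%E ->
    m.-integrable setT (fun x => (h x ^+ 2)%:E).
  move=> mh Ih; apply/integrableP; split; first exact/measurable_EFinP/measurable_funX.
  by under eq_integral do rewrite gee0_abs ?lee_fin ?sqr_ge0//.
have H := integrableD measurableT (isq f mf If) (isq g mg Ig).
apply: (le_integrable measurableT _ _ H).
  exact/measurable_EFinP/measurable_funM.
move=> x _ /=; rewrite lee_fin normrM.
rewrite [leRHS]ger0_norm ?addr_ge0 ?sqr_ge0//.
rewrite -[f x ^+ 2]real_normK ?num_real// -[g x ^+ 2]real_normK ?num_real//.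
have := sqr_ge0 (`|f x| - `|g x|); have := normr_ge0 (f x); have := normr_ge0 (g x); nra.
Qed.

Lemma sqintD f g : sqint f -> sqint g -> sqint (fun x => f x + g x).
Proof.
move=> sf sg; have [mf If] := sf; have [mg Ig] := sg; split; first exact: measurable_funD.
have H := integrableD measurableT (integrableD measurableT (sqint_integrableM sf sf)
  (integrableZl measurableT 2 (sqint_integrableM sf sg))) (sqint_integrableM sg sg).
have /integrableP[_] := H.
apply: le_lt_trans; rewrite le_eqVlt; apply/orP; left; apply/eqP.
apply: eq_integral => x _ /=.
rewrite ger0_norm; first by congr EFin; ring.
by rewrite (_ : _ + _ = (f x + g x) ^+ 2); [exact: sqr_ge0|ring].
Qed.

Lemma sqintZ (c : R) f : sqint f -> sqint (fun x => c * f x).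
Proof.
move=> [mf If]; split; first exact: measurable_funM.
under eq_integral do rewrite exprMn EFinM.
rewrite ge0_integralZl_EFin ?sqr_ge0//; last 2 first.
- by move=> x _; rewrite lee_fin sqr_ge0.
- exact/measurable_EFinP/measurable_funX.
by rewrite lte_mul_pinfty ?lee_fin ?sqr_ge0.
Qed.

Lemma sqint0 : sqint (fun=> 0).
Proof.
by split=> //; under eq_integral do rewrite expr0n; rewrite integral0.
Qed.

Lemma sqint_sum (I : Type) (s : seq I) (c : I -> R) (e : I -> T -> R) :
  (forall i, sqint (e i)) -> sqint (fun x => \sum_(i <- s) c i * e i x).
Proof.
move=> se; elim: s => [|i s IH].
  by under eq_fun do rewrite big_nil; exact: sqint0.
by under eq_fun do rewrite big_cons; apply: sqintD => //; exact: sqintZ.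
Qed.

Lemma ipC f g : ip f g = ip g f.
Proof. by rewrite /ip; under eq_Rintegral do rewrite mulrC. Qed.

Lemma ipDl f g h : sqint f -> sqint g -> sqint h ->
  ip (fun x => f x + g x) h = ip f h + ip g h.
Proof.
move=> sf sg sh; rewrite /ip; under eq_Rintegral do rewrite mulrDl.
by rewrite RintegralD//; exact: sqint_integrableM.
Qed.

Lemma ipZl (c : R) f h : sqint f -> sqint h -> ip (fun x => c * f x) h = c * ip f h.
Proof.
move=> sf sh; rewrite /ip; under eq_Rintegral do rewrite -mulrA.
by rewrite RintegralZl//; exact: sqint_integrableM.
Qed.

Lemma ip_suml (I : Type) (s : seq I) (c : I -> R) (e : I -> T -> R) h :
  (forall i, sqint (e i)) -> sqint h ->
  ip (fun x => \sum_(i <- s) c i * e i x) h = \sum_(i <- s) c i * ip (e i) h.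
Proof.
move=> se sh; elim: s => [|i s IH].
  rewrite big_nil /ip; under eq_Rintegral do rewrite big_nil mul0r.
  by rewrite /Rintegral integral0.
rewrite big_cons -IH -ipZl// -ipDl//; last 2 first.
- exact: sqintZ.
- exact: sqint_sum.
by rewrite /ip; under eq_Rintegral do rewrite big_cons.
Qed.

Lemma integral_sqrE f : sqint f -> (\int[m]_x (f x ^+ 2)%:E = (ip f f)%:E)%E.
Proof.
move=> sf; rewrite /ip /Rintegral fineK.
  by apply: eq_integral => x _; rewrite expr2.
exact: integrable_fin_num (sqint_integrableM sf sf).
Qed.

Lemma ip_ge0 f : 0 <= ip f f.
Proof. by apply: Rintegral_ge0 => x _; rewrite -expr2 sqr_ge0. Qed.

Section orthogonal.
Context (I : finType) (e : I -> T -> R) (nu : I -> R).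
Hypothesis se : forall i, sqint (e i).
Hypothesis nu0 : forall i, 0 < nu i.
Hypothesis oe : forall i j, ip (e i) (e j) = if i == j then nu j else 0.

Definition proj f x := \sum_i (ip f (e i) / nu i) * e i x.

Definition bessel f := \sum_i ip f (e i) ^+ 2 / nu i.

(** Complete the square in each coefficient. Taking the Fourier coefficients for [c] gives Bessel's
    identity, and dropping the last sum gives best approximation. *)
Lemma ip_sub_sum f (c : I -> R) : sqint f ->
  ip (fun x => f x - \sum_i c i * e i x) (fun x => f x - \sum_i c i * e i x) =
  ip f f - bessel f + \sum_i (c i - ip f (e i) / nu i) ^+ 2 * nu i.
Proof.
move=> sf; pose g x := \sum_i (- c i) * e i x.
have sg : sqint g by exact: sqint_sum.
have E : (fun x => f x - \sum_i c i * e i x) = (fun x => f x + g x).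
  by apply/funext => x; congr (_ + _); rewrite -sumrN; apply: eq_bigr => i _; rewrite mulNr.
rewrite E ipDl//; last exact: sqintD.
rewrite [ip f _]ipC [ip g _]ipC !ipDl//.
have fg : ip g f = - \sum_i c i * ip f (e i).
  rewrite ip_suml// -sumrN; apply: eq_bigr => i _; rewrite mulNr ipC//.
have gg : ip g g = \sum_i c i ^+ 2 * nu i.
  rewrite {1}/g ip_suml//; apply: eq_bigr => i _.
  rewrite ipC ip_suml// (bigD1 i)//= oe eqxx big1 ?addr0; first by ring.
  by move=> j ji; rewrite oe (negbTE ji) mulr0.
rewrite [ip f g]ipC gg fg /bessel -!addrA; congr (_ + _).
rewrite -!sumrN -!big_split /=; apply: eq_bigr => i _; field.
by rewrite gt_eqF.
Qed.

Lemma ip_sub_proj f : sqint f ->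
  ip (fun x => f x - proj f x) (fun x => f x - proj f x) = ip f f - bessel f.
Proof.
move=> sf; rewrite ip_sub_sum// big1 ?addr0// => i _.
by rewrite subrr expr0n mul0r.
Qed.

Lemma bessel_le f : sqint f -> bessel f <= ip f f.
Proof. by move=> sf; rewrite -subr_ge0 -ip_sub_proj// ip_ge0. Qed.

Lemma ip_sub_bessel_le f (c : I -> R) : sqint f ->
  ip f f - bessel f <=
  ip (fun x => f x - \sum_i c i * e i x) (fun x => f x - \sum_i c i * e i x).
Proof.
move=> sf; rewrite ip_sub_sum// lerDl sumr_ge0// => i _.
by rewrite mulr_ge0 ?sqr_ge0// ltW.
Qed.

End orthogonal.
End square_integrable.

Section completeness.
Context {R : realType}.
Local Notation leb3 := (@leb3 R).
Local Notation R3 := (R * R * R)%type.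
Implicit Types (f g h : R3 -> R) (p q r : {poly R}).

Definition hsum K g := exists c : idx K -> R, forall x, g x = \sum_n c n * hb n x.

Lemma hsum_pgauss3 K p q r : (size p <= K)%N -> (size q <= K)%N -> (size r <= K)%N ->
  hsum K (pgauss3 (1 / 2) p q r).
Proof.
move=> /herm_span[cp ->] /herm_span[cq ->] /herm_span[cr ->].
exists (fun n => cp n.1.1 * cq n.1.2 * cr n.2) => x.
pose P (c : 'I_K -> R) (i : 'I_K) y := c i * pgauss (1 / 2) (herm i) y.
have PE (c : 'I_K -> R) y : pgauss (1 / 2) (\sum_(i < K) c i *: herm i) y = \sum_i P c i y.
  rewrite /pgauss horner_sum mulr_suml; apply: eq_bigr => i _.
  by rewrite /P /pgauss hornerZ -mulrA.
rewrite /pgauss3 !PE big_distrlr /= pair_bigA /= big_distrlr /= pair_bigA /=.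
by apply: eq_bigr => n _; rewrite /P /hb /pgauss3; ring.
Qed.

Lemma hsum_hspan g : hspan g -> exists K0, forall K, (K0 <= K)%N -> hsum K g.
Proof.
move=> [s ->]; elim: s => [|t s [K0 IH]].
  by exists 0%N => K _; exists (fun=> 0) => x; rewrite big_nil big1// => n _; rewrite mul0r.
exists (maxn K0 (maxn (size t.1.1) (maxn (size t.1.2) (size t.2)))) => K.
rewrite !geq_max => /and4P[/IH[c cE] t1 t2 t3]; have [c' c'E] := hsum_pgauss3 t1 t2 t3.
exists (fun n => c' n + c n) => x; rewrite big_cons cE c'E -big_split /=.
by apply: eq_bigr => n _; rewrite mulrDl.
Qed.

Lemma sqint_hb K (n : idx K) : sqint leb3 (hb n).
Proof.
split; first exact: measurable_pgauss3.
by apply: integral_sqr_pgauss3.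
Qed.

(** An approximant from the span is a Hermite sum over every sufficiently large box of indices, and
    the projection onto that box is at least as close. *)
Lemma bessel_complete (f : R3 -> R) : sqint leb3 f -> forall e : R, 0 < e ->
  exists K0, forall K, (K0 <= K)%N ->
  ip leb3 f f - bessel leb3 (@hb R K) (@eta R K) f < e.
Proof.
move=> sf e e0; have [_ H] := app_of_sqr_integrable sf.1 sf.2.
have [g /hsum_hspan[K0 hK0] gf] := H e e0.
exists K0 => K /hK0[c cE].
have := @ip_sub_bessel_le _ _ _ leb3 _ (@hb R K) (@eta R K) (@sqint_hb K) (@eta_gt0 R K)
  (@Rintegral_hbM R K) f c sf.
move/le_lt_trans; apply; rewrite -lte_fin -integral_sqrE.
  by move: gf; rewrite (funext cE).
rewrite (_ : (fun x => _) = (fun x => f x + \sum_n (- c n) * hb n x)).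
  apply: sqintD => //; apply: sqint_sum; exact: sqint_hb.
by apply/funext => x; congr (_ + _); rewrite -sumrN; apply: eq_bigr => i _; rewrite mulNr.
Qed.

End completeness.

(** * Eigenfunctions of the oscillator *)

Section schwartz_hermite.
Context {R : realType}.
Local Notation R3 := (R * R * R)%type.
Implicit Types (p q r : {poly R}).

(** The two difference quotients coincide; this reduces partial derivatives on the product space to
    derivatives in one variable. *)
Lemma is_derive_along (V : normedModType R) (f : V -> R) (g : R -> R) (x v : V) (y dg : R) :
  (forall h, f (h *: v + x) = g (h + y)) -> is_derive y 1 g dg ->
  is_derive x v f dg.
Proof.
move=> fg [dg1 dg2]; have E : (fun h : R => h^-1 *: ((f \o shift x) (h *: v) - f x)) =
    (fun h : R => h^-1 *: ((g \o shift y) (h *: (1 : R)) - g y)).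
  apply/funext => h; have := fg 0; rewrite scale0r !add0r /= => ->.
  by rewrite fg /shift /= /GRing.scale /= mulr1.
by split; [rewrite /derivable E|rewrite -dg2 /derive E].
Qed.

Definition poly3 := ({poly R} * {poly R} * {poly R})%type.

Definition pgaussian (t : poly3) : R3 -> R := pgauss3 (1 / 2) t.1.1 t.1.2 t.2.

Definition dmul3 (i : 'I_3) (t : poly3) : poly3 :=
  (if i == 0 :> nat then dmul t.1.1 else t.1.1,
   if i == 1 :> nat then dmul t.1.2 else t.1.2,
   if i == 2 :> nat then dmul t.2 else t.2).

Lemma is_derive_pgauss p (y : R) :
  is_derive y 1 (pgauss (1 / 2) p) (pgauss (1 / 2) (dmul p) y).
Proof.
have := is_derive_poly_gauss (1 / 2) p y.
by rewrite /dgauss (_ : 2 * (1 / 2) = 1 :> R) ?scale1r//; field.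
Qed.

Lemma is_derive_pgaussian (t : poly3) (i : 'I_3) (x : R3) :
  is_derive x (axis i) (pgaussian t) (pgaussian (dmul3 i t) x).
Proof.
have M (c : R) p (y : R) : is_derive y 1 (fun s => c * pgauss (1 / 2) p s) (c * pgauss (1 / 2) (dmul p) y).
  by have D := is_derive_pgauss p y; apply: (is_derive_eq (is_deriveZ _ _)).
rewrite /pgaussian /dmul3 /pgauss3 /axis; case: i => -[|[|[|//]]] /= _.
- apply: (is_derive_along (g := fun s =>
    pgauss (1 / 2) t.1.2 x.1.2 * pgauss (1 / 2) t.2 x.2 * pgauss (1 / 2) t.1.1 s) (y := x.1.1)).
    by move=> h; rewrite /= /GRing.scale /= mulr1 !mulr0 !add0r; ring.
  by apply: (is_derive_eq (M _ _ _)); ring.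
- apply: (is_derive_along (g := fun s =>
    pgauss (1 / 2) t.1.1 x.1.1 * pgauss (1 / 2) t.2 x.2 * pgauss (1 / 2) t.1.2 s) (y := x.1.2)).
    by move=> h; rewrite /= /GRing.scale /= mulr1 !mulr0 !add0r; ring.
  by apply: (is_derive_eq (M _ _ _)); ring.
- apply: (is_derive_along (g := fun s =>
    pgauss (1 / 2) t.1.1 x.1.1 * pgauss (1 / 2) t.1.2 x.1.2 * pgauss (1 / 2) t.2 s) (y := x.2)).
    by move=> h; rewrite /= /GRing.scale /= mulr1 !mulr0 !add0r; ring.
Qed.

Lemma partial_pgaussian i t : partial i (pgaussian t) = pgaussian (dmul3 i t).
Proof.
by apply/funext => x; rewrite /partial; case: (is_derive_pgaussian t i x).
Qed.

Lemma iter_partial_pgaussian s t : iter_partial s (pgaussian t) = pgaussian (foldr dmul3 t s).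
Proof. by elim: s => //= i s ->; exact: partial_pgaussian. Qed.

(** Partial derivatives stay of the form polynomial times Gaussian, and [1 + |x| ^ 2] is at most the
    product of the [1 + x_i ^ 2], so the decay is a matter of one variable. Hermite functions thus
    become admissible test functions in the equation. *)
Lemma schwartz_pgaussian t : schwartz (pgaussian t).
Proof.
split=> [s i x|s k].
  by rewrite iter_partial_pgaussian; case: (is_derive_pgaussian (foldr dmul3 t s) i x).
rewrite iter_partial_pgaussian; move: (foldr dmul3 t s) => {s}{}t.
have B p : exists2 M : R, 0 <= M & forall y, (1 + y ^+ 2) ^+ k * `|pgauss (1 / 2) p y| <= M.
  have [|M M0 HM] := @poly_gauss_bound R (1 / 2) ((1 + 'X^2) ^+ k * p); first by [].
  exists M => // y; have := HM y.
  rewrite hornerM horner_exp hornerD -polyC1 hornerC hornerXn -mulrA.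
  by rewrite -/(pgauss (1 / 2) p y) normrM ger0_norm// exprn_ge0// addr_ge0// sqr_ge0.
have [M1 M10 H1] := B t.1.1; have [M2 M20 H2] := B t.1.2; have [M3 M30 H3] := B t.2.
have sq (y : R) : 0 <= y ^+ 2 by exact: sqr_ge0.
have sk (y : R) : 0 <= (1 + y ^+ 2) ^+ k by rewrite exprn_ge0// addr_ge0.
exists (M1 * M2 * M3) => x.
apply: (@le_trans _ _ (((1 + x.1.1 ^+ 2) * (1 + x.1.2 ^+ 2) * (1 + x.2 ^+ 2)) ^+ k * `|pgaussian t x|)).
  rewrite ler_wpM2r// lerXn2r ?nnegrE ?addr_ge0//; last first.
    rewrite /sqlen; have := sq x.1.1; have := sq x.1.2; have := sq x.2.
    move: (x.1.1 ^+ 2) (x.1.2 ^+ 2) (x.2 ^+ 2) => a b c c0 b0 a0.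
    rewrite -subr_ge0 (_ : _ - _ = a * b + a * c + b * c + a * b * c); last by ring.
    by do ![apply: addr_ge0|apply: mulr_ge0].
  by apply: mulr_ge0; [apply: mulr_ge0|]; rewrite addr_ge0.

have -> : ((1 + x.1.1 ^+ 2) * (1 + x.1.2 ^+ 2) * (1 + x.2 ^+ 2)) ^+ k * `|pgaussian t x| =
    (1 + x.1.1 ^+ 2) ^+ k * `|pgauss (1 / 2) t.1.1 x.1.1| *
    ((1 + x.1.2 ^+ 2) ^+ k * `|pgauss (1 / 2) t.1.2 x.1.2|) *
    ((1 + x.2 ^+ 2) ^+ k * `|pgauss (1 / 2) t.2 x.2|).
  by rewrite /pgaussian /pgauss3 (normrM (_ * _)) (normrM (pgauss _ _ _)) !exprMn; ring.
have N p y : 0 <= (1 + y ^+ 2) ^+ k * `|pgauss (1 / 2) p y| by exact: mulr_ge0.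
apply: ler_pM => //; first exact: mulr_ge0.
exact: ler_pM.
Qed.

(** The three one-dimensional eigenvalues [2 n_i + 1] add up. *)
Lemma oscillator_hb K (n : idx K) (x : R3) :
  oscillator (hb n) x = (2 * deg n + 3)%:R * hb n x.
Proof.
have E p (y : R) : pgauss (1 / 2) (dmul (dmul p)) y =
    y ^+ 2 * pgauss (1 / 2) p y - pgauss (1 / 2) (- dmul (dmul p) + 'X * ('X * p)) y.
  by rewrite /pgauss (hornerD (- _)) hornerN (hornerM _ (_ * _)) (hornerM _ p) !hornerX; ring.
pose t : poly3 := (herm n.1.1, herm n.1.2, herm n.2).
rewrite /oscillator /laplacian (_ : hb n = pgaussian t)//.
under eq_bigr do rewrite !partial_pgaussian.
rewrite !big_ord_recl big_ord0 /= /pgaussian /pgauss3 /dmul3 /= !E !herm_oscillator.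
rewrite /sqlen /deg.
have S k p (y : R) : pgauss (1 / 2) (k%:R *: p) y = k%:R * pgauss (1 / 2) p y.
  by rewrite /pgauss hornerZ -mulrA.
by rewrite !S; ring.
Qed.

End schwartz_hermite.

(** * Rotations and time averages *)

Section trigonometry.
Context {R : realType}.
Local Notation mu := (@lebesgue_measure R).

Lemma is_derive_cosM (l t : R) : is_derive t 1 (fun s => cos (l * s)) (- (l * sin (l * t))).
Proof.
have dl : is_derive t 1 ( *%R l) l by apply: is_derive_eq; rewrite /GRing.scale /= mulr1.
by apply: (is_derive_eq (is_derive1_comp (is_derive_cos _) dl)); rewrite mulNr mulrC.
Qed.

Lemma is_derive_sinM (l t : R) : is_derive t 1 (fun s => sin (l * s)) (l * cos (l * t)).
Proof.
have dl : is_derive t 1 ( *%R l) l by apply: is_derive_eq; rewrite /GRing.scale /= mulr1.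
by apply: (is_derive_eq (is_derive1_comp (is_derive_sin _) dl)); rewrite mulrC.
Qed.

(** Rotating [(a, b)] back by the angle [l t] gives [p] and [q], whose derivatives vanish. *)
Lemma rotation_ode (l : R) (a b : R -> R) :
  (forall t : R, is_derive t 1 a (l * b t)) -> (forall t : R, is_derive t 1 b (- (l * a t))) ->
  forall t, a t = cos (l * t) * a 0 + sin (l * t) * b 0 /\
            b t = cos (l * t) * b 0 - sin (l * t) * a 0.
Proof.
move=> da db t.
pose p s := cos (l * s) * a s - sin (l * s) * b s.
pose q s := sin (l * s) * a s + cos (l * s) * b s.
have dc := is_derive_cosM l; have ds := is_derive_sinM l.
have p0 : p t = p 0.
  apply: is_derive_0_is_cst => s; rewrite /p.
  apply: (is_derive_eq (is_deriveB (is_deriveM (dc s) (da s)) (is_deriveM (ds s) (db s)))).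
  by rewrite /GRing.scale /=; ring.
have q0 : q t = q 0.
  apply: is_derive_0_is_cst => s; rewrite /q.
  apply: (is_derive_eq (is_deriveD (is_deriveM (ds s) (da s)) (is_deriveM (dc s) (db s)))).
  by rewrite /GRing.scale /=; ring.
have -> : a 0 = p t by rewrite p0 /p mulr0 cos0 sin0; ring.
have -> : b 0 = q t by rewrite q0 /q mulr0 cos0 sin0; ring.
have cs := cos2Dsin2 (l * t); rewrite /p /q; split.
  by rewrite -[LHS]mul1r -cs; ring.
by rewrite -[LHS]mul1r -cs; ring.
Qed.

Lemma is_derive_bigsum (I : Type) (s : seq I) (h : I -> R -> R) (dh : I -> R) (t : R) :
  (forall i, is_derive t 1 (h i) (dh i)) ->
  is_derive t 1 (fun x => \sum_(i <- s) h i x) (\sum_(i <- s) dh i).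
Proof.
move=> H; elim: s => [|i s IH].
  by rewrite big_nil; under eq_fun do rewrite big_nil; exact: is_derive_cst.
by rewrite big_cons; under eq_fun do rewrite big_cons; exact: is_deriveD.
Qed.

Lemma cos_sin_natM2pi (n : nat) : cos (n%:R * (2 * pi)) = 1 :> R /\ sin (n%:R * (2 * pi)) = 0 :> R.
Proof.
have -> : n%:R * (2 * pi) = (pi *+ 2) *+ n :> R by rewrite -[RHS]mulr_natl -[pi *+ 2]mulr_natl.
split; first by rewrite -[X in cos X]add0r (periodicn (@cosD2pi R) n 0) cos0.
by rewrite -[X in sin X]add0r (periodicn (@sinD2pi R) n 0) sin0.
Qed.

(** Parseval for the sum of [(A_i + i B_i) exp (- i l_i t)]: its squared modulus is a double sum
    with frequencies [l_i - l_j]. The pairs off the diagonal have a primitive of period [2 pi]; on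
    the diagonal the primitive is linear. *)
Lemma integral_trig_sqr (I : finType) (l : I -> nat) (A B : I -> R) : injective l ->
  (\int[mu]_(t in `[0%R, (2 * pi)%R])
     ((\sum_i (cos ((l i)%:R * t) * A i + sin ((l i)%:R * t) * B i)) ^+ 2 +
      (\sum_i (cos ((l i)%:R * t) * B i - sin ((l i)%:R * t) * A i)) ^+ 2)%:E =
   (2 * pi * \sum_i (A i ^+ 2 + B i ^+ 2))%:E)%E.
Proof.
move=> linj; pose k (p : I * I) : R := (l p.1)%:R - (l p.2)%:R.
pose X (p : I * I) : R := A p.1 * A p.2 + B p.1 * B p.2.
pose Y (p : I * I) : R := B p.1 * A p.2 - A p.1 * B p.2.
pose f (t : R) : R := \sum_p (cos (k p * t) * X p + sin (k p * t) * Y p).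
pose g p (t : R) : R := if k p == 0 then t * X p else (sin (k p * t) * X p - cos (k p * t) * Y p) / k p.
pose F (t : R) : R := \sum_p g p t.
have fE t : (\sum_i (cos ((l i)%:R * t) * A i + sin ((l i)%:R * t) * B i)) ^+ 2 +
    (\sum_i (cos ((l i)%:R * t) * B i - sin ((l i)%:R * t) * A i)) ^+ 2 = f t.
  rewrite !expr2 !big_distrlr /= !pair_bigA /= -big_split /=; apply: eq_bigr => -[i j] _ /=.
  rewrite /k /X /Y /= (_ : (_ - _) * t = (l i)%:R * t - (l j)%:R * t) ?mulrBl//.
  by rewrite cosB sinB; ring.
have dg p (t : R) : is_derive t 1 (g p) (cos (k p * t) * X p + sin (k p * t) * Y p).
  rewrite /g; move: (X p) (Y p) (k p) => x y c; case: eqP => [->|/eqP c0].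
    rewrite !mul0r cos0 sin0; apply: (is_derive_eq (is_deriveM (is_derive_id _ _) (is_derive_cst _ _ _))).
    by rewrite /GRing.scale /=; ring.
  have d1 := is_deriveM (is_derive_sinM c t) (is_derive_cst x t 1).
  have d2 := is_deriveM (is_derive_cosM c t) (is_derive_cst y t 1).
  apply: (is_derive_eq (is_deriveM (is_deriveB d1 d2) (is_derive_cst c^-1 t 1))).
  by rewrite /GRing.scale /=; field.
have dF (t : R) : is_derive t 1 F (f t) by apply: is_derive_bigsum => p.
have df (t : R) : derivable f t 1.
  suff [] : is_derive t 1 f (\sum_p (- (k p * sin (k p * t)) * X p + k p * cos (k p * t) * Y p)) by [].
  apply: is_derive_bigsum => p; move: (X p) (Y p) (k p) => x y c.
  have d1 := is_deriveM (is_derive_sinM c t) (is_derive_cst y t 1).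
  have d2 := is_deriveM (is_derive_cosM c t) (is_derive_cst x t 1).
  by apply: (is_derive_eq (is_deriveD d2 d1)); rewrite /GRing.scale /=; ring.
have cf : continuous f by move=> t; apply: differentiable_continuous; apply/derivable1_diffP.
have cF : continuous F.
  by move=> t; apply: differentiable_continuous; apply/derivable1_diffP; case: (dF t).
under eq_integral do rewrite fE.
rewrite (continuous_FTC2 (F := F)); last 4 first.
- by rewrite mulr_gt0// pi_gt0.
- exact/continuous_subspaceT.
- by split; [move=> x _; case: (dF x)|apply: cvg_at_right_filter; exact: cF|apply: cvg_at_left_filter; exact: cF].
- by move=> x _; rewrite derive1E; case: (dF x).
rewrite -EFinB -sumrB; congr EFin.
transitivity (\sum_(p : I * I) if p.1 == p.2 then 2 * pi * X p else 0).
  apply: eq_bigr => -[i j] _; rewrite /g /k /=.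
  rewrite subr_eq0 eqr_nat (inj_eq linj); case: eqP => [_|ij]; first by rewrite mul0r subr0.
  have [ci si] := cos_sin_natM2pi (l i); have [cj sj] := cos_sin_natM2pi (l j).
  rewrite (_ : (_ - _) * (2 * pi) = (l i)%:R * (2 * pi) - (l j)%:R * (2 * pi)) ?mulrBl//.
  by rewrite cosB sinB ci si cj sj !mulr0 !subr0 cos0 sin0; ring.
rewrite -(pair_bigA _ (fun i j => if i == j then 2 * pi * X (i, j) else 0)) /= mulr_sumr.
apply: eq_bigr => i _; rewrite (bigD1 i)//= eqxx big1 ?addr0 => [|j ji].
  by rewrite /X /=; ring.
by rewrite eq_sym (negbTE ji).
Qed.

End trigonometry.

(** * Time averages: finite Hermite sums, then the limit *)

Section time_average.
Context {R : realType}.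
Local Notation mu := (@lebesgue_measure R).
Local Notation leb3 := (@leb3 R).
Local Notation R3 := (R * R * R)%type.

Definition rot_re (l : nat) (a b t : R) := cos (l%:R * t) * a + sin (l%:R * t) * b.
Definition rot_im (l : nat) (a b t : R) := cos (l%:R * t) * b - sin (l%:R * t) * a.

Definition lam {K} (n : idx K) : nat := (2 * deg n + 3)%N.

Lemma rot_sqr l a b t : rot_re l a b t ^+ 2 + rot_im l a b t ^+ 2 = a ^+ 2 + b ^+ 2.
Proof.
by rewrite -[RHS]mul1r -(cos2Dsin2 (l%:R * t)) /rot_re /rot_im; ring.
Qed.

Definition flow_re K (a b : idx K -> R) t x := \sum_n rot_re (lam n) (a n) (b n) t * hb n x.
Definition flow_im K (a b : idx K -> R) t x := \sum_n rot_im (lam n) (a n) (b n) t * hb n x.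

Definition level K N (a : idx K -> R) n : R := if deg n == N then a n else 0.

(** [3 * K] exceeds the degree of every index in the box. *)
Lemma sum_level K (F : nat -> idx K -> R) :
  \sum_(N < 3 * K) \sum_n (if deg n == N then F N n else 0) = \sum_n F (deg n) n.
Proof.
rewrite exchange_big /=; apply: eq_bigr => n _.
have h : (deg n < 3 * K)%N by rewrite /deg; have := ltn_ord n.1.1; have := ltn_ord n.1.2; have := ltn_ord n.2; lia.
rewrite (bigD1 (Ordinal h))//= eqxx big1 ?addr0// => N NE.
by case: eqP => // E; case/negP: NE; apply/eqP/val_inj.
Qed.

Lemma flow_level K (a b : idx K -> R) t x :
  flow_re a b t x ^+ 2 + flow_im a b t x ^+ 2 =
  (\sum_(N < 3 * K) (cos ((2 * N + 3)%:R * t) * (\sum_n level N a n * hb n x) +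
                     sin ((2 * N + 3)%:R * t) * (\sum_n level N b n * hb n x))) ^+ 2 +
  (\sum_(N < 3 * K) (cos ((2 * N + 3)%:R * t) * (\sum_n level N b n * hb n x) -
                     sin ((2 * N + 3)%:R * t) * (\sum_n level N a n * hb n x))) ^+ 2.
Proof.
congr (_ ^+ 2 + _ ^+ 2).
  rewrite /flow_re -(sum_level (fun N n => rot_re (2 * N + 3) (a n) (b n) t * hb n x)).
  apply: eq_bigr => N _; rewrite !mulr_sumr -big_split /=; apply: eq_bigr => n _.
  by rewrite /level /rot_re; case: eqP => _; ring.
rewrite /flow_im -(sum_level (fun N n => rot_im (2 * N + 3) (a n) (b n) t * hb n x)).
apply: eq_bigr => N _; rewrite !mulr_sumr -sumrB /=; apply: eq_bigr => n _.
by rewrite /level /rot_im; case: eqP => _; ring.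
Qed.

Lemma sqlen_ge0 (x : R3) : 0 <= sqlen x.
Proof. by rewrite /sqlen !addr_ge0// sqr_ge0. Qed.

Lemma measurable_rot (l a b : R) :
  measurable_fun setT (fun t : R => cos (l * t) * a + sin (l * t) * b).
Proof.
have mc : measurable_fun setT (fun t : R => cos (l * t)).
  apply: (measurableT_comp (continuous_measurable_fun (@continuous_cos R))).
  exact: mulrl_measurable.
have ms : measurable_fun setT (fun t : R => sin (l * t)).
  apply: (measurableT_comp (continuous_measurable_fun (@continuous_sin R))).
  exact: mulrl_measurable.
by apply: measurable_funD; exact: measurable_funM.
Qed.

Lemma measurable_rot_re l (a b : R) : measurable_fun setT (rot_re l a b).
Proof. exact: measurable_rot. Qed.

Lemma measurable_rot_im l (a b : R) : measurable_fun setT (rot_im l a b).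
Proof.
rewrite (_ : rot_im l a b = fun t => cos (l%:R * t) * b + sin (l%:R * t) * - a).
  exact: measurable_rot.
by apply/funext => t; rewrite /rot_im mulrN.
Qed.

Definition flow_density K (a b : idx K -> R) t x :=
  (flow_re a b t x ^+ 2 + flow_im a b t x ^+ 2) / sqlen x.

Lemma flow_density_ge0 K (a b : idx K -> R) t x : 0 <= flow_density a b t x.
Proof. by rewrite divr_ge0 ?sqlen_ge0// addr_ge0// sqr_ge0. Qed.

Lemma measurable_flow_density K (a b : idx K -> R) :
  measurable_fun setT (fun z : R * R3 => flow_density a b z.1 z.2).
Proof.
have mhb (n : idx K) : measurable_fun setT (fun z : R * R3 => hb n z.2).
  by apply: measurableT_comp => //; exact: measurable_pgauss3.
apply: measurable_funM; last first.
  by apply: (measurableT_comp measurable_inv); apply: (measurableT_comp measurable_sqlen).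
apply: measurable_funD; apply: measurable_funX; apply: measurable_sum => n;
    apply: measurable_funM => //.
  exact: (measurableT_comp (measurable_rot_re _ _ _) measurable_fst).
exact: (measurableT_comp (measurable_rot_im _ _ _) measurable_fst).
Qed.

(** Tonelli moves the time integral inside, where it separates the levels; the constant is [2 pi]
    from the period times 3 from [level_estimate]. *)
Lemma flow_average K (a b : idx K -> R) :
  (\int[mu]_(t in `[0%R, (2 * pi)%R]) \int[leb3]_x (flow_density a b t x)%:E <=
   (6 * pi * \sum_n (a n ^+ 2 + b n ^+ 2) * eta n)%:E)%E.
Proof.
pose D : set R := `[0%R, (2 * pi)%R]%classic.
have mD : measurable D by exact: measurable_itv.
have int_D (f : R -> \bar R) : (\int[mu]_(l in D) (f l) = \int[mu]_l ((\1_D l)%:E * f l))%E.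
  rewrite integral_mkcond; apply: eq_integral => l _; rewrite patchE indicE.
  by case: (l \in D); rewrite ?mul1e ?mul0e.
have mi : measurable_fun setT (\1_D : R -> R) by exact: measurable_indic.
have ind0 t : 0 <= \1_D t :> R by rewrite indicE.
pose H (z : R * R3) : \bar R := (\1_D z.1 * flow_density a b z.1 z.2)%:E.
have mH : measurable_fun setT H.
  apply/measurable_EFinP; apply: measurable_funM; last exact: measurable_flow_density.
  exact: (measurableT_comp mi measurable_fst).
have H0 z : (0 <= H z)%E by rewrite lee_fin mulr_ge0// flow_density_ge0.
rewrite int_D.
have -> : (\int[mu]_t ((\1_D t)%:E * \int[leb3]_x (flow_density a b t x)%:E) =
    \int[mu]_t \int[leb3]_x H (t, x))%E.
  apply: eq_integral => t _; rewrite -ge0_integralZl_EFin//.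
  - by move=> x _; rewrite lee_fin flow_density_ge0.
  - apply/measurable_EFinP.
    exact: (measurableT_comp (measurable_flow_density a b) (pair1_measurable t)).
rewrite (@fubini_tonelli _ _ _ _ R mu leb3 H mH H0).
pose A N (x : R3) := \sum_n level N a n * hb n x.
pose B N (x : R3) := \sum_n level N b n * hb n x.
have E (x : R3) : (\int[mu]_t H (t, x) =
    (2 * pi)%:E * \sum_(N < 3 * K) ((A N x ^+ 2 / sqlen x)%:E + (B N x ^+ 2 / sqlen x)%:E))%E.
  have -> : (\int[mu]_t H (t, x) = \int[mu]_(t in D) ((sqlen x)^-1%:E *
      (flow_re a b t x ^+ 2 + flow_im a b t x ^+ 2)%:E))%E.
    rewrite int_D; apply: eq_integral => t _.
    by rewrite /H /flow_density -!EFinM; congr EFin; ring.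
  rewrite ge0_integralZl_EFin ?invr_ge0 ?sqlen_ge0//; last 2 first.
  - by move=> t _; rewrite lee_fin addr_ge0// sqr_ge0.
  - apply/measurable_EFinP; apply: measurable_funTS; apply: measurable_funD;
      apply: measurable_funX; apply: measurable_sum => n; apply: measurable_funM => //.
      exact: measurable_rot_re.
    exact: measurable_rot_im.
  under eq_integral do rewrite flow_level.
  rewrite (@integral_trig_sqr _ _ (fun N : 'I_(3 * K) => 2 * N + 3)%N (fun N => A N x) (fun N => B N x)).
    rewrite sumEFin -!EFinM; congr EFin; rewrite mulrCA; congr (_ * _).
    by rewrite mulr_sumr; apply: eq_bigr => N _; ring.
  by move=> N M h; apply: val_inj => /=; lia.
under eq_integral do rewrite E.
have mAB c N : measurable_fun setT (fun x : R3 => ((\sum_n level N c n * hb n x) ^+ 2 / sqlen x)%:E : \bar R).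
  apply/measurable_EFinP; apply: measurable_funM.
    apply: measurable_funX; apply: measurable_sum => n; apply: measurable_funM => //.
    exact: measurable_pgauss3.
  exact: (measurableT_comp measurable_inv measurable_sqlen).
have AB0 c N (x : R3) : (0 <= ((\sum_n level N c n * hb n x) ^+ 2 / sqlen x)%:E :> \bar R)%E.
  by rewrite lee_fin divr_ge0 ?sqr_ge0// sqlen_ge0.
have p2 : 0 <= 2 * pi :> R by rewrite mulr_ge0// pi_ge0.
rewrite ge0_integralZl_EFin//; last 2 first.
- by move=> x _; apply: sume_ge0 => N _; apply: adde_ge0; exact: AB0.
- by apply: emeasurable_sum => N; apply: emeasurable_funD; exact: mAB.
rewrite ge0_integral_sum//; last 2 first.
- by move=> N; apply: emeasurable_funD; exact: mAB.
- by move=> N x _; apply: adde_ge0; exact: AB0.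
have LE c N : (\int[leb3]_x ((\sum_n level N c n * hb n x) ^+ 2 / sqlen x)%:E <=
    (3 * \sum_(n : idx K) level N c n ^+ 2 * eta n)%:E)%E.
  by apply: (level_estimate (N := N)) => n; rewrite /level => /negbTE ->.
pose S (N : 'I_(3 * K)) := 3 * \sum_(n : idx K) level N a n ^+ 2 * eta n +
  3 * \sum_(n : idx K) level N b n ^+ 2 * eta n.
apply: (@le_trans _ _ ((2 * pi)%:E * \sum_(N < 3 * K) (S N)%:E)%E).
  apply: lee_wpmul2l; first by rewrite lee_fin.
  apply: lee_sum => N _; rewrite ge0_integralD//; last 4 first.
  - by move=> x _; exact: AB0.
  - exact: mAB.
  - by move=> x _; exact: AB0.
  - exact: mAB.
  by rewrite /S EFinD; apply: leeD; exact: LE.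
rewrite sumEFin -EFinM lee_fin (_ : 6 * pi = 2 * pi * 3); last by ring.
rewrite -mulrA ler_wpM2l// mulr_sumr le_eqVlt; apply/orP; left; apply/eqP.
rewrite -(sum_level (fun N n => 3 * ((a n ^+ 2 + b n ^+ 2) * eta n))).
apply: eq_bigr => N _; rewrite /S -mulrDr -big_split mulr_sumr; apply: eq_bigr => n _.
by rewrite /level; case: eqP => _; rewrite /=; ring.
Qed.

(** The integral of a nonnegative function is a supremum over simple functions below it, so it is
    monotone without measurability. This serves the spatial integral of the solution, whose
    measurability in time is not at hand. *)
Lemma le_integral_nonmeasurable d (T : measurableType d) (m : {measure set T -> \bar R})
    (D : set T) (f g : T -> \bar R) : (forall x, D x -> (0 <= f x)%E) ->
  (forall x, D x -> (f x <= g x)%E) -> (\int[m]_(x in D) f x <= \int[m]_(x in D) g x)%E.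
Proof.
move=> f0 fg; have g0 x : D x -> (0 <= g x)%E by move=> Dx; exact: le_trans (f0 x Dx) (fg x Dx).
rewrite !ge0_integralE//; apply: ereal_sup_le => _ /= [h hf <-]; exists h => // x.
apply: le_trans (hf x) _; rewrite !patchE; case: ifPn => // xD.
by apply: fg; rewrite inE in xD.
Qed.

Lemma limn_einf_le_cst (u : (\bar R)^nat) c : (forall n, (u n <= c)%E) -> (limn_einf u <= c)%E.
Proof.
move=> uc; rewrite limn_einf_lim; apply: lime_le; first exact: is_cvg_einfs.
apply: nearW => n; apply: le_trans (uc n); apply: ereal_inf_lbound.
by exists n => /=.
Qed.

Lemma le_limn_einf (u v : (\bar R)^nat) : (forall n, (u n <= v n)%E) ->
  (limn_einf u <= limn_einf v)%E.
Proof.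
move=> uv; rewrite !limn_einf_lim; apply: lee_lim; [exact: is_cvg_einfs|exact: is_cvg_einfs|].
apply: nearW => n; apply: le_ereal_inf_tmp => _ [k /= nk <-].
by apply: le_trans (uv k); apply: ereal_inf_lbound; exists k.
Qed.

Lemma time_average (v w : R -> R3 -> R) :
  (forall t, sqint leb3 (v t)) -> (forall t, sqint leb3 (w t)) ->
  (forall K (n : idx K) t, ip leb3 (v t) (hb n) =
     rot_re (lam n) (ip leb3 (v 0) (hb n)) (ip leb3 (w 0) (hb n)) t) ->
  (forall K (n : idx K) t, ip leb3 (w t) (hb n) =
     rot_im (lam n) (ip leb3 (v 0) (hb n)) (ip leb3 (w 0) (hb n)) t) ->
  (\int[mu]_(t in `[0%R, (2 * pi)%R])
     \int[leb3]_x ((v t x ^+ 2 + w t x ^+ 2) / sqlen x)%:E <=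
   (12 * pi * (ip leb3 (v 0) (v 0) + ip leb3 (w 0) (w 0)))%:E)%E.
Proof.
move=> sv sw vE wE; pose B K f := bessel leb3 (@hb R K) (@eta R K) f.
pose E t := ip leb3 (v t) (v t) + ip leb3 (w t) (w t).
pose T K := B K (v 0) + B K (w 0).
(* The rotations preserve the modulus of each coefficient. *)
have TE K t : B K (v t) + B K (w t) = T K.
  rewrite /T /B /bessel -!big_split /=; apply: eq_bigr => n _.
  by rewrite -!mulrDl (vE K n t) (wE K n t) rot_sqr.
have TleE K t : T K <= E t.
  by rewrite -(TE K t) lerD// bessel_le//;
    [exact: sqint_hb|exact: eta_gt0|exact: Rintegral_hbM|exact: sqint_hb|exact: eta_gt0|exact: Rintegral_hbM].
have ET t (e : R) : 0 < e -> exists K0, forall K, (K0 <= K)%N -> E t - T K < e.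
  move=> e0; have e2 : 0 < e / 2 by rewrite divr_gt0.
  have [K1 H1] := bessel_complete (sv t) e2; have [K2 H2] := bessel_complete (sw t) e2.
  exists (maxn K1 K2) => K; rewrite geq_max => /andP[/H1 h1 /H2 h2].
  by rewrite -(TE K t) /E; move: h1 h2; rewrite -/(B K _) -/(B K _); lra.
(* [T K] comes arbitrarily close to [E t], and it never exceeds [E 0]. *)
have EE t : E t <= E 0.
  apply/ler_addgt0Pr => e e0; have [K0 /(_ K0 (leqnn _)) h] := ET t e e0.
  by have := TleE K0 0; lra.
pose a K (n : idx K) : R := ip leb3 (v 0) (hb n) / eta n.
pose b K (n : idx K) : R := ip leb3 (w 0) (hb n) / eta n.
have vP K t : proj leb3 (@hb R K) (@eta R K) (v t) = flow_re (@a K) (@b K) t.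
  apply/funext => x; apply: eq_bigr => n _.
  by rewrite (vE K n t) /rot_re /a /b; congr (_ * _); ring.
have wP K t : proj leb3 (@hb R K) (@eta R K) (w t) = flow_im (@a K) (@b K) t.
  apply/funext => x; apply: eq_bigr => n _.
  by rewrite (wE K n t) /rot_im /a /b; congr (_ * _); ring.
have average K : (\int[mu]_(t in `[0%R, (2 * pi)%R])
    \int[leb3]_x (flow_density (@a K) (@b K) t x)%:E <= (6 * pi * E 0)%:E)%E.
  apply: (le_trans (flow_average _ _)); rewrite lee_fin ler_wpM2l ?mulr_ge0 ?pi_ge0//.
  apply: le_trans (TleE K 0); rewrite le_eqVlt; apply/orP; left; apply/eqP.
  rewrite /T /B /bessel -big_split /=; apply: eq_bigr => n _; rewrite /a /b; field.
  by rewrite gt_eqF// eta_gt0.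
have sF K t : sqint leb3 (fun x => v t x - flow_re (@a K) (@b K) t x) /\
              sqint leb3 (fun x => w t x - flow_im (@a K) (@b K) t x).
  have S (f : R3 -> R) (c : idx K -> R) : sqint leb3 f -> sqint leb3 (fun x => f x - \sum_n c n * hb n x).
    move=> sf; rewrite (_ : (fun x => _) = (fun x => f x + \sum_n (- c n) * hb n x)).
      by apply: sqintD => //; apply: sqint_sum; exact: sqint_hb.
    by apply/funext => x; congr (_ + _); rewrite -sumrN; apply: eq_bigr => i _; rewrite mulNr.
  by split; exact: S.
have residual K t :
  (\int[leb3]_x ((v t x - flow_re (@a K) (@b K) t x) ^+ 2)%:E +
   \int[leb3]_x ((w t x - flow_im (@a K) (@b K) t x) ^+ 2)%:E <= (E 0 - T K)%:E)%E.
  have [s1 s2] := sF K t.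
  rewrite (integral_sqrE s1) (integral_sqrE s2) -EFinD lee_fin -vP -wP.
  rewrite !ip_sub_proj//; [|exact: sqint_hb|exact: eta_gt0|exact: Rintegral_hbM
                           |exact: sqint_hb|exact: eta_gt0|exact: Rintegral_hbM].
  by have := EE t; rewrite -(TE K t) {1}/E /B; lra.
apply/lee_addgt0Pr => e e0.
have p0 : 0 < pi :> R by exact: pi_gt0.
(* The truncation [k n] is so fine that the tail, doubled, multiplied by the cut-off height [n] and
   integrated over the period, is at most [e]. *)
have /choice[k Hk] : forall n : nat, exists K, 4 * pi * n%:R * (E 0 - T K) <= e.
  move=> n; have [|K /(_ K (leqnn _)) h] := ET 0 (e / (4 * pi * n.+1%:R)).
    by rewrite divr_gt0// !mulr_gt0.
  exists K; move: h; rewrite ltr_pdivlMr ?mulr_gt0// => h.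
  apply: le_trans (ltW h); rewrite mulrC ler_wpM2l ?subr_ge0//.
  by rewrite ler_wpM2l ?ler_nat// mulr_ge0// ltW.
(* A majorant of the cut-off integral that is measurable in [t], so that Fatou's lemma in time can
   be applied to it. *)
pose G n t : \bar R := (2%:E * \int[leb3]_x (flow_density (@a (k n)) (@b (k n)) t x)%:E +
  (2 * n%:R * (E 0 - T (k n)))%:E)%E.
have dens0 n t (x : R3) : (0 <= (flow_density (@a (k n)) (@b (k n)) t x)%:E)%E.
  by rewrite lee_fin flow_density_ge0.
have intdens0 n t : (0 <= \int[leb3]_x (flow_density (@a (k n)) (@b (k n)) t x)%:E)%E.
  by apply: integral_ge0.
have slack0 n : 0 <= 2 * n%:R * (E 0 - T (k n)) by rewrite !mulr_ge0// subr_ge0.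
have G0 n t : (0 <= G n t)%E.
  by apply: adde_ge0; [apply: mule_ge0 => //; rewrite lee_fin|rewrite lee_fin].
have mI n : measurable_fun setT (fun t : R => \int[leb3]_x (flow_density (@a (k n)) (@b (k n)) t x)%:E)%E.
  apply: (@measurable_fun_fubini_tonelli_F _ _ _ _ R leb3
    (fun z : R * R3 => (flow_density (@a (k n)) (@b (k n)) z.1 z.2)%:E)).
    by apply/measurable_EFinP; exact: measurable_flow_density.
  by move=> z; exact: dens0.
have mG n : measurable_fun setT (G n).
  by apply: emeasurable_funD => //; exact: measurable_funeM.
have intG n : (\int[mu]_(t in `[0%R, (2 * pi)%R]) G n t <= (12 * pi * E 0)%:E + e%:E)%E.
  rewrite /G ge0_integralD//; last 3 first.
  - by move=> t _; apply: mule_ge0 => //; rewrite lee_fin.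
  - by apply: measurable_funTS; apply: measurable_funeM; exact: mI.
  - by move=> t _; rewrite lee_fin.
  rewrite ge0_integralZl_EFin//; last by apply: measurable_funTS; exact: mI.
  rewrite integral_cst//= lebesgue_measure_itv /= lte_fin mulr_gt0// sube0 -EFinM.
  apply: leeD; last first.
    by rewrite lee_fin; apply: le_trans (Hk n); rewrite le_eqVlt; apply/orP; left; apply/eqP; ring.
  rewrite (_ : 12 * pi * E 0 = 2 * (6 * pi * E 0)); last by ring.
  by rewrite EFinM lee_wpmul2l ?lee_fin.
pose W n (x : R3) : R := Num.min (sqlen x)^-1 n%:R.
have W0 n x : 0 <= W n x by rewrite le_min invr_ge0 sqlen_ge0 ler0n.
have mW n : measurable_fun setT (W n).
  by apply: measurable_minr => //; exact: (measurableT_comp measurable_inv measurable_sqlen).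
have mh n t : measurable_fun setT (fun x : R3 => (W n x * (v t x ^+ 2 + w t x ^+ 2))%:E).
  apply/measurable_EFinP; apply: measurable_funM => //.
  apply: measurable_funD; apply: measurable_funX; [exact: (sv t).1|exact: (sw t).1].
have cutoff n t : (\int[leb3]_x (W n x * (v t x ^+ 2 + w t x ^+ 2))%:E <= G n t)%E.
  pose V := flow_re (@a (k n)) (@b (k n)) t; pose U := flow_im (@a (k n)) (@b (k n)) t.
  have [[m1 _] [m2 _]] := sF (k n) t.
  have q1 : measurable_fun setT (fun x : R3 => ((v t x - V x) ^+ 2)%:E).
    by apply/measurable_EFinP; exact: measurable_funX.
  have q2 : measurable_fun setT (fun x : R3 => ((w t x - U x) ^+ 2)%:E).
    by apply/measurable_EFinP; exact: measurable_funX.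
  have q3 : measurable_fun setT (fun x : R3 => (flow_density (@a (k n)) (@b (k n)) t x)%:E).
    apply/measurable_EFinP.
    exact: (measurableT_comp (measurable_flow_density (@a (k n)) (@b (k n))) (pair1_measurable t)).
  have sq0 (y : R) : (0 <= (y ^+ 2)%:E)%E by rewrite lee_fin sqr_ge0.
  have n2 : 0 <= 2 * n%:R :> R by rewrite mulr_ge0.
  apply: (@le_trans _ _ (\int[leb3]_x (2%:E * (flow_density (@a (k n)) (@b (k n)) t x)%:E +
      (2 * n%:R)%:E * (((v t x - V x) ^+ 2)%:E + ((w t x - U x) ^+ 2)%:E)))%E).
    apply: ge0_le_integral => //.
    - by move=> x _; rewrite lee_fin mulr_ge0// addr_ge0// sqr_ge0.
    - exact: mh.
    - apply: emeasurable_funD; first by apply: measurable_funeM.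
      by apply: measurable_funeM; apply: emeasurable_funD.
    move=> x _; rewrite -!(EFinM, EFinD) lee_fin.
    (* This comparison with the truncated sum is what doubles [6 pi] to [12 pi]. *)
    have split (y z : R) : y ^+ 2 <= 2 * z ^+ 2 + 2 * (y - z) ^+ 2.
      rewrite -subr_ge0 (_ : _ - _ = (y - 2 * z) ^+ 2); [exact: sqr_ge0|ring].
    have h1 : W n x <= (sqlen x)^-1 by rewrite ge_min lexx.
    have h2 : W n x <= n%:R by rewrite ge_min lexx orbT.
    apply: (@le_trans _ _ (W n x * (2 * (V x ^+ 2 + U x ^+ 2)) +
      W n x * (2 * ((v t x - V x) ^+ 2 + (w t x - U x) ^+ 2)))).
      rewrite -mulrDr ler_wpM2l//.
      by have := split (v t x) (V x); have := split (w t x) (U x); lra.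
    apply: lerD.
      rewrite /flow_density -/V -/U mulrCA ler_wpM2l// mulrC ler_wpM2l//.
      by rewrite addr_ge0// sqr_ge0.
    rewrite mulrCA -mulrA ler_wpM2l// ler_wpM2r//.
    by rewrite addr_ge0// sqr_ge0.
  rewrite ge0_integralD//; last 4 first.
  - by move=> x _; apply: mule_ge0 => //; rewrite lee_fin.
  - by apply: measurable_funeM.
  - by move=> x _; apply: mule_ge0; [rewrite lee_fin|apply: adde_ge0].
  - by apply: measurable_funeM; apply: emeasurable_funD.
  rewrite ge0_integralZl_EFin//.
  rewrite ge0_integralZl_EFin//; last 2 first.
  - by move=> x _; apply: adde_ge0.
  - by apply: emeasurable_funD.
  rewrite ge0_integralD//.
  by apply: leeD => //; rewrite [leRHS]EFinM lee_wpmul2l ?lee_fin//; exact: residual.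
have F0 t (x : R3) : (0 <= ((v t x ^+ 2 + w t x ^+ 2) / sqlen x)%:E)%E.
  by rewrite lee_fin divr_ge0 ?sqlen_ge0// addr_ge0// sqr_ge0.
have limW (x : R3) (c : R) : (limn_einf (fun n => (W n x * c)%:E) = (c / sqlen x)%:E)%E.
  suff : ((W n x * c)%:E @[n --> \oo] --> (c / sqlen x)%:E)%E by move/cvg_limn_einf_sup => [].
  apply: cvg_near_cst; exists (Num.truncn (sqlen x)^-1).+1 => // n /= xn.
  rewrite mulrC; congr (_ * _)%:E; apply/min_idPl.
  by rewrite (le_trans (ltW (truncnS_gt _)))// ler_nat.
(* Fatou is used in [x] at each fixed [t], and then in [t] on [G]. *)
apply: (@le_trans _ _ (\int[mu]_(t in `[0%R, (2 * pi)%R]) limn_einf (G ^~ t))%E).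
  apply: le_integral_nonmeasurable => t _; first exact: integral_ge0.
  under eq_integral do rewrite -limW.
  apply: le_trans (le_limn_einf (cutoff ^~ t)).
  apply: fatou => //; first by move=> n; exact: mh.
  by move=> n x _; rewrite lee_fin mulr_ge0// addr_ge0// sqr_ge0.
apply: (@le_trans _ _ (limn_einf (fun n => \int[mu]_(t in `[0%R, (2 * pi)%R]) G n t))%E).
  by apply: fatou => // n; apply: measurable_funTS; exact: mG.
exact: limn_einf_le_cst.
Qed.

End time_average.

(** * Hermite coefficients of the oscillator flow *)

Section oscillator_flow_estimate.
Context {R : realType}.
Local Notation mu := (@lebesgue_measure R).
Local Notation leb3 := (@leb3 R).
Local Notation R3 := (R * R * R)%type.
Local Open Scope complex_scope.

Lemma mulci (z : R[i]) :
  'i * z = (- complex.Im z) +i* complex.Re z.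
Proof. by case: z => a b; rewrite /= -complexiE; simpc. Qed.

Lemma memL2_sqint (f : R3 -> R[i]) : memL2 f ->
  sqint leb3 (fun x => complex.Re (f x)) /\ sqint leb3 (fun x => complex.Im (f x)).
Proof.
have H (g : R3 -> R) : g \in Lfun leb3 2%:E -> sqint leb3 g.
  move=> gL; have /integrableP[_ ig] := Lfun2_integrable_sqr gL; split.
    by move: gL; rewrite inE => /andP[/[!inE] gm _].
  apply: le_lt_trans ig; rewrite le_eqVlt; apply/orP; left; apply/eqP.
  by apply: eq_integral => x _ /=; rewrite ger0_norm// sqr_ge0.
by move=> [h1 h2]; split; exact: H.
Qed.

Lemma cmod_sqr (z : R[i]) : cmod z ^+ 2 = complex.Re z ^+ 2 + complex.Im z ^+ 2.
Proof.
by case: z => a b; rewrite /cmod /= sqr_sqrtr// addr_ge0// sqr_ge0.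
Qed.

Lemma cmod_ge0 (z : R[i]) : 0 <= cmod z.
Proof. by case: z => a b; rewrite /cmod /= sqrtr_ge0. Qed.

Lemma normL2_sqr (f : R3 -> R[i]) : memL2 f ->
  (normL2 f ^+ 2 = (ip leb3 (fun x => complex.Re (f x)) (fun x => complex.Re (f x)) +
    ip leb3 (fun x => complex.Im (f x)) (fun x => complex.Im (f x)))%:E)%E.
Proof.
move=> /memL2_sqint[s1 s2].
have I : (\int[leb3]_x (`|(EFin \o (@cmod R \o f)) x| `^ 2) =
  (ip leb3 (fun x => complex.Re (f x)) (fun x => complex.Re (f x)) +
    ip leb3 (fun x => complex.Im (f x)) (fun x => complex.Im (f x)))%:E)%E.
  rewrite EFinD -!integral_sqrE// -ge0_integralD//; last 4 first.
  - by move=> x _; rewrite lee_fin sqr_ge0.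
  - by apply/measurable_EFinP/measurable_funX; exact: s1.1.
  - by move=> x _; rewrite lee_fin sqr_ge0.
  - by apply/measurable_EFinP/measurable_funX; exact: s2.1.
  apply: eq_integral => x _ /=; rewrite ger0_norm ?cmod_ge0//.
  by rewrite powR_mulrn ?cmod_ge0// cmod_sqr.
rewrite -I -(@poweR_Lnorm _ _ _ leb3 _ 2)//.
have sq (x : \bar R) : (0 <= x -> x ^+ 2 = x `^ 2)%E.
  case: x => [r|_|//]; last by rewrite poweRyr ?expe2 ?mulyy.
  by rewrite lee_fin => r0; rewrite poweR_EFin powR_mulrn.
by rewrite /normL2 sq// Lnorm_ge0.
Qed.

(** Testing the equation on [hb n] gives a rotation equation of frequency [lam n] for the real and
    imaginary parts of the coefficient. The initial condition holds almost everywhere, which is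
    enough to identify the norms. *)
Lemma time_average_oscillator_flow (d : R3 -> R[i]) (u : R -> R3 -> R[i]) :
  memL2 d -> oscillator_flow d u ->
  (\int[mu]_(t in `[0%R, (2 * pi)%R]) \int[leb3]_x (cmod (u t x) ^+ 2 / sqlen x)%:E
   <= (12 * pi)%:E * normL2 d ^+ 2)%E.
Proof.
move=> d2 [u2 _ ueq u0].
pose v t x := complex.Re (u t x); pose w t x := complex.Im (u t x).
have sv t : sqint leb3 (v t) by case: (memL2_sqint (u2 t)).
have sw t : sqint leb3 (w t) by case: (memL2_sqint (u2 t)).
have ode K (n : idx K) (t : R) :
    is_derive t 1 (fun s => ip leb3 (v s) (hb n)) ((lam n)%:R * ip leb3 (w t) (hb n)) /\
    is_derive t 1 (fun s => ip leb3 (w s) (hb n)) (- ((lam n)%:R * ip leb3 (v t) (hb n))).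
  have Sn : schwartz (@hb R K n) by exact: (schwartz_pgaussian (herm n.1.1, herm n.1.2, herm n.2)).
  have [z [[dz1 dz2]]] := ueq _ Sn t; rewrite mulci.
  have osc : oscillator (@hb R K n) = (fun x => (lam n)%:R * hb n x).
    by apply/funext => x; exact: oscillator_hb.
  have P (f : R3 -> R) : sqint leb3 f -> \int[leb3]_x (f x * oscillator (hb n) x) = (lam n)%:R * ip leb3 f (hb n).
    move=> sf; rewrite osc -/(ip leb3 f (fun x => (lam n)%:R * hb n x)) ipC.
    by rewrite ipZl// 1?ipC//; exact: sqint_hb.
  rewrite /pairing (P _ (sv t)) (P _ (sw t)) => -[E1 E2].
  have {}E1 : complex.Im z = - ((lam n)%:R * ip leb3 (v t) (hb n)) by rewrite -E1 opprK.
  by split; [rewrite -E2; exact: dz1|rewrite -E1; exact: dz2].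
have rot K (n : idx K) t := rotation_ode (fun s => (ode K n s).1) (fun s => (ode K n s).2) t.
have := time_average sv sw (fun K n t => (rot K n t).1) (fun K n t => (rot K n t).2).
have -> : (\int[mu]_(t in `[0%R, (2 * pi)%R]) \int[leb3]_x (cmod (u t x) ^+ 2 / sqlen x)%:E =
    \int[mu]_(t in `[0%R, (2 * pi)%R]) \int[leb3]_x ((v t x ^+ 2 + w t x ^+ 2) / sqlen x)%:E)%E.
  by apply: eq_integral => t _; apply: eq_integral => x _; rewrite cmod_sqr.
move/le_trans; apply; rewrite EFinM normL2_sqr//.
have [s1 s2] := memL2_sqint d2.
have F := @ae_filter_ringOfSetsType _ _ R leb3.
have E (f g : R3 -> R) : sqint leb3 f -> sqint leb3 g -> {ae leb3, forall x, f x = g x} ->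
    ip leb3 f f = ip leb3 g g.
  move=> sf sg fg; apply: EFin_inj; rewrite -!integral_sqrE//; apply: ae_eq_integral => //.
  - by apply/measurable_EFinP/measurable_funX; exact: sf.1.
  - by apply/measurable_EFinP/measurable_funX; exact: sg.1.
  - by apply: (@filterS _ _ F) fg => x /= -> _.
rewrite (E _ _ (sv 0) s1); last by apply: (@filterS _ _ F) u0 => x; rewrite /v => ->.
by rewrite (E _ _ (sw 0) s2)//; apply: (@filterS _ _ F) u0 => x; rewrite /w => ->.
Qed.

End oscillator_flow_estimate.

Local Open Scope complex_scope.

Theorem theorem5 (R : realType) :
  exists C : R, 0 < C /\
    forall d : R * R * R -> R[i],
      memL2 d ->
      (forall s1 s2 s3 : bool,
         {ae @leb3 R, forall x, d (reflect3 s1 s2 s3 x) = d x}) ->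
      forall u : R -> R * R * R -> R[i],
        oscillator_flow d u ->
        (\int[@lebesgue_measure R]_(t in `[0%R, (2 * pi)%R])
           \int[@leb3 R]_x (cmod (u t x) ^+ 2 / sqlen x)%:E
         <= C%:E * normL2 d ^+ 2)%E.
Proof.
exists (12 * pi); split; first by rewrite mulr_gt0// pi_gt0.
by move=> d d2 _ u du; exact: time_average_oscillator_flow.
Qed.
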